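(* Let $(R,\mathfrak m)$ be a commutative Noetherian local ring, $M$ a finitely generated $R$-module of dimension $d$, and $\underline x=(x_1,\ldots,x_d)$ a system of parameters of $M$ which is a dd-sequence of $M$. Then for every $k$ with $0<k\le d$ the $k$-th Euler-Poincaré characteristic $\chi_k(x_1^{n_1},\ldots,x_d^{n_d};M)$ is a polynomial in $(n_1,\ldots,n_d)$ (on all $d$-tuples of positive integers). Moreover, $$\chi_k(x_1^{n_1},\ldots,x_d^{n_d};M)=\sum_{i=0}^{p_k(M)}n_1\cdots n_i\,e\bigl(x_1,\ldots,x_i;(0:x_{i+1})_{H_{k-1}(x_{i+2},\ldots,x_d;M)}\bigr)$$ for all positive integers $n_1,\ldots,n_d$.
   Context: $\ell(N)$ is the length of an $R$-module $N$, and $(0:x)_N=\{a\in N: xa=0\}$. $H_i(\underline y;M)$ denotes the $i$-th Koszul homology module of $M$ with respect to $\underline y$ ($H_0(\emptyset;M)=M$), and for a system of parameters $\underline x$ of $M$, $\chi_k(\underline x;M)=\sum_{i\ge k}(-1)^{i-k}\ell(H_i(\underline x;M))$. For a finitely generated module $N$ and a sequence $\underline y$ in $\mathfrak m$ with $\ell(N/\underline yN)<\infty$, $e(\underline y;N)=\sum_i(-1)^i\ell(H_i(\underline y;N))$ is the Serre multiplicity; for the empty sequence $e(\emptyset;N)=\ell(N)$, so for $i=0$ the term in the sum is $\ell((0:x_1)_{H_{k-1}(x_2,\ldots,x_d;M)})$, with empty product $n_1\cdots n_i=1$. Invariant $p_k(M)$: for a system of parameters $\underline x$ of $M$, consider $\chi_k(x_1^{n_1},\ldots,x_d^{n_d};M)$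 as a function of positive integers $n_1,\ldots,n_d$; $p_k(M)$ is the least degree of all polynomials in $n_1,\ldots,n_d$ bounding this function from above. It is known to be independent of the choice of $\underline x$. The zero polynomial has degree $-\infty$, and a sum from $0$ to $-\infty$ is empty. A sequence $x_1,\ldots,x_s$ in $\mathfrak m$ is a d-sequence of a module $N$ if $(x_1,\ldots,x_{i-1})N:x_j=(x_1,\ldots,x_{i-1})N:x_ix_j$ for all $1\le i\le j\le s$. It is a dd-sequence of $M$ if for all $i\in\{1,\ldots,s\}$ and all positive integers $n_1,\ldots,n_s$, the sequence $x_1^{n_1},\ldots,x_i^{n_i}$ is a d-sequence of $M/(x_{i+1}^{n_{i+1}},\ldots,x_s^{n_s})M$. *)

(* Defs.v *)
From HB Require Import structures.
From mathcomp Require Import all_boot all_order all_algebra.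
From mathcomp Require Import ring_quotient generic_quotient.
From mathcomp Require Import boolp classical_sets.
From mathcomp Require Export mpoly.

Set Implicit Arguments.
Unset Strict Implicit.
Unset Printing Implicit Defensive.

Import GRing.Theory Num.Theory.
Local Open Scope ring_scope.

(* Arbitrary subsets are represented by boolean predicates [{pred T}]; since
   [`[< P >]] turns any proposition into a boolean, this is no restriction. *)

Section Submodules.
Variables (R : comNzRingType) (V : lmodType R).

Definition submod (S : submodClosed V) := {v : V | v \in S}.
HB.instance Definition _ (S : submodClosed V) := SubChoice.on (submod S).
HB.instance Definition _ (S : submodClosed V) :=
  GRing.SubChoice_isSubLmodule.Build R V (fun v => v \in S) (submod S)
    (GRing.subsemimodClosedP S).

(* S as a closed predicate for the underlying additive group of V, which is
   what the quotients of ring_quotient.v expect. *)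
Definition submod_group (S : submodClosed V) : {pred V} := fun v => v \in S.
Fact submod_group_closed S : zmod_closed (submod_group S).
Proof. exact: GRing.submod_closedB (GRing.submodClosedP S). Qed.
HB.instance Definition _ S :=
  GRing.isZmodClosed.Build V (submod_group S) (submod_group_closed S).

Definition quotmod (S : submodClosed V) := @Quotient.quot V (submod_group S).

Section Quotient.
Variable S : submodClosed V.
Local Open Scope quotient_scope.
HB.instance Definition _ := GRing.Zmodule.on (quotmod S).
HB.instance Definition _ := Quotient.on (quotmod S).

Lemma pi_quotD u v :
  \pi_(quotmod S) (u + v) = \pi_(quotmod S) u + \pi_(quotmod S) v.
Proof. exact: (raddfD (\pi_(Quotient.quot (submod_group S)))). Qed.

Definition quot_scale (a : R) (u : quotmod S) : quotmod S :=
  \pi_(quotmod S) (a *: repr u).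

Lemma quot_eqE (u v : V) :
  (u == v %[mod quotmod S]) = (u - v \in S).
Proof. by rewrite -[RHS]/(u - v \in submod_group S) Quotient.idealrBE. Qed.

Lemma pi_quot_scale a (v : V) :
  quot_scale a (\pi_(quotmod S) v) = \pi_(quotmod S) (a *: v).
Proof.
rewrite /quot_scale; apply/eqP; rewrite quot_eqE -scalerBr.
by apply: rpredZ; rewrite -quot_eqE reprK.
Qed.

Fact quot_scaleA a b u : quot_scale a (quot_scale b u) = quot_scale (a * b) u.
Proof.
by rewrite -[u]reprK (pi_quot_scale b) !pi_quot_scale scalerA.
Qed.
Fact quot_scale1 : left_id 1 quot_scale.
Proof. by move=> u; rewrite -[u]reprK pi_quot_scale scale1r. Qed.
Fact quot_scaleDr : right_distributive quot_scale +%R.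
Proof.
move=> a u v; rewrite -[u]reprK -[v]reprK.
by rewrite -pi_quotD !pi_quot_scale scalerDr pi_quotD.
Qed.
Fact quot_scaleDl u : {morph quot_scale^~ u : a b / a + b}.
Proof.
by move=> a b; rewrite -[u]reprK !pi_quot_scale scalerDl pi_quotD.
Qed.
HB.instance Definition _ := GRing.Zmodule_isLmodule.Build R (quotmod S)
  quot_scaleA quot_scale1 quot_scaleDr quot_scaleDl.
End Quotient.

Definition generated_by (s : seq V) (v : V) : Prop :=
  exists c : 'I_(size s) -> R, v = \sum_(i < size s) c i *: s`_i.

(* The submodule yV. *)
Definition idmul (y : seq R) : {pred V} := fun v =>
  `[< exists f : 'I_(size y) -> V, v = \sum_(i < size y) y`_i *: f i >].

Fact idmul_closed y : submod_closed (idmul y).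
Proof.
split=> [|a u v /asboolP[f ->] /asboolP[g ->]]; apply/asboolP.
  by exists (fun=> 0); rewrite big1 // => i _; rewrite scaler0.
exists (fun i => a *: f i + g i); rewrite scaler_sumr -big_split /=.
by apply: eq_bigr => i _; rewrite scalerDr !scalerA mulrC.
Qed.
HB.instance Definition _ y :=
  GRing.isSubmodClosed.Build R V (idmul y) (idmul_closed y).

(* (0 : x)_V *)
Definition ann_by (x : R) : {pred V} := fun v => x *: v == 0.

Fact ann_by_closed x : submod_closed (ann_by x).
Proof.
split=> [|a u v /eqP xu /eqP xv]; apply/eqP; first by rewrite scaler0.
by rewrite scalerDr xv addr0 scalerA mulrC -scalerA xu scaler0.
Qed.
HB.instance Definition _ x :=
  GRing.isSubmodClosed.Build R V (ann_by x) (ann_by_closed x).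

End Submodules.

Arguments idmul {R} V y.
Arguments ann_by {R} V x.

Section Chains.
Variables (T : Type) (P : {pred T} -> Prop).

(* A strict chain C 0 < C 1 < ... < C n of subsets satisfying P. *)
Definition has_chain (n : nat) : Prop :=
  exists C : nat -> {pred T},
    (forall i, (i <= n)%N -> P (C i)) /\
    (forall i, (i < n)%N ->
       {subset C i <= C i.+1} /\ ~ {subset C i.+1 <= C i}).

Definition max_chain (n : nat) : Prop :=
  has_chain n /\ forall m, has_chain m -> (m <= n)%N.

End Chains.

Section Modules.
Variable R : comNzRingType.

Definition has_length (V : lmodType R) (n : nat) : Prop :=
  max_chain (fun S : {pred V} => submod_closed S) n.

Definition finite_length (V : lmodType R) : Prop := exists n, has_length V n.

(* Modules of infinite length get the value 0. *)
Definition mod_length (V : lmodType R) : nat :=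
  xget 0%N [set n | has_length V n].

Definition noetherian : Prop :=
  forall I : {pred R^o}, submod_closed I ->
    exists s : seq R^o, forall a, a \in I <-> generated_by s a.

(* [idealr_closed] includes properness. *)
Definition maximal_ideal (m : {pred R}) : Prop :=
  idealr_closed m /\
  forall I : {pred R}, idealr_closed I -> {subset m <= I} -> {subset I <= m}.

Definition local_ring (m : {pred R}) : Prop :=
  maximal_ideal m /\ forall m' : {pred R}, maximal_ideal m' -> m' =i m.

Definition fin_gen (V : lmodType R) : Prop :=
  exists s : seq V, forall v, generated_by s v.

(* Krull dimension of R / Ann V; no d satisfies this when V = 0. *)
Definition has_dim (V : lmodType R) (d : nat) : Prop :=
  max_chain (fun p : {pred R} =>
    [/\ idealr_closed p, prime_idealr_closed p &
        forall a, (forall v : V, a *: v = 0) -> a \in p]) d.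

End Modules.

Section Koszul.
Variables (R : comNzRingType) (y : seq R) (V : lmodType R).
Local Notation n := (size y).

(* The whole Koszul complex: f is the element \sum_I f I (x) e_I, where
   e_I = e_{i_1} /\ ... /\ e_{i_p} for I = {i_1 < ... < i_p}. *)
Definition koszul := {ffun {set 'I_n} -> V}.
HB.instance Definition _ := GRing.Lmodule.on koszul.

(* d(v (x) e_I) = \sum_(j in I) (-1)^#|{l in I | l < j}| y_j v (x) e_(I \ j) *)
Definition koszul_diff (f : koszul) : koszul :=
  [ffun J : {set 'I_n} => \sum_(j | j \notin J)
     (-1) ^+ #|[set l in J | (l < j)%N]| *: (y`_j *: f (j |: J))].

Definition koszul_deg (i : nat) (f : koszul) : Prop :=
  forall I : {set 'I_n}, #|I| != i -> f I = 0.

Lemma koszul_diff_linear a f g :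
  koszul_diff (a *: f + g) = a *: koszul_diff f + koszul_diff g.
Proof.
apply/ffunP=> J; rewrite !ffunE scaler_sumr -big_split /=.
apply: eq_bigr => j _; rewrite !ffunE !scalerDr !scalerA; congr (_ *: _ + _).
by rewrite -!mulrA [y`_j * a]mulrC mulrCA.
Qed.

Lemma koszul_diff0 : koszul_diff 0 = 0.
Proof.
by apply/ffunP=> J; rewrite !ffunE big1 // => j _; rewrite ffunE !scaler0.
Qed.

Lemma koszul_diffK f : koszul_diff (koszul_diff f) = 0.
Proof.
apply/ffunP=> J; rewrite !ffunE.
pose a (j : 'I_n) := #|[set l in J | (l < j)%N]|.
pose g (j k : 'I_n) : V :=
  (-1) ^+ (a j + (a k + (j < k))) *: (y`_j *: (y`_k *: f (k |: (j |: J)))).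
have gN (j k : 'I_n) : (j < k)%N -> g k j = - g j k.
  move=> ltjk; rewrite /g ltjk ltnNge (ltnW ltjk) /= addn0 addn1 !addnS exprS.
  rewrite mulN1r scaleNr opprK [(a k + a j)%N]addnC; congr (_ *: _).
  by rewrite !scalerA mulrC finset.setUCA.
transitivity (\sum_(j | j \notin J) \sum_(k | k \notin J)
  ((if (j < k)%N then g j k else 0) + (if (k < j)%N then g j k else 0))).
  apply: eq_bigr => j jJ; rewrite ffunE !scaler_sumr.
  rewrite [RHS](bigD1 j) //= ltnn addr0 add0r.
  apply: eq_big => [k|k]; first by rewrite in_setU1 negb_or andbC.
  rewrite in_setU1 negb_or => /andP[kj kJ].
  have -> : (if (j < k)%N then g j k else 0) + (if (k < j)%N then g j k else 0)
      = g j k.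
    case: (ltngtP j k) => [_|_|/val_inj jk]; rewrite ?addr0 ?add0r //.
    by rewrite jk eqxx in kj.
  rewrite /g -/(a j); set b := #|_|.
  have -> : b = (a k + (j < k))%N.
    rewrite /b /a; case: ltnP => [ltjk|lekj].
      rewrite -[RHS]addnC -(_ : j |: [set l in J | (l < k)%N] =
          [set l in j |: J | (l < k)%N]) ?cardsU1 ?inE ?(negPf jJ) //.
      by apply/setP=> l; rewrite !inE; case: eqP => // ->; rewrite ltjk.
    rewrite addn0; apply: eq_card => l; rewrite !inE; case: eqP => // ->.
    by rewrite ltnNge lekj !andbF.
  rewrite [in RHS]exprD !scalerA !mulrA; congr (_ * _ *: _).
  by rewrite mulrAC.
under eq_bigr do rewrite big_split /=.
rewrite big_split /= [X in _ + X]exchange_big /= -big_split big1 //= => j _.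
rewrite -big_split big1 //= => k _; case: ltnP => [ltjk|_].
  by rewrite (gN _ _ ltjk) subrr.
by rewrite addr0.
Qed.

Lemma koszul_deg_closed i a f g :
  koszul_deg i f -> koszul_deg i g -> koszul_deg i (a *: f + g).
Proof.
by move=> hf hg I hI; rewrite !ffunE hf // hg // scaler0 addr0.
Qed.

Definition cycles (i : nat) : {pred koszul} := fun f =>
  `[< koszul_deg i f /\ koszul_diff f = 0 >].

Fact cycles_closed i : submod_closed (cycles i).
Proof.
split=> [|a f g /asboolP[df zf] /asboolP[dg zg]]; apply/asboolP.
  by split; [move=> I _; rewrite ffunE | exact: koszul_diff0].
split; first exact: koszul_deg_closed.
by rewrite koszul_diff_linear zf zg scaler0 addr0.
Qed.
HB.instance Definition _ i :=
  GRing.isSubmodClosed.Build R koszul (cycles i) (cycles_closed i).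

Definition boundaries (i : nat) : {pred submod (cycles i)} := fun z =>
  `[< exists2 g : koszul, koszul_deg i.+1 g & val z = koszul_diff g >].

Fact boundaries_closed i : submod_closed (@boundaries i).
Proof.
split=> [|a f g /asboolP[f' df Ef] /asboolP[g' dg Eg]]; apply/asboolP.
  by exists 0; [move=> I _; rewrite ffunE | rewrite koszul_diff0].
exists (a *: f' + g'); first exact: koszul_deg_closed.
by rewrite koszul_diff_linear -Ef -Eg.
Qed.
HB.instance Definition _ i :=
  GRing.isSubmodClosed.Build R (submod (cycles i)) (@boundaries i)
    (boundaries_closed i).

Definition koszulH (i : nat) : lmodType R := quotmod (@boundaries i).

End Koszul.

Section Characteristics.
Variable R : comNzRingType.

(* H_i(y; V) = 0 for i > size y. *)
Definition chi (k : nat) (y : seq R) (V : lmodType R) : int :=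
  \sum_(k <= i < (size y).+1) (-1) ^+ (i - k) * (mod_length (koszulH y V i))%:Z.

(* The Serre multiplicity e(y; V). *)
Definition serre_mult (y : seq R) (V : lmodType R) : int := chi 0 y V.

Definition pows d (x : d.-tuple R) (n : 'I_d -> nat) : d.-tuple R :=
  [tuple tnth x i ^+ n i | i < d].

Definition positive d (n : 'I_d -> nat) : Prop := forall i, (0 < n i)%N.

(* (y_1, ..., y_i) V : y_j = (y_1, ..., y_i) V : y_(i+1) y_j, with 0-based
   indices. *)
Definition d_sequence (y : seq R) (V : lmodType R) : Prop :=
  forall i j, (i <= j < size y)%N ->
    forall v : V, y`_j *: v \in idmul V (take i y) <->
      (y`_i * y`_j) *: v \in idmul V (take i y).

Definition dd_sequence (m : {pred R}) s (x : s.-tuple R) (V : lmodType R) :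
  Prop :=
  {subset x <= m} /\
  forall i, (0 < i <= s)%N -> forall n : 'I_s -> nat, positive n ->
    d_sequence (take i (pows x n)) (quotmod (idmul V (drop i (pows x n)))).

Definition sop (m : {pred R}) d (x : d.-tuple R) (V : lmodType R) : Prop :=
  [/\ has_dim V d, {subset x <= m} & finite_length (quotmod (idmul V x))].

Definition peval d (P : {mpoly rat[d]}) (n : 'I_d -> nat) : rat :=
  P.@[fun i => (n i)%:R].

Definition chi_bound (k : nat) d (x : d.-tuple R) (V : lmodType R)
  (P : {mpoly rat[d]}) : Prop :=
  forall n, positive n -> (chi k (pows x n) V)%:~R <= peval P n.

(* [pk_size m k V] is p_k(V) + 1, in the convention of [msize]: it is 0 when
   p_k(V) = -oo, so that a sum over 0 <= i <= p_k(V) is a sum over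
   i < pk_size m k V. The system of parameters y is arbitrary, as p_k(V) does
   not depend on it. *)
Definition pk_size (m : {pred R}) (k : nat) (V : lmodType R) : nat :=
  xget 0%N [set p | exists d (y : d.-tuple R), [/\ sop m y V,
    exists2 P, chi_bound k y V P & msize P = p &
    forall P, chi_bound k y V P -> (p <= msize P)%N]].

End Characteristics.

(* Main.v *)
From HB Require Import structures.
Require Import Defs.
From mathcomp Require Import all_boot all_order all_algebra.
From mathcomp Require Import ring_quotient generic_quotient.
From mathcomp Require Import boolp classical_sets.
From mathcomp Require Import zify ring.

Set Implicit Arguments.
Unset Strict Implicit.
Unset Printing Implicit Defensive.

Import Order.TTheory GRing.Theory Num.Theory.
Local Open Scope ring_scope.

(* For every additive nonnegative function l on a class of modules closed under
   subquotients and extensions, l^r(N) = l(N/rN) - l(0 :_N r) is again additive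
   and nonnegative.  Splitting the long exact sequence of a mapping cone,
     chi_k^l(y, ys; M) = l((0 : y)_{H_{k-1}(ys; M)}) + chi_k^{l^y}(ys; M),
   so for any system of parameters chi_k is the sum of the
   e(x_1, .., x_i; (0 : x_{i+1})_{H_{k-1}(x_{i+2}, .., x_d; M)}), and it only
   remains to see how the terms vary with the exponents.  The factor n_1 .. n_i
   comes from l^{rs} = l^r + l^s.

   For a dd-sequence, Krull's intersection theorem removes or inserts powers in
   the ideals occurring in the definition, which gives, for each subset S of the
   indices, two facts about H = H_p(x_S; M): if i < j are not in S, a power of
   x_j kills (0 : x_i)_H, and (0 : x_j^2)_H = (0 : x_j)_H.  Splitting off x_i and
   x_j in both orders from chi_{p+1}(x_i, x_j, x_S) then expresses
   l((0 : x_i)_{H_p(x_j, x_S)}) through annihilators of x_j, which do not change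
   when x_j is replaced by a power.

   The recursion also shows chi_k >= 0 and chi_k(r, ys) <= chi_k(rs, ys).  Hence
   exchanging one parameter changes chi_k of powers by at most a rescaling of the
   exponents; prime avoidance joins any two systems of parameters by such
   exchanges, so the degree p_k(M) may be read off from the dd-sequence. *)

(** * Submodules and lengths of subquotients *)

(** In the inductions along a sequence M stays fixed: passing from K(ys) to the cone K(y, ys)
    replaces l by l^y, so every statement is proved for all additive l at once. The price is the
    domain: H_p(ys; M) may have infinite length until enough parameters are used, so each l comes
    with a class D, and l^r lives on the noetherian N with N/rN in D. Nonnegativity of l^r rests on
    the chain condition: the r-power torsion of N contributes 0, and r is injective on the rest.

    The swap of x_i and x_j needs colon conditions modulo arbitrary subsets of the parameters, while
    the dd-condition gives them only modulo an initial together with a final segment.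

    Homology is kept as a pair of cycles and boundaries inside one complex; quotient modules appear
    only where the definitions of the theorem, or an argument about whole modules, require them. *)

Section Smod.
Variable R : comNzRingType.
Implicit Types V W : lmodType R.

Definition smod_closed V (S : V -> Prop) :=
  S 0 /\ forall a u v, S u -> S v -> S (a *: u + v).

(** Prop-valued, so that sums, colons and images of submodules are plain predicates, and submodules
    with the same elements are equal ([smod_eq]). *)
Record smod V := Smod { scar :> V -> Prop; scarP : smod_closed scar }.

Lemma smod_eq V (A B : smod V) : (forall v, A v <-> B v) -> A = B.
Proof.
case: A B => A hA [B hB] /= e.
have eAB : A = B by apply/predeqP.
by subst B; congr Smod; apply: Prop_irrelevance.
Qed.

Section Membership.
Variables (V : lmodType R) (A : smod V).
Lemma sm0 : A 0. Proof. exact: (scarP A).1. Qed.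
Lemma smD u v : A u -> A v -> A (u + v).
Proof. by move=> hu hv; rewrite -[u]scale1r; apply: (scarP A).2. Qed.
Lemma smZ a u : A u -> A (a *: u).
Proof. by move=> hu; rewrite -[_ *: _]addr0; apply: (scarP A).2 => //; apply: sm0. Qed.
Lemma smN u : A u -> A (- u).
Proof. by move=> hu; rewrite -scaleN1r; apply: smZ. Qed.
Lemma smB u v : A u -> A v -> A (u - v).
Proof. by move=> hu hv; apply: smD => //; apply: smN. Qed.
Lemma smDr u v : A u -> (A (u + v) <-> A v).
Proof.
move=> hu; split=> h; last exact: smD.
by rewrite -[v](addKr u) addrC; apply: smB.
Qed.
Lemma smBl u v : A v -> (A (u - v) <-> A u).
Proof. by move=> hv; rewrite addrC smDr //; apply: smN. Qed.
Lemma sm_sum I (r : seq I) (P : pred I) (F : I -> V) :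
  (forall i, P i -> A (F i)) -> A (\sum_(i <- r | P i) F i).
Proof. by move=> h; apply: big_ind => //; [apply: sm0 | apply: smD]. Qed.
End Membership.

Definition sle V (A B : smod V) := forall v, A v -> B v.

Program Definition s0 V : smod V := @Smod V (fun v => v = 0) _.
Next Obligation. by split=> // a u v -> ->; rewrite scaler0 addr0. Qed.
Program Definition sT V : smod V := @Smod V (fun v => True) _.
Next Obligation. by []. Qed.
Program Definition scap V (A B : smod V) := @Smod V (fun v => A v /\ B v) _.
Next Obligation.
split; first by split; apply: sm0.
by move=> a u v [? ?] [? ?]; split; apply: smD => //; apply: smZ.
Qed.
Program Definition sadd V (A B : smod V) :=
  @Smod V (fun v => exists a b, [/\ A a, B b & v = a + b]) _.
Next Obligation.
split; first by exists 0, 0; rewrite addr0; split=> //; apply: sm0.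
move=> r u v [a [b [ha hb ->]]] [a' [b' [ha' hb' ->]]].
exists (r *: a + a'), (r *: b + b'); split; try by apply: smD => //; apply: smZ.
by rewrite scalerDr addrACA.
Qed.
Program Definition scol V (A : smod V) (r : R) := @Smod V (fun v => A (r *: v)) _.
Next Obligation.
split; first by rewrite scaler0; apply: sm0.
by move=> a u v hu hv; rewrite scalerDr scalerA mulrC -scalerA; apply: smD => //; apply: smZ.
Qed.
Program Definition smul V (r : R) (A : smod V) :=
  @Smod V (fun v => exists2 a, A a & v = r *: a) _.
Next Obligation.
split; first by exists 0; rewrite ?scaler0 //; apply: sm0.
move=> c u v [a ha ->] [b hb ->]; exists (c *: a + b).
  by apply: smD => //; apply: smZ.
by rewrite scalerDr !scalerA mulrC.
Qed.

Definition lin V W (f : V -> W) := forall a u v, f (a *: u + v) = a *: f u + f v.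
Section Lin.
Variables (V W : lmodType R) (f : V -> W).
Hypothesis hf : lin f.
Lemma lin0 : f 0 = 0.
Proof.
have := hf 1 0 0; rewrite !scale1r addr0 => /eqP.
by rewrite -subr_eq0 opprD addNKr oppr_eq0 => /eqP.
Qed.
Lemma linD u v : f (u + v) = f u + f v.
Proof. by have := hf 1 u v; rewrite !scale1r. Qed.
Lemma linZ a u : f (a *: u) = a *: f u.
Proof. by have := hf a u 0; rewrite !addr0 lin0 addr0. Qed.
Lemma linN u : f (- u) = - f u.
Proof. by rewrite -scaleN1r linZ scaleN1r. Qed.
Lemma linB u v : f (u - v) = f u - f v.
Proof. by rewrite linD linN. Qed.
End Lin.

Lemma lin_scale V (r : R) : lin (fun v : V => r *: v).
Proof. by move=> a u v; rewrite scalerDr !scalerA mulrC. Qed.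

Definition simg V W (f : V -> W) (hf : lin f) (A : smod V) : smod W.
Proof.
exists (fun w => exists2 a, A a & w = f a); split.
  by exists 0; [apply: sm0 | rewrite lin0].
move=> c u v [a ha ->] [b hb ->]; exists (c *: a + b); last by rewrite hf.
by apply: smD => //; apply: smZ.
Defined.
Definition spre V W (f : V -> W) (hf : lin f) (A : smod W) : smod V.
Proof.
exists (fun v => A (f v)); split; first by rewrite lin0 //; apply: sm0.
by move=> c u v hu hv; rewrite hf; apply: smD => //; apply: smZ.
Defined.

(* f induces an isomorphism from A/B to A'/B'; quotients are never formed, a
   subquotient is the pair (A, B). *)
Definition siso V W (f : V -> W) (A B : smod V) (A' B' : smod W) :=
  [/\ lin f, forall a, A a -> A' (f a),
      forall a', A' a' -> exists2 a, A a & B' (a' - f a)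
    & forall a, A a -> (B' (f a) <-> B a)].

Lemma sle_refl V (A : smod V) : sle A A. Proof. by []. Qed.
Lemma sle_trans V (B A C : smod V) : sle A B -> sle B C -> sle A C.
Proof. by move=> h1 h2 v /h1 /h2. Qed.
Lemma sle_anti V (A B : smod V) : sle A B -> sle B A -> A = B.
Proof. by move=> h1 h2; apply: smod_eq => v; split; [apply: h1 | apply: h2]. Qed.
Lemma sle_addl V (A B : smod V) : sle A (sadd A B).
Proof. by move=> v hv; exists v, 0; rewrite addr0; split=> //; apply: sm0. Qed.
Lemma sle_addr V (A B : smod V) : sle B (sadd A B).
Proof. by move=> v hv; exists 0, v; rewrite add0r; split=> //; apply: sm0. Qed.
Lemma sadd_le V (A B C : smod V) : sle A C -> sle B C -> sle (sadd A B) C.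
Proof. by move=> h1 h2 _ [a [b [/h1 ha /h2 hb ->]]]; apply: smD. Qed.
Lemma smul_le V r (A : smod V) : sle (smul r A) A.
Proof. by move=> _ [a ha ->]; apply: smZ. Qed.
Lemma scap_l V (A B : smod V) : sle (scap A B) A. Proof. by move=> v []. Qed.
Lemma scap_Tl V (A : smod V) : scap (sT V) A = A.
Proof. by apply: smod_eq => v; split=> [[]|]. Qed.
Lemma scap_r V (A B : smod V) : sle (scap A B) B. Proof. by move=> v []. Qed.
Lemma le_scap V (A B C : smod V) : sle C A -> sle C B -> sle C (scap A B).
Proof. by move=> h1 h2 v hv; split; [apply: h1 | apply: h2]. Qed.
Lemma le_scol V (A : smod V) r : sle A (scol A r).
Proof. by move=> v; apply: smZ. Qed.
Lemma sadd_idl V (A B : smod V) : sle A B -> sadd A B = B.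
Proof. by move=> h; apply: sle_anti; [apply: sadd_le | apply: sle_addr]. Qed.
Lemma saddC V (A B : smod V) : sadd A B = sadd B A.
Proof.
by apply: sle_anti; apply: sadd_le; first [exact: sle_addl | exact: sle_addr].
Qed.
Lemma sadd_idr V (A B : smod V) : sle B A -> sadd A B = A.
Proof. by rewrite saddC; apply: sadd_idl. Qed.
Lemma saddA V (A B C : smod V) : sadd A (sadd B C) = sadd (sadd A B) C.
Proof.
apply: smod_eq => v; split.
  move=> [a [_ [ha [b [c [hb hc ->]]] ->]]]; exists (a + b), c; rewrite addrA; split=> //.
  by exists a, b.
move=> [_ [c [[a [b [ha hb ->]]] hc ->]]]; exists a, (b + c); rewrite addrA; split=> //.
by exists b, c.
Qed.
Lemma sadd_mono V (A A' B B' : smod V) :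
  sle A A' -> sle B B' -> sle (sadd A B) (sadd A' B').
Proof. by move=> h1 h2 _ [a [b [/h1 ha /h2 hb ->]]]; exists a, b. Qed.
Lemma smul_mono V r (A B : smod V) : sle A B -> sle (smul r A) (smul r B).
Proof. by move=> h _ [a /h ha ->]; exists a. Qed.
Lemma s0_le V (A : smod V) : sle (s0 V) A. Proof. by move=> _ ->; apply: sm0. Qed.
Lemma le_sT V (A : smod V) : sle A (sT V). Proof. by []. Qed.
Lemma smul_sub V r (A : smod V) a : A a -> smul r A (r *: a).
Proof. by move=> ha; exists a. Qed.
Lemma smul1 V (A : smod V) : smul 1 A = A.
Proof.
by apply: smod_eq => v; split=> [[a ha ->]|hv]; [rewrite scale1r | exists v; rewrite ?scale1r].
Qed.

End Smod.

Arguments s0 {R V}.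
Arguments sT {R V}.

Section Length.
Variable R : comNzRingType.
Implicit Types V W : lmodType R.

Definition schain V (B A : smod V) n := exists C : nat -> smod V,
  (forall i, (i <= n)%N -> sle B (C i) /\ sle (C i) A) /\
  (forall i, (i < n)%N -> sle (C i) (C i.+1) /\ ~ sle (C i.+1) (C i)).

Definition fl V (A B : smod V) :=
  sle B A /\ exists n, forall m, schain B A m -> (m <= n)%N.

Definition is_slen V (A B : smod V) n :=
  schain B A n /\ forall m, schain B A m -> (m <= n)%N.

Definition slen V (A B : smod V) : nat := xget 0%N [set n | is_slen A B n].

Lemma schain0 V (A B : smod V) : sle B A -> schain B A 0.
Proof. by move=> h; exists (fun=> B); split=> // i _; split. Qed.

Lemma schain_le V (A B : smod V) n : schain B A n -> sle B A.
Proof. by move=> [C [h _]]; have [] := h 0%N isT; apply: sle_trans. Qed.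

Lemma is_slen_uniq V (A B : smod V) n m : is_slen A B n -> is_slen A B m -> n = m.
Proof. by move=> [h1 h2] [h3 h4]; apply/eqP; rewrite eqn_leq h2 // h4. Qed.

Lemma slenE V (A B : smod V) n : is_slen A B n -> slen A B = n.
Proof. by move=> h; apply: xget_subset1 => // m k; apply: is_slen_uniq. Qed.

Lemma fl_slen V (A B : smod V) : fl A B <-> exists n, is_slen A B n.
Proof.
split=> [[hle [n hn]]|[n [h1 h2]]]; last by split; [apply: schain_le h1 | exists n].
have ex : exists m, `[< schain B A m >] by exists 0%N; apply/asboolP/schain0.
have ub m : `[< schain B A m >] -> (m <= n)%N by move/asboolP/hn.
case: (ex_maxnP ex ub) => m /asboolP hm mx; exists m; split=> // k hk.
by apply/mx/asboolP.
Qed.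

Lemma fl_slenP V (A B : smod V) : fl A B -> is_slen A B (slen A B).
Proof. by move=> /fl_slen [n hn]; rewrite (slenE hn). Qed.

Lemma schain_ext V (A B C : smod V) n :
  schain B C n -> sle C A -> ~ sle A C -> schain B A n.+1.
Proof.
move=> h hCA hn; have hBC := schain_le h; case: h => E [h1 h2].
exists (fun i => if (i <= n)%N then E i else A); split=> [i hi|i].
  case: ifP => [/h1 [? ?]|_]; first by split=> //; apply: sle_trans hCA.
  by split=> //; apply: sle_trans hCA.
rewrite ltnS => hi; rewrite hi; case: ltnP => [/h2 //|hni].
have -> : i = n by apply/eqP; rewrite eqn_leq hi.
have [_ hEC] := h1 n (leqnn n); split; first exact: sle_trans hCA.
by move=> hAE; apply: hn; apply: sle_trans hEC.
Qed.

Lemma schain_mono V (A A' B B' : smod V) n :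
  sle B' B -> sle A A' -> schain B A n -> schain B' A' n.
Proof.
move=> hB hA [E [h1 h2]]; exists E; split=> // i /h1 [? ?].
by split; [apply: sle_trans hB _ | apply: sle_trans hA].
Qed.

Lemma schain_weak V (C : nat -> smod V) n :
  (forall i, (i < n)%N -> sle (C i) (C i.+1)) ->
  schain (C 0%N) (C n) (\sum_(i < n) ~~ `[< sle (C i.+1) (C i) >]).
Proof.
elim: n => [|n IHn] h; first by rewrite big_ord0; apply: schain0.
rewrite big_ord_recr /=; have {}IHn := IHn (fun i hi => h i (ltnW hi)).
case: asboolP => hC /=; rewrite ?addn0 ?addn1.
  exact: (schain_mono _ (h n (ltnSn n)) IHn).
exact: schain_ext IHn (h n (ltnSn n)) hC.
Qed.

Lemma schain_cat V (A B C : smod V) n m :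
  schain C B n -> schain B A m -> schain C A (n + m).
Proof.
move=> hCB [E [h1 h2]].
have hBE := (h1 0%N isT).1.
elim: m A E h1 h2 hBE => [|m IHm] A E h1 h2 hBE.
  rewrite addn0; apply: (schain_mono _ _ hCB) => //.
  exact: sle_trans hBE (h1 0%N isT).2.
have {}IHm : schain C (E m) (n + m).
  apply: (IHm _ E) => [i hi|i hi|]; [|exact: h2 (ltnW hi)|by []].
  split; first exact: (h1 i (leqW hi)).1.
  have: forall k, (i + k <= m)%N -> sle (E i) (E (i + k)%N).
    elim=> [|k IHk]; first by rewrite addn0 => _ v.
    rewrite addnS => hk; apply: sle_trans (IHk (ltnW hk)) _.
    by have [] := h2 (i + k)%N (leqW hk).
  by move/(_ (m - i)%N); rewrite subnKC //; apply.
have [h3 h4] := h2 m (ltnSn m); rewrite addnS.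
have hEA := (h1 m.+1 (leqnn _)).2.
exact: (schain_mono (fun _ h => h) hEA (schain_ext IHm h3 h4)).
Qed.

(** Adding B to the members of the chain and intersecting them with B gives chains above and below
    B; by the modular law no strict step collapses in both. *)
Lemma schain_split V (A B C : smod V) n : sle C B -> sle B A -> schain C A n ->
  exists a b, [/\ schain C B a, schain B A b & (n <= a + b)%N].
Proof.
move=> hCB hBA [E [h1 h2]].
pose X i := sadd (E i) B; pose Y i := scap (E i) B.
have hX := @schain_weak _ X n; have hY := @schain_weak _ Y n.
exists (\sum_(i < n) ~~ `[< sle (Y i.+1) (Y i) >])%N, (\sum_(i < n) ~~ `[< sle (X i.+1) (X i) >])%N.
split.
- apply: (schain_mono _ _ (hY _)).
  + by apply: le_scap => //; apply: (h1 0%N isT).1.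
  + exact: scap_r.
  + by move=> i /h2 [h _] v [/h ? ?].
- apply: (schain_mono _ _ (hX _)).
  + exact: sle_addr.
  + by apply: sadd_le => //; apply: (h1 n (leqnn _)).2.
  + by move=> i /h2 [h _]; apply: sadd_mono.
rewrite -big_split /= -[n in (n <= _)%N]card_ord -sum1_card leq_sum // => i _.
have [h3 h4] := h2 i (ltn_ord i).
case: asboolP => hYi; case: asboolP => hXi //; case: h4 => v hv.
have [e [b [he hb ev]]] : X i v by apply: hXi; apply: sle_addl.
have hbE : E i.+1 b.
  by rewrite -[b](addKr e) addrC -ev; apply: smB => //; apply: h3.
have [hbi _] : Y i b by apply: hYi; split.
by rewrite ev; apply: smD.
Qed.

(** Chains travel forward as f(E) + B' and back as the intersection of A with the preimage.
    Strictness survives since f is injective on A/B and onto A'/B'. *)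
Lemma schain_iso V W (f : V -> W) (A B : smod V) (A' B' : smod W) n :
  sle B A -> sle B' A' -> siso f A B A' B' -> schain B A n <-> schain B' A' n.
Proof.
move=> hBA hBA' [hf h1 h2 h3]; split=> -[E [h4 h5]].
  exists (fun i => sadd (simg hf (E i)) B'); split=> i /=.
    move=> /h4 [h h']; split; first exact: sle_addr.
    by apply: sadd_le => // _ [a /h' /h1 ? ->].
  move=> hi; have [h6 h7] := h5 i hi; split.
    by apply: sadd_mono => // _ [a /h6 ha ->]; exists a.
  move=> h8; apply: h7 => v hv; have hAv := (h4 _ hi).2 v hv.
  have [_ [b [[e he ->] hb ev]]] : sadd (simg hf (E i)) B' (f v).
    by apply: h8; apply: sle_addl; exists v.
  have hAe := (h4 _ (ltnW hi)).2 _ he.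
  have : B (v - e).
    by rewrite -h3; [rewrite (linB hf) ev addrAC subrr add0r | apply: smB].
  by move=> /((h4 _ (ltnW hi)).1) h; rewrite -[v](subrK e); apply: smD.
exists (fun i => scap A (spre hf (E i))); split=> i /=.
  move=> /h4 [h h']; split; last exact: scap_l.
  by move=> v hv; split; [apply: hBA | apply: h; apply/h3 => //; apply: hBA].
move=> hi; have [h6 h7] := h5 i hi; split; first by move=> v [? /h6].
move=> h8; apply: h7 => v hv; have [a ha hb] := h2 _ ((h4 _ hi).2 _ hv).
have hE j : (j <= n)%N -> E j v <-> E j (f a).
  move=> /h4 [h _]; rewrite -[v](subrK (f a)); rewrite smDr //; exact: h.
by apply/(hE i (ltnW hi)); have [] : scap A (spre hf (E i)) a by apply: h8; split=> //; apply/(hE _ hi).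
Qed.

Lemma is_slen_iso V W (f : V -> W) (A B : smod V) (A' B' : smod W) n :
  sle B A -> sle B' A' -> siso f A B A' B' -> is_slen A B n <-> is_slen A' B' n.
Proof.
move=> h1 h2 /(schain_iso _ h1 h2) h3.
by split=> -[h4 h5]; split=> [|m /h3]; by [apply/h3 | apply: h5].
Qed.

End Length.

(** * Additive functions *)

Section Additive.
Variable R : comNzRingType.
Implicit Types V W : lmodType R.

(* Maximal condition on the submodules between B and A. *)
Definition noeth V (A B : smod V) := sle B A /\
  forall P : smod V -> Prop, (exists C, [/\ P C, sle B C & sle C A]) ->
  exists C, [/\ P C, sle B C, sle C A &
    forall C', P C' -> sle C' A -> sle C C' -> sle C' C].

Lemma noeth_acc V (A B : smod V) (C : nat -> smod V) : noeth A B ->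
  (forall i, sle B (C i)) -> (forall i, sle (C i) A) ->
  (forall i, sle (C i) (C i.+1)) -> exists n, forall i, sle (C i) (C n).
Proof.
move=> [_ h] h1 h2 h3.
have mono i j : (i <= j)%N -> sle (C i) (C j).
  move/subnKC <-; elim: (j - i)%N => [|k IHk]; first by rewrite addn0 => v.
  by rewrite addnS; apply: sle_trans IHk (h3 _).
have [|_ [[n ->] _ _ hn]] := h (fun X => exists i, X = C i).
  by exists (C 0%N); split=> //; exists 0%N.
exists n => i; have [/mono //|/ltnW/mono hi] := leqP i n.
by apply: hn => //; exists i.
Qed.

Definition dom := forall V : lmodType R, smod V -> smod V -> Prop.
Definition sfun := forall V : lmodType R, smod V -> smod V -> int.

(* l is additive and nonnegative on the Serre subcategory D of noetherian
   modules. *)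
Record addf (D : dom) (l : sfun) : Prop := Addf {
  ad_noeth : forall V (A B : smod V), D V A B -> noeth A B;
  ad_refl : forall V (A : smod V), D V A A;
  ad_split : forall V (A B C : smod V), sle C B -> sle B A ->
    D V A C <-> D V A B /\ D V B C;
  ad_add : forall V (A B C : smod V), sle C B -> sle B A -> D V A C ->
    l V A C = l V A B + l V B C;
  ad_iso : forall V W (f : V -> W) (A B : smod V) (A' B' : smod W),
    sle B A -> sle B' A' -> siso f A B A' B' ->
    (D V A B <-> D W A' B') /\ (D V A B -> l V A B = l W A' B');
  ad_ge0 : forall V (A B : smod V), D V A B -> 0 <= l V A B }.

(** The zero function carries only its domain: this packages the closure properties of noetherian
    modules, so that [ad_quot], [ad_ext] and the like serve for noetherianity too. *)
Lemma noeth_addf : addf (@noeth) (fun _ _ _ => 0).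
Proof.
split=> //.
- move=> V A; split=> // P [C [pC h1 h2]]; exists C; split=> // C' _ h3 _.
  by apply: sle_trans h3 _.
- move=> V A B C hCB hBA; split=> [[h0 h]|[[_ h1] [_ h2]]].
    split; split=> // P [E [pE h1 h2]].
      have [|X [[pX hBX] _ hXA hX]] := h (fun X => P X /\ sle B X).
        by exists E; split=> //; apply: sle_trans hCB _.
      exists X; split=> // C' pC' h3 h4; apply: hX => //; split=> //.
      exact: sle_trans h4.
    have [|X [[pX hBX] hCX hXA hX]] := h (fun X => P X /\ sle X B).
      by exists E; split=> //; apply: sle_trans hBA.
    exists X; split=> // C' pC' h3 h4; apply: hX => //; exact: sle_trans hBA.
  split; first exact: sle_trans hBA.
  move=> P [E [pE h3 h4]].
  (* E1 has a maximal sum with B; E2, among the members with at least this sum, has a maximal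
     intersection with B. The modular law makes E2 maximal. *)
  have [|X [[E1 [pE1 hE1 hE1' ->]] hBX hXA hX]] :=
    h1 (fun X => exists E, [/\ P E, sle C E, sle E A & X = sadd E B]).
    exists (sadd E B); split; [by exists E | exact: sle_addr | exact: sadd_le].
  have [|Y [[E2 [pE2 hE2 hE2' hE2X ->]] _ _ hY]] :=
    h2 (fun Y => exists E, [/\ P E, sle C E, sle E A, sle (sadd E1 B) (sadd E B)
      & Y = scap E B]).
    exists (scap E1 B); split; last exact: scap_r.
      by exists E1; split.
    exact: le_scap.
  exists E2; split=> // E3 pE3 hE3 h23 v hv.
  have hC3 : sle C E3 by apply: sle_trans h23.
  have hmono : sle (sadd E2 B) (sadd E3 B) by apply: sadd_mono.
  have : sadd E3 B v by apply: sle_addl.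
  move/(hX _ _ (sadd_le hE3 hBA) (sle_trans hE2X hmono)).
  case; first by exists E3.
  move=> a [b [ha hb ev]].
  have [e [c [he hc ea]]] : sadd E2 B a by apply: hE2X; apply: sle_addl.
  have e3 : scap E3 B (c + b).
    split; last exact: smD.
    have -> : c + b = v - e by rewrite ev ea -[e + c + b]addrA [e + _]addrC addrK.
    by apply: smB => //; apply: h23.
  have [] : scap E2 B (c + b).
    apply: hY e3; first by exists E3; split=> //; apply: sle_trans hmono.
      exact: scap_r.
    by move=> u [/h23 ? ?].
  by move=> h5 _; rewrite ev ea -addrA; apply: smD.
- move=> V W f A B A' B' hBA hBA' [hf h1 h2 h3]; split=> //; split=> -[_ h]; split=> // P [E [pE h4 h5]].
    have [|X [[E1 [pE1 hE1 hE1' ->]] hBX hXA hX]] :=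
      h (fun X => exists E, [/\ P E, sle B' E, sle E A' & X = scap A (spre hf E)]).
      exists (scap A (spre hf E)); split; [by exists E| | exact: scap_l].
      by move=> v hv; split; [apply: hBA | apply: h4; apply/h3 => //; apply: hBA].
    exists E1; split=> // E2 pE2 hE2 hE12 w hw.
    have hE2' : sle B' E2 by apply: sle_trans hE12.
    have [a ha hb] := h2 _ (hE2 _ hw).
    have hE2a : E2 (f a) by rewrite -[f a](subKr w); apply: smB => //; apply: hE2'.
    have [_ ha'] : scap A (spre hf E1) a.
      apply: hX; [by exists E2; split | exact: scap_l | | by split].
      by move=> u [? /hE12].
    by rewrite -[w](subrK (f a)); apply: smD => //; apply: hE1.
  pose im (E : smod V) := sadd (simg hf E) B'.
  have [|X [[E1 [pE1 hE1 hE1' ->]] hBX hXA hX]] :=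
    h (fun X => exists E, [/\ P E, sle B E, sle E A & X = im E]).
    exists (im E); split; [by exists E | exact: sle_addr |].
    by apply: sadd_le => // _ [a /h5/h1 ? ->].
  exists E1; split=> // E2 pE2 hE2 hE12 v hv.
  have [_ [b [[e he ->] hb ev]]] : im E1 (f v).
    apply: hX; [by exists E2; split=> //; apply: sle_trans hE12 | | |].
    - by apply: sadd_le => // _ [a /hE2/h1 ? ->].
    - by apply: sadd_mono => // _ [a /hE12 ha ->]; exists a.
    - by apply: sle_addl; exists v.
  rewrite -[v](subrK e); apply: smD => //; apply: hE1; apply/h3.
    by apply: smB; [apply: hE2 | apply: hE1'].
  by rewrite (linB hf) ev addrAC subrr add0r.
Qed.

Section Theory.
Variables (D : dom) (l : sfun).
Hypothesis hD : addf D l.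

Lemma ad_le V (A B : smod V) : D A B -> sle B A.
Proof. by case/(ad_noeth hD). Qed.

Lemma ad_id V (A : smod V) : l A A = 0.
Proof.
have h : sle A A by [].
by apply: (addrI (l A A)); rewrite -(ad_add hD h h (ad_refl hD A)) addr0.
Qed.

Lemma ad_quot V (A B C : smod V) : sle C B -> sle B A -> D A C -> D A B.
Proof. by move=> h1 h2 /(ad_split hD h1 h2) []. Qed.
Lemma ad_sub V (A B C : smod V) : sle C B -> sle B A -> D A C -> D B C.
Proof. by move=> h1 h2 /(ad_split hD h1 h2) []. Qed.
Lemma ad_ext V (A B C : smod V) : D A B -> D B C -> D A C.
Proof. by move=> h1 h2; apply/(ad_split hD (ad_le h2) (ad_le h1)). Qed.

Lemma siso_add V (A B : smod V) : siso idfun A (scap A B) (sadd A B) B.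
Proof.
split=> //= [a|_ [a [b [ha hb ->]]]|a ha]; first exact: sle_addl.
  by exists a; rewrite // addrAC subrr add0r.
by split=> [|[]].
Qed.
Lemma ad_iso2D V (A B : smod V) : D A (scap A B) <-> D (sadd A B) B.
Proof. by have [] := ad_iso hD (@scap_l _ _ A B) (@sle_addr _ _ A B) (siso_add A B). Qed.
Lemma ad_iso2 V (A B : smod V) : D A (scap A B) -> l (sadd A B) B = l A (scap A B).
Proof. by have [_ h /h ->] := ad_iso hD (@scap_l _ _ A B) (@sle_addr _ _ A B) (siso_add A B). Qed.

Lemma siso_mul V (A B : smod V) r :
  siso (fun v => r *: v) A (scap A (scol B r)) (sadd B (smul r A)) B.
Proof.
split=> [|a ha|_ [b [_ [hb [a ha ->] ->]]]|a ha]; first exact: lin_scale.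
- by apply: sle_addr; exists a.
- by exists a; rewrite // addrK.
- by split=> [h|[]].
Qed.
Lemma ad_mulD V (A B : smod V) r :
  D A (scap A (scol B r)) <-> D (sadd B (smul r A)) B.
Proof. by have [] := ad_iso hD (@scap_l _ _ _ _) (@sle_addl _ _ _ _) (siso_mul A B r). Qed.
Lemma ad_mul V (A B : smod V) r : D A (scap A (scol B r)) ->
  l A (scap A (scol B r)) = l (sadd B (smul r A)) B.
Proof. by have [_] := ad_iso hD (@scap_l _ _ _ _) (@sle_addl _ _ _ _) (siso_mul A B r). Qed.

(** Only N/rN is required to lie in D; that (0 : r)_N does too follows by Artin-Rees ([Dr_ker]), for
    which N has to be noetherian. *)
Definition Dr (r : R) : dom := fun V A B => noeth A B /\ D A (sadd B (smul r A)).
Definition lr (r : R) : sfun := fun V A B =>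
  l A (sadd B (smul r A)) - l (scap A (scol B r)) B.

Lemma Dr_le r V (A B : smod V) : Dr r A B -> sle B A. Proof. by case=> -[]. Qed.

(** Multiplication by r^n maps A/rA onto r^n A / r^(n+1) A, all modulo B. *)
Lemma Dr_pow r n V (A B : smod V) : Dr r A B -> D A (sadd B (smul (r ^+ n) A)).
Proof.
move=> h; have hBA := Dr_le h; case: h => _ h.
have hle m : sle (sadd B (smul (r ^+ m) A)) A.
  by apply: sadd_le => //; apply: smul_le.
elim: n => [|n IHn].
  by rewrite expr0 smul1 sadd_idl //; apply: ad_refl hD _ _.
apply: (ad_ext IHn).
have e : sadd (sadd B (smul (r ^+ n.+1) A)) (smul (r ^+ n) A) = sadd B (smul (r ^+ n) A).
  rewrite -saddA; congr sadd; apply: sadd_idl => _ [a ha ->].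
  by rewrite exprSr -scalerA; apply: smul_sub; apply: smZ.
rewrite -e; apply/ad_mulD; apply: ad_quot h; last exact: scap_l.
apply: sadd_le => [v hv|_ [a ha ->]]; split.
- exact: hBA.
- by apply: smZ; apply: sle_addl.
- exact: smZ.
- by apply: sle_addr => /=; exists a; rewrite // scalerA -exprSr.
Qed.

(* Artin-Rees for a principal ideal. *)
Lemma Dr_sub r V (A B C : smod V) : sle C B -> sle B A -> Dr r A C -> Dr r B C.
Proof.
move=> hCB hBA h; have [nC _] := h; split.
  by have /(ad_split noeth_addf hCB hBA) [] := nC.
(* Once the colons B : r^i stabilise at n, r^(n+1) a in B forces r^n a in B; so B meets C + r^(n+1)
   A inside C + rB. *)
have [i|i|i|n hn] := @noeth_acc _ A C (fun i => scap A (scol B (r ^+ i))) nC.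
- by apply: le_scap; [apply: sle_trans hBA | apply: sle_trans hCB _; apply: le_scol].
- exact: scap_l.
- by move=> v [? h1]; split=> //=; rewrite exprS -scalerA; apply: smZ.
have h1 := Dr_pow n.+1 h.
have {h1} : D (sadd B (sadd C (smul (r ^+ n.+1) A))) (sadd C (smul (r ^+ n.+1) A)).
  apply: ad_sub h1; first exact: sle_addr.
  apply: sadd_le => //; apply: sadd_le; first exact: sle_trans hBA.
  exact: smul_le.
move/ad_iso2D; apply: ad_quot.
  move=> v [h1 [c [_ [hc [a ha ->] e]]]]; rewrite e.
  have [|_ h2] := hn n.+1 a.
    by split=> //=; rewrite -(smDr _ (hCB _ hc)) -e.
  exists c, (r ^+ n.+1 *: a); split=> //.
  by rewrite exprS -scalerA; apply: smul_sub.
by apply: sadd_le => //; apply: smul_le.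
Qed.
End Theory.
End Additive.

(** * Additivity of l^r, and its behaviour under products of elements *)

Section AdditiveQuotient.
Variables (R : comNzRingType) (D : dom R) (l : sfun R).
Hypothesis hD : addf D l.
Implicit Types V W : lmodType R.

Lemma Dr_ker r V (A B : smod V) : Dr D r A B -> D (scap A (scol B r)) B.
Proof.
move=> h; have hBA := Dr_le h.
have /(Dr_sub hD) : sle B (scap A (scol B r)) by apply: le_scap => //; apply: le_scol.
move=> /(_ r A (@scap_l _ _ _ _) h) [_].
by rewrite sadd_idr // => _ [a [_ ?] ->].
Qed.

Lemma siso_Dr r V W (f : V -> W) (A B : smod V) (A' B' : smod W) :
  sle B A -> sle B' A' -> siso f A B A' B' ->
  siso f A (sadd B (smul r A)) A' (sadd B' (smul r A')) /\
  siso f (scap A (scol B r)) B (scap A' (scol B' r)) B'.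
Proof.
move=> hBA hBA' [hf h1 h2 h3]; split; split=> //.
- by move=> w /h2 [a ha hb]; exists a => //; apply: sle_addl.
- move=> a ha; split=> [[b [_ [hb [a' ha' ->] e]]]|[b [_ [hb [a' ha' ->] ->]]]].
    have [a1 ha1 hb1] := h2 _ ha'.
    exists (a - r *: a1), (r *: a1); split; [|by apply: smul_sub|by rewrite subrK].
    apply/h3; first by apply: smB => //; apply: smZ.
    rewrite (linB hf) (linZ hf) e -addrA -scalerBr.
    by apply: smD => //; apply: smZ.
  rewrite (linD hf) (linZ hf); exists (f b), (r *: f a'); split=> //.
    by apply/h3 => //; apply: hBA.
  by apply: smul_sub; apply: h1.
- move=> a [ha hb]; split; first exact: h1.
  by rewrite /= -(linZ hf); apply/h3 => //; apply: smZ.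
- move=> w [/h2 [a ha hb] hw]; exists a => //; split=> //=.
  apply/h3; first exact: smZ.
  rewrite (linZ hf) -[f a](subKr w) scalerBr; apply: smB => //.
  exact: smZ.
- by move=> a [ha _]; apply: h3.
Qed.

(** N/(0 : r) is isomorphic to rN, so for N in D the kernel and the cokernel of r have the same
    value. *)
Lemma lr_fin r V (A B : smod V) : D A B -> lr l r A B = 0.
Proof.
move=> h; have hBA := ad_le hD h.
have h1 : sle (sadd B (smul r A)) A by apply: sadd_le => //; apply: smul_le.
have h2 : sle B (scap A (scol B r)) by apply: le_scap => //; apply: le_scol.
have e1 := ad_add hD (@sle_addl _ _ B (smul r A)) h1 h.
have e2 := ad_add hD h2 (@scap_l _ _ _ _) h.
have e3 := ad_mul hD (ad_quot hD h2 (@scap_l _ _ _ _) h).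
by apply/eqP; rewrite /lr subr_eq0 -(inj_eq (addIr (l (sadd B (smul r A)) B))) -e1 e2 e3 addrC.
Qed.

Lemma Dr_nil r n V (A B : smod V) :
  sle (smul (r ^+ n) A) B -> Dr D r A B -> D A B.
Proof. by move=> h /(Dr_pow hD n); rewrite sadd_idr. Qed.

Lemma lr_nil r n V (A B : smod V) :
  sle (smul (r ^+ n) A) B -> Dr D r A B -> lr l r A B = 0.
Proof. by move=> h /(Dr_nil h)/lr_fin. Qed.

Lemma Dr_addf r : addf (Dr D r) (lr l r).
Proof.
have hsplit V (A B C : smod V) : sle C B -> sle B A ->
    Dr D r A C <-> Dr D r A B /\ Dr D r B C.
  move=> hCB hBA; split=> [h|[[n1 h1] [n2 h2]]].
    split; last exact: (Dr_sub hD hCB hBA h).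
    case: h => n1 h1; split; first exact: (ad_quot (noeth_addf R) hCB hBA n1).
    apply: (ad_quot hD _ _ h1); first exact: sadd_mono.
    by apply: sadd_le => //; apply: smul_le.
  split; first exact: (ad_ext (noeth_addf R) n1 n2).
  apply: (ad_ext hD h1).
  have -> : sadd B (smul r A) = sadd B (sadd C (smul r A)).
    by rewrite saddA [sadd B C]saddC (sadd_idl hCB).
  apply/(ad_iso2D hD); apply: (ad_quot hD _ _ h2); last exact: scap_l.
  apply: le_scap; first by apply: sadd_le => //; apply: smul_le.
  by apply: sadd_mono => //; apply: smul_mono.
have hiso V W (f : V -> W) (A B : smod V) (A' B' : smod W) :
    sle B A -> sle B' A' -> siso f A B A' B' ->
    (Dr D r A B <-> Dr D r A' B') /\ (Dr D r A B -> lr l r A B = lr l r A' B').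
  move=> hBA hBA' h; have [h1 h2] := siso_Dr r hBA hBA' h.
  have [h3 h4] := ad_iso hD (sadd_le hBA (@smul_le _ _ r A)) (sadd_le hBA' (@smul_le _ _ r A')) h1.
  have [_ h6] : (D (scap A (scol B r)) B <-> D (scap A' (scol B' r)) B') /\
      (D (scap A (scol B r)) B -> l (scap A (scol B r)) B = l (scap A' (scol B' r)) B').
    apply: (ad_iso hD _ _ h2);
    by apply: le_scap => //; apply: le_scol.
  have [h7 _] := ad_iso (noeth_addf R) hBA hBA' h.
  split; first by split=> -[/h7 ? /h3 ?]; split.
  by move=> hA; rewrite /lr h4 ?h6 //; [apply: Dr_ker | case: hA].
have hadd V (A B C : smod V) : sle C B -> sle B A -> Dr D r A C ->
    lr l r A C = lr l r A B + lr l r B C.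
  move=> hCB hBA h; have /(hsplit _ _ _ _ hCB hBA) [hAB hBC] := h.
  have kAC := Dr_ker h; have kAB := Dr_ker hAB; have kBC := Dr_ker hBC.
  case: h hAB hBC => nAC h [_ hAB] [_ hBC].
  rewrite /lr.
  set X := scap A (scol C r) in kAC *; set X' := scap A (scol B r) in kAB *.
  have hCX : sle C X by apply: le_scap; [apply: sle_trans hBA | apply: le_scol].
  have eB : scap B (scol C r) = scap X B.
    by apply: smod_eq => v; split=> [[? ?]|[[? ?] ?]]; split=> //; split=> //; apply: hBA.
  rewrite eB in kBC *.
  have hCXB : sle C (scap X B) by apply: le_scap.
  have hXBX' : sle (sadd X B) X'.
    apply: sadd_le; last by apply: le_scap => //; apply: le_scol.
    by move=> v [? ?]; split=> //; apply: hCB.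
  have eBA : sadd B (sadd C (smul r A)) = sadd B (smul r A).
    by rewrite saddA [sadd B C]saddC (sadd_idl hCB).
  have hCA : sle (sadd C (smul r A)) (sadd B (smul r A)) by apply: sadd_mono.
  have hBrA : sle (sadd B (smul r A)) A by apply: sadd_le => //; apply: smul_le.
  have hCrB : sle (sadd C (smul r B)) (scap B (sadd C (smul r A))).
    apply: le_scap; first by apply: sadd_le => //; apply: smul_le.
    by apply: sadd_mono => //; apply: smul_mono.
  have e1 := ad_add hD hCA hBrA h.
  have e2 : l (sadd B (smul r A)) (sadd C (smul r A)) = l B (scap B (sadd C (smul r A))).
    by rewrite -eBA; apply: (ad_iso2 hD); apply: (ad_quot hD hCrB _ hBC); apply: scap_l.
  have e3 := ad_add hD hCrB (@scap_l _ _ _ _) hBC.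
  have e4 := ad_add hD hCXB (@scap_l _ _ _ _) kAC.
  have e5 := ad_iso2 hD (ad_quot hD hCXB (@scap_l _ _ _ _) kAC).
  have e6 := ad_add hD (@sle_addr _ _ X B) hXBX' kAB.
  (* The connecting map of the snake lemma: multiplication by r takes the kernel on A/B, modulo what
     comes from the kernel on A/C, onto the kernel of the map from B/rB to A/rA (modulo C). *)
  have e7 : l X' (sadd X B) = l (scap B (sadd C (smul r A))) (sadd C (smul r B)).
    have [|_ ->] // := ad_iso hD (f := fun v => r *: v) hXBX' hCrB; last first.
      by apply: (ad_quot hD _ hXBX' kAB); apply: sle_addr.
    split; first exact: lin_scale.
    - move=> a [ha hb]; split=> //.
      by exists 0, (r *: a); rewrite add0r; split; [apply: sm0 | apply: smul_sub |].
    - move=> b [hb [c [_ [hc [a ha ->] eb]]]]; exists a.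
        split=> //=; rewrite -[r *: a](addKr c) -eb addrC; apply: smB => //.
        exact: hCB.
      by rewrite eb addrK; apply: sle_addl.
    - move=> a [ha hb]; split=> [[c [_ [hc [b hb' ->] e]]]|].
        exists (a - b), b; split; rewrite ?subrK //; split.
          by apply: smB => //; apply: hBA.
        by rewrite /= scalerBr e addrK.
      move=> [x [b [[? ?] hb' ->]]]; exists (r *: x), (r *: b).
      by split; rewrite ?scalerDr //; apply: smul_sub.
  by rewrite e1 e2 e3 e4 -e5 e6 e7; ring.
split=> //.
- by move=> V A B [].
- move=> V A; split; first exact: ad_refl (noeth_addf R) _ _.
  by rewrite sadd_idr; [apply: ad_refl hD _ _ | apply: smul_le].
(* T is the r-power torsion of A/B, reached at a finite stage n. Its value is 0, and r is injective
   on A/T, so that only a cokernel remains. *)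
- move=> V A B h; have hBA := Dr_le h; have [nAB _] := h.
  have [i|i|i|n hn] := @noeth_acc _ _ A B (fun i => scap A (scol B (r ^+ i))) nAB.
  + by apply: le_scap => //; apply: le_scol.
  + exact: scap_l.
  + by move=> v [? h1]; split=> //=; rewrite exprS -scalerA; apply: smZ.
  set T := scap A (scol B (r ^+ n)) in hn.
  have hBT : sle B T by apply: le_scap => //; apply: le_scol.
  have hTA : sle T A by apply: scap_l.
  have /(hsplit _ _ _ _ hBT hTA) [hAT hT] := h.
  rewrite (hadd _ _ _ _ hBT hTA h) (@lr_nil r n _ T B) // ?addr0; last first.
    by move=> _ [a [_ ha] ->].
  rewrite /lr; have -> : scap A (scol T r) = T.
    apply: smod_eq => v; split=> [[ha [_ hv]]|hv]; last first.
      by split; [apply: hTA | apply: smZ].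
    by apply: (hn n.+1); split=> //=; rewrite exprSr -scalerA.
  by rewrite (ad_id hD) subr0; apply: (ad_ge0 hD); case: hAT.
Qed.

Lemma Dr_dvd r s V (A B : smod V) : Dr D (r * s) A B -> Dr D r A B.
Proof.
move=> [n h]; split=> //; apply: (ad_quot hD _ _ h).
  by apply: sadd_mono => // _ [a ha ->]; rewrite -scalerA; apply: smul_sub; apply: smZ.
by case: n => ? _; apply: sadd_le => //; apply: smul_le.
Qed.

(** Additivity along the exact sequence 0 -> (0 : s) -> (0 : rs) -> (0 : r) -> N/sN -> N/rsN -> N/rN
    -> 0 for N = A/B. *)
Lemma lr_mul r s V (A B : smod V) : Dr D (r * s) A B ->
  lr l (r * s) A B = lr l r A B + lr l s A B.
Proof.
move=> h; have hr := Dr_dvd h; have hs : Dr D s A B by apply: (@Dr_dvd s r); rewrite mulrC.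
have hBA := Dr_le h.
have kr := Dr_ker hr; have ks := Dr_ker hs; have krs := Dr_ker h.
case: h hr hs => n h [_ hr] [_ hs]; rewrite /lr.
set X := scap A (scol B r) in kr *; set Y := scap A (scol B s) in ks *.
set Z := scap A (scol B (r * s)) in krs *.
have sl r' : sle (smul r' A) A by apply: smul_le.
have hXA : sle X A by apply: scap_l.
have hBX : sle B X by apply: le_scap => //; apply: le_scol.
have hBY : sle B Y by apply: le_scap => //; apply: le_scol.
have hYZ : sle Y Z by move=> v [? ?]; split=> //=; rewrite -scalerA; apply: smZ.
have hBrA : sle (sadd B (smul r A)) A by apply: sadd_le.
have hrs : sle (sadd B (smul (r * s) A)) (sadd B (smul r A)).
  by apply: sadd_mono => // _ [a ha ->]; rewrite -scalerA; apply: smul_sub; apply: smZ.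
have hXs : sle (sadd X (smul s A)) A by apply: sadd_le.
have hBXs : sle (sadd B (smul s A)) (sadd X (smul s A)) by apply: sadd_mono.
have e1 := ad_add hD hrs hBrA h.
have e2 : l (sadd B (smul r A)) (sadd B (smul (r * s) A)) = l A (sadd X (smul s A)).
  have [|_ <-] // := ad_iso hD (f := fun v => r *: v) hXs hrs; last first.
    exact: (ad_quot hD hBXs hXs hs).
  split; first exact: lin_scale.
  - by move=> a ha; apply: sle_addr; apply: smul_sub.
  - move=> _ [b [_ [hb [a ha ->] ->]]]; exists a => //.
    by rewrite addrK; apply: sle_addl.
  - move=> a ha; split=> [[b [_ [hb [a' ha' ->] e]]]|[x [_ [[hx hx'] [a' ha' ->] ->]]]].
      exists (a - s *: a'), (s *: a'); split; rewrite ?subrK //; last exact: smul_sub.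
      split=> /=; first by apply: smB => //; apply: smZ.
      by rewrite scalerBr scalerA e addrK.
    exists (r *: x), (r * s *: a'); rewrite scalerDr scalerA; split=> //.
    exact: smul_sub.
have e3 := ad_add hD hBXs hXs hs.
have eX : sadd X (sadd B (smul s A)) = sadd X (smul s A).
  by rewrite saddA (sadd_idr hBX).
have hBXB : sle B (scap X (sadd B (smul s A))) by apply: le_scap => //; apply: sle_addl.
have e4 : l (sadd X (smul s A)) (sadd B (smul s A)) = l X (scap X (sadd B (smul s A))).
  by rewrite -eX; apply: (ad_iso2 hD); apply: (ad_quot hD hBXB _ kr); apply: scap_l.
have e5 := ad_add hD hBXB (@scap_l _ _ _ _) kr.
have e6 := ad_add hD hBY hYZ krs.
have e7 : l Z Y = l (scap X (sadd B (smul s A))) B.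
  have [|_ <-] // := ad_iso hD (f := fun v => s *: v) hYZ hBXB; last first.
    exact: (ad_quot hD hBY hYZ krs).
  split; first exact: lin_scale.
  - move=> a [ha hb]; split; last by apply: sle_addr; apply: smul_sub.
    by split=> /=; [apply: smZ | rewrite scalerA].
  - move=> x [[hx hx'] [b [_ [hb [a ha ->] ex]]]]; exists a; last by rewrite ex addrK.
    split=> //=; rewrite -scalerA -[s *: a](addKr b) -ex scalerDr scalerN addrC.
    by apply: smB => //; apply: smZ.
  - by move=> a [ha _]; split=> [|[]].
by rewrite e1 e2 e3 e4 e5 e6 e7; ring.
Qed.

Lemma Dr_exp r n V (A B : smod V) : Dr D r A B -> Dr D (r ^+ n) A B.
Proof. by move=> h; split; [case: h | apply: (Dr_pow hD n h)]. Qed.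

Lemma lr_exp r n V (A B : smod V) : Dr D r A B ->
  lr l (r ^+ n) A B = n%:Z * lr l r A B.
Proof.
move=> h; elim: n => [|n IHn].
  have hBA := Dr_le h; rewrite mul0r expr0 /lr smul1 sadd_idl //.
  suff -> : scap A (scol B 1) = B by rewrite !(ad_id hD) subr0.
  apply: smod_eq => v; split=> [[_]|hv]; rewrite /= ?scale1r //.
  by split=> //; apply: hBA.
rewrite exprS lr_mul -?exprS; last exact: Dr_exp.
by rewrite IHn; lia.
Qed.

End AdditiveQuotient.

(** * Length as an additive function, and its iterates *)

Section LengthAdditive.
Variable R : comNzRingType.
Implicit Types V W : lmodType R.

Lemma fl_noeth V (A B : smod V) : fl A B -> noeth A B.
Proof.
move=> [hBA [n hn]]; split=> // P [E [pE hBE hEA]].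
have ex : exists m, `[< exists C, [/\ P C, sle C A & schain B C m] >].
  by exists 0%N; apply/asboolP; exists E; split=> //; apply: schain0.
have ub m : `[< exists C, [/\ P C, sle C A & schain B C m] >] -> (m <= n)%N.
  by move/asboolP => [C [_ h1 h2]]; apply: hn; apply: schain_mono h2.
case: (ex_maxnP ex ub) => m /asboolP [C [pC hCA hC]] hm.
exists C; split=> //; first exact: schain_le hC.
move=> C' pC' hC'A hCC'; apply: contrapT => h.
suff : (m.+1 <= m)%N by rewrite ltnn.
by apply: hm; apply/asboolP; exists C'; split=> //; apply: schain_ext hC _ h.
Qed.

Definition len : sfun R := fun V A B => (slen A B)%:Z.

Lemma len_addf : addf (@fl R) len.
Proof.
have hsplit V (A B C : smod V) : sle C B -> sle B A ->
    fl A C <-> fl A B /\ fl B C.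
  move=> hCB hBA; split=> [[h [n hn]]|[[_ [n hn]] [_ [m hm]]]].
    split; split=> //; exists n => k hk; apply: hn; exact: schain_mono hk.
  split; first exact: sle_trans hBA.
  exists (m + n)%N => k /(schain_split hCB hBA) [a [b [ha hb /leq_trans]]]; apply.
  by apply: leq_add; [apply: hm | apply: hn].
split=> //.
- exact: fl_noeth.
- move=> V A; split=> //; exists 0%N => -[|m] // [C [h1 h2]].
  have [_ []] := h2 0%N isT.
  by apply: sle_trans (h1 1%N isT).2 (h1 0%N isT).1.
- move=> V A B C hCB hBA h.
  have /(hsplit _ _ _ _ hCB hBA) [/fl_slenP [h1 h2] /fl_slenP [h3 h4]] := h.
  have [h5 h6] := fl_slenP h; rewrite /len -PoszD; congr Posz.
  apply/eqP; rewrite eqn_leq addnC (h6 _ (schain_cat h3 h1)) andbT.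
  have [a [b [ha hb /leq_trans]]] := schain_split hCB hBA h5; apply.
  by apply: leq_add; [apply: h4 | apply: h2].
- move=> V W f A B A' B' hBA hBA' h; have hs n := is_slen_iso n hBA hBA' h.
  split; first by rewrite !fl_slen; split=> -[n /hs]; exists n.
  by move=> /fl_slenP /hs /slenE hl; rewrite /len hl.
Qed.

End LengthAdditive.

(** * Iterating l^r along a sequence *)

Section Iterated.
Variable R : comNzRingType.
Implicit Types (V W : lmodType R) (D : dom R) (l : sfun R) (ys : seq R).

(* ll len ys is the Serre multiplicity e(ys; -). *)
Definition Dl D ys : dom R := foldl (@Dr R) D ys.
Definition ll l ys : sfun R := foldl (@lr R) l ys.

Fixpoint sidl V ys (A : smod V) : smod V :=
  if ys is y :: s then sadd (smul y A) (sidl s A) else s0.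

Lemma Dl_addf D l ys : addf D l -> addf (Dl D ys) (ll l ys).
Proof. by elim: ys D l => //= y s IHs D l h; apply/IHs/Dr_addf. Qed.

Lemma sidl_le V ys (A : smod V) : sle (sidl ys A) A.
Proof.
elim: ys => [|y s IHs] /=; first exact: s0_le.
by apply: sadd_le => //; apply: smul_le.
Qed.

(** Shows that the domain depends on ys only through the ideal they generate; hence the order of ys
    is irrelevant to it. *)
Lemma DlE D l ys V (A B : smod V) : addf D l ->
  Dl D ys A B <-> noeth A B /\ D V A (sadd B (sidl ys A)).
Proof.
move=> hD; elim: ys D l hD => [|y s IHs] D l hD /=.
  rewrite sadd_idr; last exact: s0_le.
  by split=> [h|[]//]; split=> //; apply: (ad_noeth hD).
rewrite (IHs _ _ (Dr_addf hD y)) /Dr -saddA [sadd (sidl s A) _]saddC.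
split=> [[? []]|[h1 h2]] //; split=> //; split=> //.
apply: (ad_quot (noeth_addf R) _ _ h1); first exact: sle_addl.
by apply: sadd_le; [case: h1 | apply: sidl_le].
Qed.

Lemma sidl_mem V ys (A : smod V) y a : y \in ys -> A a -> sidl ys A (y *: a).
Proof.
elim: ys => // z s IHs; rewrite inE => /orP[/eqP ->|/IHs h] ha.
  by apply: sle_addl; apply: smul_sub.
by apply: sle_addr; apply: h.
Qed.

Lemma sidl_min V ys (A B : smod V) :
  (forall y a, y \in ys -> A a -> B (y *: a)) -> sle (sidl ys A) B.
Proof.
elim: ys => [|y s IHs] /= h; first exact: s0_le.
apply: sadd_le; first by move=> _ [a ha ->]; apply: h; rewrite ?mem_head.
by apply: IHs => z a hz; apply: h; rewrite inE hz orbT.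
Qed.

Lemma sidl_sub V ys zs (A : smod V) : {subset ys <= zs} -> sle (sidl ys A) (sidl zs A).
Proof. by move=> h; apply: sidl_min => y a /h; apply: sidl_mem. Qed.

Lemma sidl_eqi V ys zs (A : smod V) : ys =i zs -> sidl ys A = sidl zs A.
Proof. by move=> h; apply: sle_anti; apply: sidl_sub => y; rewrite h. Qed.

End Iterated.

(** * The Koszul complex as an iterated mapping cone *)

Section Koszul.
Variables (R : comNzRingType) (M : lmodType R).
Implicit Types (y : R) (ys s : seq R).

(* The Koszul complex K(y, s) is the mapping cone of y on K(s). *)
Fixpoint kos ys : lmodType R :=
  if ys is _ :: s then (kos s * kos s)%type else M.

(** The pair (a, b) stands for a plus the product of the new basis element with b; the sign makes
    the differential square to zero. *)
Fixpoint kd ys : kos ys -> kos ys :=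
  match ys with
  | [::] => fun=> 0
  | y :: s => fun v => (kd v.1 + y *: v.2, - kd v.2)
  end.

(** A predicate on the total module, which avoids a family of types indexed by p; 0 has every
    degree. *)
Fixpoint kdeg ys (p : nat) : kos ys -> Prop :=
  match ys with
  | [::] => fun v => p = 0%N \/ v = 0
  | y :: s => fun v => kdeg p v.1 /\ (if p is q.+1 then kdeg q v.2 else v.2 = 0)
  end.

Lemma kd_lin ys : lin (@kd ys).
Proof.
elim: ys => [|y s IHs] a u v /=; first by rewrite scaler0 addr0.
congr (_, _); rewrite !IHs /=.
  by rewrite !scalerDr !scalerA [y * a]mulrC !addrA; congr (_ + _); rewrite addrAC.
by rewrite scalerN opprD.
Qed.

Lemma kdK ys (v : kos ys) : kd (kd v) = 0.
Proof.
elim: ys v => [|y s IHs] v //=.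
rewrite (linD (@kd_lin s)) (linZ (@kd_lin s)) !(linN (@kd_lin s)) !IHs add0r scalerN subrr !oppr0.
by [].
Qed.

Lemma kdeg_closed ys p : smod_closed (@kdeg ys p).
Proof.
elim: ys p => [|y s IHs] p /=.
  split; first by right.
  by move=> a u v [?|->] [?|->]; by [left | right; rewrite scaler0 addr0].
split; first by split; [apply: (IHs p).1 | case: p => // p; apply: (IHs p).1].
move=> a u v [h1 h2] [h3 h4]; split; first exact: (IHs p).2.
by case: p h1 h2 h3 h4 => [|p] _ h2 _ h4; [rewrite /= h2 h4 scaler0 addr0 | apply: (IHs p).2].
Qed.
Definition kdegs ys p := Smod (@kdeg_closed ys p).

Lemma kd_deg0 ys (v : kos ys) : kdeg 0 v -> kd v = 0.
Proof.
elim: ys v => [|z t IHt] w //= [h3 h4].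
by rewrite IHt // h4 scaler0 addr0 (lin0 (@kd_lin t)) oppr0.
Qed.

Lemma kd_deg ys p (v : kos ys) : kdeg p.+1 v -> kdeg p (kd v).
Proof.
elim: ys p v => [|y s IHs] p v /=; first by right.
case=> h1 h2; split; first by apply: (@smD _ _ (kdegs s p)); [apply: IHs | apply: smZ].
case: p h1 h2 => [|p] h1 h2; last by apply: (@smN _ _ (kdegs s p)); apply: IHs.
by rewrite /= kd_deg0 ?oppr0.
Qed.

Lemma kdeg_gt ys p (v : kos ys) : (size ys < p)%N -> kdeg p v -> v = 0.
Proof.
elim: ys p v => [|y s IHs] p v /=; first by case: p => [|p] // _ [].
case: p => // p hp; case: v => v1 v2 /= [h1 h2]; rewrite (IHs p.+1 v1) //.
  by rewrite (IHs p v2).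
by rewrite ltnS ltnW.
Qed.

Program Definition kZ ys p : smod (kos ys) :=
  @Smod _ _ (fun v => kdeg p v /\ kd v = 0) _.
Next Obligation.
split; first by split; [apply: sm0 (kdegs ys p) | apply: lin0; apply: kd_lin].
move=> a u v [h1 h2] [h3 h4]; split; first exact: (kdeg_closed ys p).2.
by rewrite kd_lin h2 h4 scaler0 addr0.
Qed.

Program Definition kB ys p : smod (kos ys) :=
  @Smod _ _ (fun v => exists2 u, kdeg p.+1 u & v = kd u) _.
Next Obligation.
split; first by exists 0; [apply: sm0 (kdegs ys p.+1) | rewrite lin0 //; apply: kd_lin].
move=> a _ _ [u h1 ->] [v h3 ->]; exists (a *: u + v); last by rewrite kd_lin.
exact: (kdeg_closed ys p.+1).2.
Qed.

Lemma kB_le ys p : sle (kB ys p) (kZ ys p).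
Proof. by move=> _ [u hu ->]; split; [apply: kd_deg | apply: kdK]. Qed.

Definition kann ys p r := scap (kZ ys p) (scol (kB ys p) r).

Lemma kB_le_kann ys p r : sle (kB ys p) (kann ys p r).
Proof. by apply: le_scap; [apply: kB_le | apply: le_scol]. Qed.

Lemma kZ_gt ys p : (size ys < p)%N -> kZ ys p = s0.
Proof.
move=> hp; apply: sle_anti; last exact: s0_le.
by move=> v [/(kdeg_gt hp)].
Qed.

Lemma kB_gt ys p : (size ys < p)%N -> kB ys p = s0.
Proof.
move=> hp; apply: sle_anti; last exact: s0_le.
by rewrite -(kZ_gt hp); apply: kB_le.
Qed.

Lemma kZ0E ys : kZ ys 0 = kdegs ys 0.
Proof. by apply: smod_eq => v; split=> [[]|h] //; split=> //; apply: kd_deg0. Qed.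

Section Cone.
Variables (y : R) (s : seq R) (p : nat).

Definition kin (a : kos s) : kos (y :: s) := (a, 0).

Lemma kin_lin : lin kin.
Proof. by move=> a u v; rewrite /kin; congr (_, _); rewrite /= scaler0 addr0. Qed.

Lemma kZ_in a : kZ (y :: s) p (kin a) <-> kZ s p a.
Proof.
rewrite /= scaler0 addr0 (lin0 (@kd_lin s)) oppr0; split=> [[[h _] []]|[h1 ->]] //.
by split=> //; split=> //; case: (p) => //= q; apply: sm0 (kdegs s q).
Qed.

(** Exactness at H_p(s) in the long exact sequence of the cone. *)
Lemma kB_in a : kB (y :: s) p (kin a) <->
  exists2 g, kZ s p g & kB s p (a - y *: g).
Proof.
split=> [[[u v] /= [h1 h2] [-> /eqP]]|[g [h1 h2] [u hu e]]].
  rewrite eq_sym oppr_eq0 => /eqP hv; exists v => //.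
  by rewrite addrK; exists u.
exists (u, g) => //=; rewrite h2 oppr0 -e subrK; by [].
Qed.

Lemma kZ_fst z : kZ (y :: s) p.+1 z -> kann s p y z.2.
Proof.
move=> [[h1 h2] [/eqP e1 /eqP]]; rewrite oppr_eq0 => /eqP e2; split=> //.
exists (- z.1); first exact: smN (kdegs s p.+1) _ h1.
by rewrite (linN (@kd_lin s)); apply/eqP; rewrite -addr_eq0 addrC.
Qed.

Lemma kB_snd z : kB (y :: s) p.+1 z -> kB s p z.2.
Proof.
move=> [u [h1 h2] ->] /=; exists (- u.2); first exact: smN (kdegs s p.+1) _ h2.
by rewrite (linN (@kd_lin s)).
Qed.

(* A cycle whose last coordinate is a boundary is homologous to one from K(s). *)
Lemma kZ_red z c : kZ (y :: s) p.+1 z -> kdeg p.+1 c -> z.2 = kd c ->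
  kZ s p.+1 (z.1 + y *: c) /\ kB (y :: s) p.+1 (z - kin (z.1 + y *: c)).
Proof.
move=> [[h1 h2] [e1 e2]] hc e; split.
  split; first by apply: (@smD _ _ (kdegs s p.+1)) => //; apply: smZ.
  by rewrite (linD (@kd_lin s)) (linZ (@kd_lin s)) -e.
exists (0, - c) => /=.
  by split; [apply: sm0 (kdegs s p.+2) | apply: smN (kdegs s p.+1) _ hc].
rewrite [LHS]surjective_pairing /= (lin0 (@kd_lin s)) (linN (@kd_lin s)) opprK -e.
by rewrite opprD addrA subrr !add0r subr0 scalerN.
Qed.

End Cone.

Lemma kann_lift y s p b : kann s p y b -> exists z, kZ (y :: s) p.+1 z /\ z.2 = b.
Proof.
move=> [[h1 h2] [u hu e]]; exists (- u, b); split=> //=; split.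
  by split=> //; apply: smN (kdegs s p.+1) _ hu.
by rewrite (linN (@kd_lin s)) -e addNr h2 oppr0.
Qed.

Section Cone2.
Variables (y : R) (s : seq R).

(** With [siso_ksnd], the exact sequence 0 -> H_p(s)/y H_p(s) -> H_p(y, s) -> (0 : y)_{H_(p-1)(s)}
    -> 0, where the first term is the image of K(s). *)
Lemma siso_kin p : siso (kin y (s := s)) (kZ s p) (sadd (kB s p) (smul y (kZ s p)))
  (sadd (simg (@kin_lin y s) (kZ s p)) (kB (y :: s) p)) (kB (y :: s) p).
Proof.
split; first exact: kin_lin.
- by move=> a ha; apply: sle_addl; exists a.
- by move=> _ [_ [b [[a ha ->] hb ->]]]; exists a; rewrite // addrC addKr.
- move=> a ha; rewrite kB_in; split=> [[g hg hb]|[b [_ [hb [g hg ->] ->]]]].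
    by exists (a - y *: g), (y *: g); rewrite subrK; split=> //; apply: smul_sub.
  by exists g => //; rewrite addrK.
Qed.

Lemma siso_ksnd p : siso (snd : kos (y :: s) -> kos s) (kZ (y :: s) p.+1)
  (sadd (simg (@kin_lin y s) (kZ s p.+1)) (kB (y :: s) p.+1)) (kann s p y) (kB s p).
Proof.
split=> //.
- by move=> z /kZ_fst.
- by move=> b /kann_lift [z [hz <-]]; exists z; rewrite // subrr; apply: sm0.
- move=> z hz; split=> [[u hu e]|[_ [b [[a ha ->] /kB_snd hb ->]]]].
    have [h1 h2] := kZ_red hz hu e.
    exists (kin y (z.1 + y *: u)), (z - kin y (z.1 + y *: u)).
    by split=> //; [exists (z.1 + y *: u) | rewrite addrC subrK].
  by rewrite /= add0r.
Qed.

Lemma kZ0_kin : sadd (simg (@kin_lin y s) (kZ s 0)) (kB (y :: s) 0) = kZ (y :: s) 0.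
Proof.
apply: sle_anti; first by apply: sadd_le; [move=> _ [a ha ->]; apply/kZ_in | apply: kB_le].
move=> [a b] hz; have [[_ hb] _] := hz; apply: sle_addl; rewrite /= in hb.
by exists a; rewrite ?hb //; apply/(kZ_in y); rewrite /kin -{1}hb.
Qed.

End Cone2.
End Koszul.

(** * Euler-Poincare characteristics *)

Section AlternatingSums.
Definition alt N (a : nat -> int) k : int := \sum_(k <= i < N) (-1) ^+ (i - k) * a i.

Lemma alt_rec N a k : (forall i, (N <= i)%N -> a i = 0) ->
  alt N a k = a k - alt N a k.+1.
Proof.
move=> ha; rewrite /alt; have [hk|hk] := ltnP k N; last first.
  by rewrite !big_geq ?ha ?subr0 // leqW.
rewrite big_ltn // subnn expr0 mul1r; congr (_ + _); rewrite -sumrN.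
rewrite big_nat_cond [RHS]big_nat_cond; apply: eq_bigr => i; rewrite andbT => /andP[hki _].
by rewrite -[(i - k)%N]prednK ?subn_gt0 // -subnS exprS mulN1r mulNr.
Qed.

Lemma alt_big N a k : (N <= k)%N -> alt N a k = 0.
Proof. by move=> h; rewrite /alt big_geq. Qed.

(** L, h and t are meant for the values on H_i(y, s), H_i(s)/y H_i(s) and (0 : y)_{H_i(s)}. For i >=
    k the terms t_i and h_i occur with opposite signs; only t_(k-1) is left over. *)
Lemma alt_cone n (L h t : nat -> int) :
  L 0%N = h 0%N -> (forall i, L i.+1 = h i.+1 + t i) ->
  (forall i, (n < i)%N -> h i = 0) -> (forall i, (n < i)%N -> t i = 0) ->
  forall k, alt n.+2 L k =
    (if k is q.+1 then t q else 0) + alt n.+1 (fun i => h i - t i) k.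
Proof.
move=> L0 LS h0 t0.
have hL i : (n.+2 <= i)%N -> L i = 0.
  by case: i => // i hi; rewrite LS h0 ?t0 ?addr0 // ltnW.
have hht i : (n.+1 <= i)%N -> h i - t i = 0 by move=> hi; rewrite h0 ?t0 ?subr0.
(* Downward induction on q, started beyond n where all terms are 0; j bounds the distance to that
   range. *)
suff aux j q : (n.+1 - q <= j)%N ->
    alt n.+2 L q.+1 = t q + alt n.+1 (fun i => h i - t i) q.+1.
  case=> [|q]; last exact: (aux _ q (leqnn _)).
  rewrite (alt_rec _ hL) (alt_rec _ hht) (aux _ 0%N (leqnn _)) L0 add0r.
  by ring.
elim: j q => [|j IHj] q hq.
  by rewrite !alt_big ?t0 ?addr0 //; lia.
have [hnq|hnq] := ltnP n q; first by rewrite !alt_big ?t0 ?addr0 //; lia.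
rewrite (alt_rec _ hL) (alt_rec _ hht) LS IHj; last by lia.
by ring.
Qed.
End AlternatingSums.

Section KoszulLength.
Variables (R : comNzRingType) (M : lmodType R).
Implicit Types (y : R) (ys s : seq R).
Local Notation kZ := (@kZ R M).
Local Notation kB := (@kB R M).
Local Notation kann := (@kann R M).

Lemma kos_cons D l y s : addf D l -> (forall p, Dr D y (kZ s p) (kB s p)) ->
  [/\ forall p, D _ (kZ (y :: s) p) (kB (y :: s) p),
      l _ (kZ (y :: s) 0) (kB (y :: s) 0) =
        l _ (kZ s 0) (sadd (kB s 0) (smul y (kZ s 0)))
    & forall p, l _ (kZ (y :: s) p.+1) (kB (y :: s) p.+1) =
        l _ (kZ s p.+1) (sadd (kB s p.+1) (smul y (kZ s p.+1))) +
        l _ (kann s p y) (kB s p)].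
Proof.
move=> hD hs.
pose im p := sadd (simg (@kin_lin R M y s) (kZ s p)) (kB (y :: s) p).
have him p : sle (im p) (kZ (y :: s) p).
  apply: sadd_le; last exact: kB_le.
  by move=> _ [a ha ->]; apply/kZ_in.
have hBim p : sle (kB (y :: s) p) (im p) by apply: sle_addr.
have hsZ p : sle (sadd (kB s p) (smul y (kZ s p))) (kZ s p).
  by apply: sadd_le; [apply: kB_le | apply: smul_le].
have [h1 h2] : (forall p, D _ (im p) (kB (y :: s) p)) /\
    forall p, l _ (im p) (kB (y :: s) p) =
      l _ (kZ s p) (sadd (kB s p) (smul y (kZ s p))).
  split=> p; have [h1 h2] := ad_iso hD (hsZ p) (hBim p) (@siso_kin R M y s p).
    by apply/h1; case: (hs p).
  by rewrite -h2 //; case: (hs p).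
have [h3 h4] : (forall p, D _ (kZ (y :: s) p.+1) (im p.+1)) /\
    forall p, l _ (kZ (y :: s) p.+1) (im p.+1) = l _ (kann s p y) (kB s p).
  split=> p; have [h3 h4] := ad_iso hD (him p.+1) (@kB_le_kann _ _ s p y) (@siso_ksnd R M y s p).
    by apply/h3; apply: (Dr_ker hD (hs p)).
  by apply: h4; apply/h3; apply: (Dr_ker hD (hs p)).
have hZ p : D _ (kZ (y :: s) p) (kB (y :: s) p).
  case: p => [|p]; first by rewrite -(kZ0_kin M y s); apply: h1.
  exact: (ad_ext hD (h3 p) (h1 p.+1)).
split=> // [|p]; first by rewrite -h2 /im (kZ0_kin M y s).
by rewrite (ad_add hD (hBim p.+1) (him p.+1)) // h2 h4 addrC.
Qed.

Lemma kZ_nil0 : kZ [::] 0 = sT.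
Proof. by apply: smod_eq => v; split=> // _; split=> //; left. Qed.
Lemma kB_nil p : kB [::] p = s0.
Proof.
apply: smod_eq => v; split=> [[u _ ->]|->] //; exists 0 => //; by right.
Qed.

Lemma kos_dom D l ys p : addf D l -> Dl D ys (@sT R M) s0 ->
  D _ (kZ ys p) (kB ys p).
Proof.
elim: ys D l p => [|y s IHs] D l p hD /=.
  case: p => [|p]; first by rewrite kZ_nil0 kB_nil.
  by move=> _; rewrite kZ_gt // kB_gt //; apply: ad_refl hD _ _.
move=> h; have [] // := kos_cons hD (y := y) (s := s) => q.
exact: (IHs _ _ q (Dr_addf hD y) h).
Qed.

Definition chik (l : sfun R) k ys :=
  alt (size ys).+1 (fun i => l _ (kZ ys i) (kB ys i)) k.

Lemma chik_cons D l y s k : addf D l -> Dl D (y :: s) (@sT R M) s0 ->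
  chik l k (y :: s) =
  (if k is q.+1 then l _ (kann s q y) (kB s q) else 0) + chik (lr l y) k s.
Proof.
move=> hD h.
have [_ L0 LS] := kos_cons hD (fun p => kos_dom p (Dr_addf hD y) h).
apply: (alt_cone L0 LS) => i hi; rewrite /kann (kZ_gt M hi) (kB_gt M hi).
  by rewrite sadd_idr ?(ad_id hD) //; apply: smul_le.
rewrite (_ : scap _ _ = s0) ?(ad_id hD) //.
by apply: sle_anti; [apply: scap_l | apply: s0_le].
Qed.

Lemma chik_serre D l ys : addf D l -> Dl D ys (@sT R M) s0 ->
  chik l 0 ys = ll l ys (@sT R M) s0.
Proof.
elim: ys D l => [|y s IHs] D l hD h.
  by rewrite /chik /alt big_nat1 expr0 mul1r kZ_nil0 kB_nil.
by rewrite (chik_cons _ hD h) add0r (IHs _ _ (Dr_addf hD y)).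
Qed.

Lemma chik_formula D l ys q : addf D l -> Dl D ys (@sT R M) s0 ->
  chik l q.+1 ys = \sum_(i < size ys)
    ll l (take i ys) (kann (drop i.+1 ys) q ys`_i) (kB (drop i.+1 ys) q).
Proof.
elim: ys D l => [|y s IHs] D l hD h.
  by rewrite big_ord0 /chik alt_big.
rewrite (chik_cons _ hD h) (IHs _ _ (Dr_addf hD y)) // big_ord_recl /=.
by rewrite drop0.
Qed.

Lemma chik_ge0 D l ys k : addf D l -> Dl D ys (@sT R M) s0 -> 0 <= chik l k ys.
Proof.
elim: ys D l k => [|y s IHs] D l k hD h.
  rewrite /chik; case: k => [|k]; last by rewrite alt_big.
  by rewrite /alt big_nat1 expr0 mul1r kZ_nil0 kB_nil; apply: (ad_ge0 hD).
rewrite (chik_cons _ hD h) addr_ge0 //; last exact: IHs _ (Dr_addf hD y) h.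
case: k => // k; apply: (ad_ge0 hD); apply: (Dr_ker hD).
exact: kos_dom (Dr_addf hD y) h.
Qed.

(** [g] is only a section of [f]; together with the trivial kernel it makes [f] bijective, and
    linearity of the inverse never has to be checked. *)
Definition kiso ys zs := exists (f : kos M ys -> kos M zs) (g : kos M zs -> kos M ys),
  [/\ lin f, cancel g f, forall v, f (kd v) = kd (f v), forall v, f v = 0 -> v = 0
    & forall p v, kdeg p v <-> kdeg p (f v)].

Lemma kiso_refl ys : kiso ys ys.
Proof. by exists id, id; split. Qed.

Lemma kiso_trans ys zs ts : kiso ys zs -> kiso zs ts -> kiso ys ts.
Proof.
move=> [f [g [h1 h2 h3 h4 h5]]] [f' [g' [h1' h2' h3' h4' h5']]].
exists (f' \o f), (g \o g'); split=> /=.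
- by move=> a u v /=; rewrite h1 h1'.
- by apply: can_comp.
- by move=> v; rewrite h3 h3'.
- by move=> v /h4'/h4.
- by move=> p v; rewrite h5 h5'.
Qed.

Lemma kiso_cons y ys zs : kiso ys zs -> kiso (y :: ys) (y :: zs).
Proof.
move=> [f [g [h1 h2 h3 h4 h5]]].
exists (fun v => (f v.1, f v.2)), (fun v => (g v.1, g v.2)); split=> /=.
- by move=> a u v /=; congr (_, _); rewrite h1.
- by move=> [u v]; rewrite /= !h2.
- by move=> v; rewrite (linD h1) (linZ h1) (linN h1) !h3.
- by move=> [u v] /= [/h4 -> /h4 ->].
- move=> p [u v]; rewrite /= h5; case: p => [|p]; last by rewrite h5.
  by split=> -[h e]; split=> //; [rewrite e (lin0 h1) | apply: h4].
Qed.

(** The basis elements of a and b anticommute, hence the sign in the last coordinate. *)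
Lemma kiso_swap a b ys : kiso [:: a, b & ys] [:: b, a & ys].
Proof.
exists (fun v => ((v.1.1, v.2.1), (v.1.2, - v.2.2))).
exists (fun v => ((v.1.1, v.2.1), (v.1.2, - v.2.2))); split=> /=.
- by move=> c u v; congr ((_, _), (_, _)); rewrite /= scalerN opprD.
- by move=> [[u v] [w z]]; rewrite /= opprK.
- move=> [[u v] [w z]] /=; rewrite !(linN (@kd_lin R M ys)) !scalerN !opprK.
  congr ((_, _), (_, _)); rewrite /= ?opprD ?opprK ?scalerN //.
  exact: addrAC.
- move=> [[u v] [w z]] /= [-> -> -> /eqP]; rewrite oppr_eq0 => /eqP -> //.
- move=> p [[u v] [w z]] /=; case: p => [|[|p]].
  + by split=> [[[h1 ->] [-> ->]]|[[h1 ->] [-> /eqP]]]; rewrite ?oppr0 // oppr_eq0 => /eqP ->.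
  + split=> [[[h1 h2] [h3 ->]]|[[h1 h2] [h3 /eqP]]]; rewrite ?oppr0 //.
    by rewrite oppr_eq0 => /eqP ->.
  + split=> [[[h1 h2] [h3 h4]]|[[h1 h2] [h3 h4]]]; do 2 split=> //.
      by apply: (@smN _ _ (kdegs M ys p)).
    by rewrite -[z]opprK; apply: (@smN _ _ (kdegs M ys p)).
Qed.

Lemma perm_kiso ys zs : perm_eq ys zs -> kiso ys zs.
Proof.
have hhead y s : y \in s -> kiso s (y :: rem y s).
  elim: s => //= z s IHs; rewrite inE eq_sym; case: eqP => [-> _|_ /= /IHs h].
    exact: kiso_refl.
  exact: kiso_trans (kiso_cons z h) (kiso_swap z y _).
elim: zs ys => [|z s IHs] ys h.
  have /eqP -> : ys == [::] by rewrite -size_eq0 (perm_size h).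
  exact: kiso_refl.
have hz : z \in ys by rewrite (perm_mem h) mem_head.
apply: kiso_trans (hhead z ys hz) (kiso_cons z _); apply: IHs.
by rewrite -(perm_cons z) -(permPl (perm_to_rem hz)).
Qed.

Lemma kiso_ZB ys zs : kiso ys zs ->
  exists (f : kos M ys -> kos M zs) (g : kos M zs -> kos M ys),
  [/\ lin f, cancel g f, forall p v, kZ zs p (f v) <-> kZ ys p v
   & forall p v, kB zs p (f v) <-> kB ys p v].
Proof.
move=> [f [g [h1 h2 h3 h4 h5]]]; exists f, g; split=> //.
  move=> p v; split=> -[/h5 hd e]; split=> //; first by apply: h4; rewrite h3.
  by rewrite -h3 e (lin0 h1).
move=> p v; split=> -[u hu e]; last first.
  by exists (f u); [apply/h5 | rewrite e h3].
exists (g u); first by apply/h5; rewrite h2.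
by apply/eqP; rewrite -subr_eq0; apply/eqP/h4; rewrite (linB h1) h3 h2 e subrr.
Qed.

Lemma kiso_siso ys zs : kiso ys zs -> exists f : kos M ys -> kos M zs,
  forall p, siso f (kZ ys p) (kB ys p) (kZ zs p) (kB zs p) /\
  forall r, siso f (kann ys p r) (kB ys p) (kann zs p r) (kB zs p).
Proof.
move=> /kiso_ZB [f [g [h1 h2 h3 h4]]]; exists f => p; split.
  split=> // [a /h3|w hw] //; exists (g w); last by rewrite h2 subrr; apply: sm0.
  by apply/h3; rewrite h2.
move=> r; split=> // [a [ha hb]|w [hw hw']].
  by split; [apply/h3 | move/h4: (hb : kB ys p (r *: a)); rewrite (linZ h1)].
exists (g w); last by rewrite h2 subrr; apply: sm0.
by split; [apply/h3; rewrite h2 | apply/(h4 p (r *: g w)); rewrite (linZ h1) h2].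
Qed.

Lemma perm_kann D l ys zs p r : addf D l -> perm_eq ys zs ->
  D _ (kann ys p r) (kB ys p) ->
  l _ (kann ys p r) (kB ys p) = l _ (kann zs p r) (kB zs p).
Proof.
move=> hD /perm_kiso/kiso_siso [f /(_ p) [_ /(_ r) h]] hd.
by have [_ ->] := ad_iso hD (@kB_le_kann _ _ _ _ _) (@kB_le_kann _ _ _ _ _) h.
Qed.

Lemma perm_chik D l ys zs k : addf D l -> perm_eq ys zs -> Dl D ys (@sT R M) s0 ->
  chik l k ys = chik l k zs.
Proof.
move=> hD hp hd; rewrite /chik (perm_size hp); apply: eq_bigr => p _; congr (_ * _).
have [f /(_ p) [h _]] := kiso_siso (perm_kiso hp).
have [_ ->] // := ad_iso hD (@kB_le _ _ _ _) (@kB_le _ _ _ _) h.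
exact: kos_dom hD hd.
Qed.

Lemma kos_homotopy ys p y z : y \in ys -> kZ ys p z -> kB ys p (y *: z).
Proof.
move=> /perm_to_rem/perm_kiso/kiso_ZB [f [g [h1 h2 h3 h4]]] /h3 hz.
apply/h4; rewrite (linZ h1); case: (f z) hz => a b [[ha hb] [/eqP ea eb]].
(* Contracting homotopy: d(0, a) = (ya, -da), and -da = yb because (a, b) is a cycle. *)
exists (0, a) => /=; first by split=> //; apply: sm0 (kdegs M _ p.+1).
rewrite (lin0 (@kd_lin R M _)) add0r; congr (_, _).
by rewrite addr_eq0 in ea; rewrite /= (eqP ea) opprK.
Qed.

End KoszulLength.

(** * Koszul cycles of d-sequences *)

Section Coefficients.
Variables (R : comNzRingType) (M : lmodType R).
Implicit Types (ys s : seq R) (A : smod M).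
Local Notation kos := (kos M).

Fixpoint kcoef A ys : kos ys -> Prop :=
  match ys with
  | [::] => fun v => A v
  | y :: s => fun v => kcoef A v.1 /\ kcoef A v.2
  end.

Lemma kcoef_closed A ys : smod_closed (@kcoef A ys).
Proof.
elim: ys => [|y s [h0 h]]; first exact: scarP A.
by split=> [|a u v [? ?] [? ?]]; split=> //; apply: h.
Qed.
Definition kcoefs A ys := Smod (kcoef_closed A ys).

Lemma kcoef_scale A ys r (v : kos ys) : (forall m, A (r *: m)) -> kcoef A (r *: v).
Proof. by move=> h; elim: ys v => [|y s IHs] v //=. Qed.

Lemma kcoef_sub A B ys (v : kos ys) : sle A B -> kcoef A v -> kcoef B v.
Proof. by move=> h; elim: ys v => [|y s IHs] v /=; [apply: h | case=> /IHs ? /IHs]. Qed.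

Fixpoint kinj ys (m : M) : kos ys := if ys is y :: s then (kinj s m, 0) else m.

Lemma kinj_lin ys : lin (@kinj ys).
Proof.
elim: ys => [|y s IHs] a u v //=; rewrite IHs; congr (_, _).
by rewrite /= scaler0 addr0.
Qed.

Lemma kcoef_inj A ys m : kcoef A (kinj ys m) -> A m.
Proof. by elim: ys => [|y s IHs] //= [/IHs]. Qed.

Lemma kinj_Z ys m : kZ M ys 0 (kinj ys m).
Proof.
rewrite kZ0E; elim: ys => [|y s IHs] /=; first by left.
by split.
Qed.

Lemma kZ0P ys v : kZ M ys 0 v -> exists m, v = kinj ys m.
Proof.
rewrite kZ0E; elim: ys v => [|y s IHs] v /=; first by exists v.
by case: v => v1 v2 /= [/IHs [m ->] ->]; exists m.
Qed.

Lemma kB0P ys m : kB M ys 0 (kinj ys m) <-> sidl ys sT m.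
Proof.
elim: ys m => [|y s IHs] m; first by rewrite kB_nil.
rewrite (kB_in _ 0 (kinj s m)); split=> [[g /kZ0P [n ->]]|[_ [b [[n _ ->] hb ->]]]].
  rewrite -(linZ (kinj_lin s)) -(linB (kinj_lin s)) IHs => h.
  by exists (y *: n), (m - y *: n); split; [exists n | | rewrite addrC subrK].
exists (kinj s n); first exact: kinj_Z.
rewrite -(linZ (kinj_lin s)) -(linB (kinj_lin s)) IHs.
by rewrite addrC addKr.
Qed.

End Coefficients.

(** Decreasing order puts the largest index at the head of the list, that is, into the outermost
    cone. *)
Lemma sort_gtn (S : seq nat) : uniq S -> pairwise gtn (sort geq S) /\ perm_eq S (sort geq S).
Proof.
move=> uS; split; last by rewrite perm_sym perm_sort.
rewrite -sorted_pairwise; last by move=> a b c /= h1 h2; apply: ltn_trans h2 h1.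
by rewrite gtn_sorted_uniq_geq sort_uniq uS; apply: sort_sorted => a b; apply: leq_total.
Qed.

Section DSequence.
Variables (R : comNzRingType) (M : lmodType R) (y : nat -> R).
Implicit Types (S T U : seq nat).
Local Notation I S := (@sidl R M (map y S) sT).
Local Notation kZ S := (@kZ R M (map y S)).
Local Notation kB S := (@kB R M (map y S)).

(* Any elements with indices outside [a, b] may be factored out, in particular
   elements between those that form the d-sequence. *)
Hypothesis hP : forall S a b, (a <= b)%N -> {in S, forall s, (s < a)%N || (b < s)%N} ->
  forall v : M, I S (y a *: (y b *: v)) -> I S (y b *: v).

Lemma idl_sub S T : {subset S <= T} -> sle (I S) (I T).
Proof. by move=> h; apply: sidl_sub => _ /mapP [s /h hs ->]; apply: map_f. Qed.

Lemma idl_mem S s (m : M) : s \in S -> I S (y s *: m).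
Proof. by move=> hs; apply: sidl_mem => //; apply: map_f. Qed.

Lemma idl_consP s S (v : M) : I (s :: S) v ->
  exists m v', I S v' /\ v = y s *: m + v'.
Proof. by move=> [_ [v' [[m _ ->] hv ->]]]; exists m, v'. Qed.

Lemma dseq_exp S a n (m : M) : {in S, forall s, s != a} ->
  I S (y a ^+ n.+1 *: m) -> I S (y a *: m).
Proof.
move=> hS; elim: n => // n IHn; rewrite exprS -scalerA exprS -scalerA.
move/hP => h; apply: IHn; rewrite exprS -scalerA; apply: h => // s /hS.
by rewrite neq_ltn.
Qed.

(** The largest u in U goes first. Write v = y_u m + v'; the hypothesis for the pair (t, u) puts y_u
    v into I S, so y_u^2 m, and then y_u m, lies in the ideal without u. *)
Lemma idl_colon_cap S U t (v : M) : pairwise gtn U ->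
  {in S, forall s, (s < t)%N} -> {in U, forall u, (t <= u)%N} ->
  I (U ++ S) v -> I S (y t *: v) -> I S v.
Proof.
move=> pU hS; elim: U pU => //= u U IHU /andP[/allP hu pU] hU /idl_consP [m [v' [hv' ev]]] hv.
have htu : (t <= u)%N by apply: hU; rewrite mem_head.
have hUS : {in U ++ S, forall s, (s < u)%N}.
  move=> s; rewrite mem_cat => /orP[/hu //|/hS h]; exact: leq_trans h htu.
apply: IHU => //; first by move=> w hw; apply: hU; rewrite inE hw orbT.
rewrite ev; apply: smD => //; apply: (@dseq_exp _ _ 1).
  by move=> s /hUS; rewrite ltn_neqAle => /andP[].
have -> : y u ^+ 2 *: m = y u *: v - y u *: v' by rewrite ev scalerDr addrK scalerA -expr2.
apply: smB; last exact: smZ.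
apply: (@idl_sub S); first by move=> s hs; rewrite mem_cat hs orbT.
apply: (hP htu) => [s /hS -> //|].
by rewrite scalerA mulrC -scalerA; apply: smZ.
Qed.

(** The last coordinate of z is a boundary, by induction or, in degree 0, by [idl_colon_cap]; so z
    is homologous to a cycle of the smaller complex. U collects the elements split off, so that the
    coefficient ideal never changes. *)
Lemma kos_cycle_boundary S U p z : pairwise gtn (U ++ S) ->
  kZ S p.+1 z -> kcoef (I (U ++ S)) z -> kB S p.+1 z.
Proof.
elim: S U p z => [|s S IHS] U p z.
  by move=> _; rewrite kZ_gt // kB_gt.
rewrite -cat_rcons => hU hz [cf1 cf2].
have [hZ2 hB2] := kZ_fst hz.
have hUS u w : u \in rcons U s -> w \in S -> (w < u)%N.
  by move: hU; rewrite pairwise_cat => /and3P[/allrelP h _ _] hu /h; apply.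
have [c hc ec] : kB S p z.2.
  case: p z hz cf1 cf2 hZ2 hB2 => [|p] z hz cf1 cf2 hZ2 hB2; last exact: IHS hU hZ2 cf2.
  have [m em] := kZ0P hZ2; rewrite em in hB2 cf2 *.
  apply/kB0P; apply: (@idl_colon_cap S (rcons U s) s) => //.
  - by move: hU; rewrite pairwise_cat => /and3P[].
  - by move=> w; apply: hUS; rewrite mem_rcons mem_head.
  - move=> u; rewrite mem_rcons inE => /orP[/eqP -> //|hu].
    move: hU; rewrite cat_rcons pairwise_cat => /and3P[/allrelP /(_ u s hu) h _ _].
    by apply/ltnW/h; rewrite mem_head.
  - exact: kcoef_inj cf2.
  - by apply/kB0P; move: hB2; rewrite /= (linZ (@kinj_lin R M _)).
have [h1 h2] := kZ_red hz hc ec.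
rewrite -[z](subrK (kin (y s) (z.1 + y s *: c))); apply: smD => //.
apply/kB_in; exists 0; first exact: sm0.
rewrite scaler0 subr0; apply: IHS hU h1 _.
apply: (@smD _ _ (kcoefs (I (rcons U s ++ S)) (map y S))) => //.
apply: kcoef_scale => m; apply: idl_mem.
by rewrite mem_cat mem_rcons mem_head.
Qed.

Lemma kos_kill S s p z : pairwise gtn (s :: S) -> kZ S p.+1 z -> kB S p.+1 (y s *: z).
Proof.
move=> hS hz; apply: (@kos_cycle_boundary S [:: s]) => //; first exact: smZ.
by apply: kcoef_scale => m; apply: idl_mem; rewrite mem_head.
Qed.

(** The indices between i and j are removed from the largest on, at the cost of one factor y_j
    each. *)
Lemma idl_colon_exp T S i j (v : M) : (i < j)%N -> pairwise gtn S ->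
  {in S, forall s, (i < s < j)%N} -> {in T, forall t, (t < i)%N || (j < t)%N} ->
  I (S ++ T) (y i *: v) -> I (S ++ T) (y j ^+ (size S).+1 *: v).
Proof.
move=> hij pS hS hT; elim: S v pS hS => [|s S IHS] v.
  move=> _ _ hv; apply: (hP (ltnW hij) hT).
  by rewrite scalerA mulrC -scalerA; apply: smZ.
rewrite pairwise_cons => /andP[/allP hs pS] hS /idl_consP [u [w [hw ev]]].
have /andP[his hsj] : (i < s < j)%N by apply: hS; rewrite mem_head.
have hS' : {in S, forall s, (i < s < j)%N} by move=> t ht; apply: hS; rewrite inE ht orbT.
have hsub : sle (I (S ++ T)) (I (i :: S ++ T)) by apply: idl_sub => t ht; rewrite inE ht orbT.
have hsub' : sle (I (S ++ T)) (I (s :: S ++ T)) by apply: idl_sub => t ht; rewrite inE ht orbT.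
(* Since y_s u lies in the ideal of i and the rest, the pair (s, j) gives y_j u = y_i m + w2. Then
   y_j v - y_s m satisfies the hypothesis with s removed. *)
have /idl_consP [m [w2 [hw2 eu]]] : I (i :: S ++ T) (y j *: u).
  apply: (hP (ltnW hsj)) => [t|].
    rewrite inE mem_cat => /orP[/eqP ->|/orP[/hs /= ->|/hT/orP[h|->]]]; rewrite ?his ?orbT //.
    by rewrite (ltn_trans h his).
  rewrite scalerA mulrC -scalerA; apply: smZ.
  have -> : y s *: u = y i *: v - w by rewrite ev addrK.
  by apply: smB; [apply: idl_mem; rewrite mem_head | apply: hsub].
have {}IHS := IHS (y j *: v - y s *: m) pS hS'.
have hI : I (S ++ T) (y i *: (y j *: v - y s *: m)).
  have -> : y i *: (y j *: v - y s *: m) = y s *: w2 + y j *: w.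
    rewrite scalerBr scalerA mulrC -scalerA ev scalerDr [y j *: (_ *: u)]scalerA.
    rewrite mulrC -scalerA eu scalerDr !scalerA [y i * y s]mulrC.
    by rewrite addrAC [_ + y s *: w2]addrC addrK.
  by apply: smD; apply: smZ.
have {}IHS := hsub' _ (IHS hI).
rewrite [size _]/= exprSr -scalerA.
have -> : y j *: v = (y j *: v - y s *: m) + y s *: m by rewrite subrK.
by rewrite scalerDr; apply: smD => //; apply: smZ; apply: idl_mem; rewrite mem_head.
Qed.

Lemma idl_colon_nil S i j : (i < j)%N -> i \notin S -> j \notin S ->
  exists N, forall v : M, I S (y i *: v) -> I S (y j ^+ N *: v).
Proof.
move=> hij hi hj; pose S1 := sort geq (undup [seq s <- S | (i < s < j)%N]).
pose S2 := [seq s <- S | ~~ (i < s < j)%N].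
have eS : I S = I (S1 ++ S2).
  apply: sle_anti; apply: idl_sub => s;
  rewrite mem_cat mem_sort mem_undup !mem_filter; by case: (_ < _ < _)%N; case: (s \in S).
exists (size S1).+1 => v; rewrite eS; apply: idl_colon_exp => //.
- by have [] := sort_gtn (undup_uniq [seq s <- S | (i < s < j)%N]).
- by move=> s; rewrite mem_sort mem_undup mem_filter => /andP[].
move=> s; rewrite mem_filter negb_and -!leqNgt => /andP[/orP[h|h] hs].
  by rewrite ltn_neqAle h andbT; case: eqP hs => // ->; rewrite (negPf hi).
by rewrite orbC ltn_neqAle h andbT; case: eqP hs => // <-; rewrite (negPf hj).
Qed.

(** H_(p+1) of the cone is an extension of a part of H_p(S) by a quotient of H_(p+1)(S); both are
    handled by induction, so the exponents add. *)
Lemma kos_ann_nil S i j p : pairwise gtn S -> (i < j)%N -> i \notin S -> j \notin S ->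
  exists N, forall z, kZ S p z -> kB S p (y i *: z) -> kB S p (y j ^+ N *: z).
Proof.
move=> pS hij; elim: S p pS => [|s S IHS] p pS hi hj.
  case: p => [|p]; last by exists 0%N => z; rewrite kZ_gt // kB_gt // => -> _; rewrite scaler0.
  have [N hN] := idl_colon_nil hij hi hj.
  exists N => z /kZ0P [m ->]; rewrite -!(linZ (@kinj_lin R M _)) !kB0P; exact: hN.
case: p => [|p].
  have [N hN] := idl_colon_nil hij hi hj.
  exists N => z /kZ0P [m ->]; rewrite -!(linZ (@kinj_lin R M _)) !kB0P; exact: hN.
move: (pS) (hi) (hj); rewrite pairwise_cons !inE !negb_or => /andP[_ pS'] /andP[_ hi'] /andP[_ hj'].
have [N1 hN1] := IHS p pS' hi' hj'; have [N2 hN2] := IHS p.+1 pS' hi' hj'.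
exists (N2 + N1)%N => z hz hB.
have [hZ2 _] := kZ_fst hz.
have /(hN1 _ hZ2) [c hc ec] : kB S p (y i *: z.2) by have := kB_snd hB.
have hz1 : kZ (s :: S) p.+1 (y j ^+ N1 *: z) by apply: smZ.
have [h1 h2] := kZ_red hz1 hc ec.
set a := _ + _ in h1 h2.
have hia : kB (s :: S) p.+1 (kin (y s) (y i *: a)).
  have -> : kin (y s) (y i *: a) = y i *: kin (y s) a.
    by rewrite (linZ (@kin_lin R M _ _)).
  rewrite -[kin _ a](subKr (y j ^+ N1 *: z)) scalerBr; apply: smB; last exact: smZ.
  by rewrite scalerA mulrC -scalerA; apply: smZ.
(* Being zero over the cone means being a multiple of y_s in H_(p+1)(S); such multiples vanish by
   [kos_kill]. *)
have {hia} hia : kB S p.+1 (y i *: a).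
  have /kB_in [g hg hb] := hia; rewrite -[_ *: a](subrK (y s *: g)).
  by apply: smD => //; apply: kos_kill.
have /(hN2 _ h1) ha := hia.
rewrite exprD -scalerA -[_ ^+ N1 *: z](subrK (kin (y s) a)) scalerDr.
apply: smD; first exact: smZ.
rewrite -(linZ (@kin_lin R M _ _)); apply/kB_in; exists 0; first exact: sm0.
by rewrite scaler0 subr0.
Qed.

(** Now S may have indices above j, so the pair (j, u) no longer puts y_u v into I S;
    [idl_colon_nil] does it for a power of y_u. *)
Lemma idl_colon_cap_mid S U j (v : M) : pairwise gtn (U ++ S) ->
  {in U, forall u, (j < u)%N} -> j \notin S ->
  I (j :: U ++ S) v -> I S (y j *: v) -> I S v.
Proof.
move=> pU hU hj; elim: U pU hU => [|u U IHU].
  move=> _ _ /idl_consP [m [v' [hv' ->]]].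
  rewrite scalerDr => /(smBl _ (smZ (y j) hv')); rewrite addrK => h.
  apply: smD => //; apply: (@dseq_exp _ _ 1); last by rewrite expr2 -scalerA.
  by move=> s hs; apply: contraNneq hj => <-.
rewrite cat_cons pairwise_cons => /andP[/allP hu pU] hU hv hjv.
have hju : (j < u)%N by apply: hU; rewrite mem_head.
have huS : u \notin S.
  by apply/negP => h; have /= := hu u; rewrite mem_cat h orbT ltnn => /(_ isT).
have [N /(_ v hjv) hN] := idl_colon_nil hju hj huS.
apply: IHU => //; first by move=> w hw; apply: hU; rewrite inE hw orbT.
have /idl_consP [m [v' [hv' ev]]] : I (u :: j :: U ++ S) v.
  by apply: idl_sub hv => s; rewrite !inE orbCA.
rewrite ev; apply: smD => //; apply: (@dseq_exp _ _ N).
  move=> s; rewrite inE => /orP[/eqP ->|/hu /= h]; first by rewrite neq_ltn hju.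
  by rewrite neq_ltn h.
have -> : y u ^+ N.+1 *: m = y u ^+ N *: v - y u ^+ N *: v'.
  by rewrite ev scalerDr addrK scalerA -exprSr.
apply: smB; last exact: smZ.
by apply: idl_sub hN => s hs; rewrite inE mem_cat hs !orbT.
Qed.

(** In positive degree, indices of S above j move to U; once the head of S is below j, the list U,
    j, S is decreasing and [kos_cycle_boundary] applies. *)
Lemma kos_colon_cap S U j p z : pairwise gtn (U ++ S) ->
  {in U, forall u, (j < u)%N} -> j \notin S ->
  kZ S p z -> kcoef (I (j :: U ++ S)) z -> kB S p (y j *: z) -> kB S p z.
Proof.
elim: S U p z => [|s S IHS] U p z pU hU hj hz cf hB.
  case: p hz hB => [|p]; last by rewrite kZ_gt // kB_gt.
  move=> /kZ0P [m em]; rewrite em -(linZ (@kinj_lin R M _)) !kB0P.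
  by apply: idl_colon_cap_mid pU hU hj _; rewrite em in cf; apply: kcoef_inj cf.
case: p hz hB => [|p] hz hB.
  have [m em] := kZ0P hz; move: hB; rewrite em -(linZ (@kinj_lin R M _)) !kB0P.
  by apply: idl_colon_cap_mid pU hU hj _; rewrite em in cf; apply: kcoef_inj cf.
move: (hj); rewrite inE negb_or neq_ltn => /andP[/orP[hjs|hsj] hjS]; last first.
  apply: (@kos_cycle_boundary _ (rcons U j)) => //.
    rewrite -cats1 -catA /=; move: pU; rewrite !pairwise_cat /= => /and3P[h1 h2 /andP[h3 h4]].
    rewrite h2 h4 /= hsj h3 /= !andbT; apply/andP; split.
      apply/allrelP => u w hu; rewrite inE => /orP[/eqP ->|hw]; first exact: hU.
      by move/allrelP: h1; apply.
    by apply/allP => w /(allP h3) h; apply: ltn_trans h hsj.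
  by apply: kcoef_sub cf; apply: idl_sub => w; rewrite -cats1 -catA !(inE, mem_cat) orbCA.
rewrite -cat_rcons in pU cf.
have hU' : {in rcons U s, forall u, (j < u)%N}.
  by move=> u; rewrite mem_rcons inE => /orP[/eqP ->|/hU].
case: cf => cf1 cf2.
have [hZ2 _] := kZ_fst hz.
have /(IHS _ _ _ pU hU' hjS hZ2 cf2) [c hc ec] : kB S p (y j *: z.2) by have := kB_snd hB.
have [h1 h2] := kZ_red hz hc ec.
set a := _ + _ in h1 h2.
have hja : kB (s :: S) p.+1 (kin (y s) (y j *: a)).
  have -> : kin (y s) (y j *: a) = y j *: kin (y s) a.
    by rewrite (linZ (@kin_lin R M _ _)).
  by rewrite -[kin _ a](subKr z) scalerBr; apply: smB => //; apply: smZ.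
have {hja} hja : kB S p.+1 (y j *: a).
  have /kB_in [g hg hb] := hja; rewrite -[_ *: a](subrK (y s *: g)).
  apply: smD => //; apply: kos_kill => //.
  by move: pU; rewrite cat_rcons pairwise_cat => /and3P[].
rewrite -[z](subrK (kin (y s) a)); apply: smD => //.
apply/kB_in; exists 0; first exact: sm0.
rewrite scaler0 subr0; apply: IHS pU hU' hjS h1 _ hja.
apply: (@smD _ _ (kcoefs (I (j :: rcons U s ++ S)) (map y S))) => //.
apply: kcoef_scale => m; apply: idl_mem.
by rewrite inE mem_cat mem_rcons mem_head orbT.
Qed.

(** A multiple y_j z has all its coefficients in the ideal of j :: S, so [kos_colon_cap] cancels a
    further factor y_j. *)
Lemma kann_exp S j p n : pairwise gtn S -> j \notin S ->
  kann M (map y S) p (y j ^+ n.+1) = kann M (map y S) p (y j).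
Proof.
move=> pS hj; elim: n => // n IHn; rewrite -IHn; apply: sle_anti => z [hz hB]; split=> //.
  move: hB; rewrite /= !exprS -!scalerA -/(kB S p) => hB.
  apply: (@kos_colon_cap S [::] j) hB => //; first by do 2 apply: smZ.
  by apply: kcoef_scale => m; apply: idl_mem; rewrite mem_head.
by rewrite /scol /= exprS -scalerA; apply: (@smZ _ _ (kB S p)).
Qed.

End DSequence.

(** * Independence of the exponents *)

Section SubmodClosed.
Variable R : comNzRingType.
Implicit Types V W : lmodType R.

Definition smod_of V (S : submodClosed V) : smod V.
Proof.
exists (fun v => v \in S); split; first exact: rpred0.
by move=> a u v hu hv; apply: rpredD => //; apply: rpredZ.
Defined.

Definition smod_pred V (A : smod V) : {pred V} := fun v => `[< A v >].
Fact smod_pred_closed V (A : smod V) : submod_closed (smod_pred A).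
Proof.
split; first by apply/asboolP/sm0.
by move=> a u v /asboolP hu /asboolP hv; apply/asboolP/(scarP A).2.
Qed.
HB.instance Definition _ V (A : smod V) :=
  GRing.isSubmodClosed.Build R V (smod_pred A) (smod_pred_closed A).

Lemma smod_of_pred V (A : smod V) : smod_of (smod_pred A) = A.
Proof. by apply: smod_eq => v; split=> /asboolP. Qed.

Lemma pi_lin V (S : submodClosed V) : lin (\pi_(quotmod S)%qT : V -> quotmod S).
Proof. by move=> a u v; rewrite pi_quotD -pi_quot_scale. Qed.

Lemma simg_pi V (S : submodClosed V) : simg (@pi_lin V S) sT = sT.
Proof. by apply: smod_eq => v; split=> // _; exists (repr v); rewrite // reprK. Qed.

Lemma siso_pi V (A : smod V) (S : submodClosed V) :
  siso (\pi_(quotmod S)%qT : V -> quotmod S) A (scap A (smod_of S)) (simg (@pi_lin V S) A) s0.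
Proof.
split; first exact: pi_lin.
- by move=> a ha; exists a.
- by move=> _ [a ha ->]; exists a; rewrite // subrr.
- move=> a ha; rewrite /= -(lin0 (@pi_lin V S)); split.
    by move=> /eqP; rewrite quot_eqE subr0.
  by move=> [_ h]; apply/eqP; rewrite quot_eqE subr0.
Qed.

Lemma val_lin V (S : submodClosed V) : lin (val : submod S -> V).
Proof. by []. Qed.

Lemma siso_val V (S : submodClosed V) (B : smod V) :
  siso (val : submod S -> V) sT (spre (@val_lin V S) B) (smod_of S) B.
Proof.
split=> //; first by move=> a _; exact: (valP a).
by move=> v hv; exists (Sub v hv : submod S); rewrite // SubK subrr; apply: sm0.
Qed.

(** [chik_serre] speaks of whole modules, so a subquotient is realised by one, the same for all
    l. *)
Lemma addf_quot_module V (A B : smod V) : sle B A -> exists N : lmodType R,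
  forall D l, addf D l -> D _ A B -> D N sT s0 /\ l _ A B = l N sT s0.
Proof.
move=> hBA; pose S := smod_pred A; pose B' := spre (@val_lin V S) B.
exists (quotmod (smod_pred B')) => D l hD.
have h1 := @siso_val V S B; rewrite smod_of_pred in h1.
have h2 := @siso_pi _ sT (smod_pred B').
rewrite smod_of_pred in h2.
rewrite scap_Tl simg_pi in h2.
have [i1 i2] := ad_iso hD (@le_sT _ _ B') hBA h1.
have [i3 i4] := ad_iso hD (@le_sT _ _ B') (@s0_le _ _ sT) h2.
by move=> /i1 h; split; [apply/i3 | rewrite -i2 // i4].
Qed.

End SubmodClosed.

(** * Splitting off two elements in either order *)

Section Swap.
Variable R : comNzRingType.

Lemma Dl_perm D l (ys zs : seq R) (V : lmodType R) (A B : smod V) : addf D l ->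
  ys =i zs -> Dl D ys A B -> Dl D zs A B.
Proof. by move=> hD e; rewrite !(DlE _ _ _ hD) (sidl_eqi _ e). Qed.

(** Both sides are chi_0 of a Koszul complex on a and b, which does not see their order. *)
Lemma lr_comm D l a b (V : lmodType R) (A B : smod V) : addf D l ->
  Dl D [:: a; b] A B -> lr (lr l a) b A B = lr (lr l b) a A B.
Proof.
move=> hD h.
have hC : [:: a; b] =i [:: b; a] by move=> z; rewrite !inE orbC.
have h' := Dl_perm hD hC h.
have [N hN] := addf_quot_module (ad_le (Dl_addf [:: a; b] hD) h).
have [d1 e1] := hN _ _ (Dl_addf [:: a; b] hD) h.
have [d2 e2] := hN _ _ (Dl_addf [:: b; a] hD) h'.
rewrite -[LHS]/(ll l [:: a; b] A B) -[RHS]/(ll l [:: b; a] A B) e1 e2.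
rewrite -(chik_serre hD d1) -(chik_serre hD d2).
by apply: (perm_chik _ hD _ d1); rewrite (perm_catC [:: a] [:: b]).
Qed.

Variable M : lmodType R.
Local Notation kZ := (@kZ R M).
Local Notation kB := (@kB R M).
Local Notation kann := (@kann R M).

(* chi_{p+1}(a, b, ws) computed by splitting off a then b, and b then a. *)
Lemma kann_swap D l a b ws p N : addf D l -> Dl D [:: a, b & ws] (@sT R M) s0 ->
  (forall z, kZ ws p z -> kB ws p (a *: z) -> kB ws p (b ^+ N *: z)) ->
  l _ (kann (b :: ws) p a) (kB (b :: ws) p) =
  l _ (kann (a :: ws) p b) (kB (a :: ws) p) - lr l a (kann ws p b) (kB ws p).
Proof.
move=> hD hab hN.
have hC : [:: a, b & ws] =i [:: b, a & ws] by move=> z; rewrite !inE orbCA.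
have hba := Dl_perm hD hC hab.
have e : chik M l p.+1 [:: a, b & ws] = chik M l p.+1 [:: b, a & ws].
  by apply: (perm_chik _ hD _ hab); rewrite (perm_catCA [:: a] [:: b] ws).
have ha := Dr_addf hD a; have hb := Dr_addf hD b.
rewrite (chik_cons _ hD hab) (chik_cons _ hD hba) in e.
rewrite (chik_cons _ ha hab) (chik_cons _ hb hba) in e.
(* A power of b kills (0 : a) in H_p(ws; M), so l^b vanishes there. *)
have e0 : lr l b (kann ws p a) (kB ws p) = 0.
  apply: (lr_nil hD (n := N)) => [_ [z [hz hz'] ->]|]; first exact: hN.
  by apply: (Dr_ker hb); apply: (kos_dom p (Dr_addf hb a) hba).
have e1 : chik M (lr (lr l a) b) p.+1 ws = chik M (lr (lr l b) a) p.+1 ws.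
  apply: eq_bigr => i _; congr (_ * _); apply: (lr_comm hD).
  exact: (kos_dom i (Dr_addf ha b) hab).
by move: e; rewrite e0 e1 add0r addrA => /addIr <-; rewrite addrK.
Qed.

Lemma kann_kiso ys zs p r r' : kiso M ys zs ->
  kann zs p r = kann zs p r' -> kann ys p r = kann ys p r'.
Proof.
move=> /kiso_ZB [f [g [h1 h2 h3 h4]]] e.
have h s v : kann ys p s v <-> kann zs p s (f v).
  by rewrite /kann /= -(linZ h1); split=> -[hz hb]; split; by [apply/(h3 p v) | apply/(h4 p (s *: v))].
by apply: smod_eq => v; rewrite !h e.
Qed.

Lemma kann_nil_kiso ys zs p a c : kiso M ys zs ->
  (forall z, kZ zs p z -> kB zs p (a *: z) -> kB zs p (c *: z)) ->
  (forall z, kZ ys p z -> kB ys p (a *: z) -> kB ys p (c *: z)).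
Proof.
move=> /kiso_ZB [f [g [h1 h2 h3 h4]]] h z /h3 hz /h4 ha.
by apply/h4; rewrite (linZ h1); apply: h => //; rewrite -(linZ h1).
Qed.

End Swap.

Section Powers.
Variable R : comNzRingType.

Lemma Dl_mono (D1 D2 : dom R) ys : (forall V (A B : smod V), D1 V A B -> D2 V A B) ->
  forall V (A B : smod V), Dl D1 ys A B -> Dl D2 ys A B.
Proof.
elim: ys D1 D2 => [|y ys IHys] D1 D2 h12; first exact: h12.
by apply: IHys => V A B [n0 h0]; split=> //; apply: h12.
Qed.

Definition pwr (T : Type) (x : T -> R) (n : T -> nat) i := x i ^+ n i.

Lemma Dl_pwr (T : Type) (x : T -> R) D l n S (V : lmodType R) (A B : smod V) :
  addf D l -> Dl D (map x S) A B -> Dl D (map (pwr x n) S) A B.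
Proof.
elim: S D l => //= s S IHS D l hD h.
apply: (IHS _ _ (Dr_addf hD _)).
by apply: (@Dl_mono (Dr D (x s))) h => W A' B'; apply: (Dr_exp hD).
Qed.
End Powers.

Section Constancy.
Variables (R : comNzRingType) (M : lmodType R) (x : nat -> R).
Local Notation pw := (pwr x).
Hypothesis hP : forall n, (forall i, (0 < n i)%N) ->
  forall S a b, (a <= b)%N -> {in S, forall s, (s < a)%N || (b < s)%N} ->
  forall v : M, sidl (map (pw n) S) sT (pw n a *: (pw n b *: v)) ->
    sidl (map (pw n) S) sT (pw n b *: v).

Lemma kann_pw n S j p k : (forall i, (0 < n i)%N) -> uniq S -> j \notin S -> n j = 1%N ->
  kann M (map (pw n) S) p (x j ^+ k.+1) = kann M (map (pw n) S) p (x j).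
Proof.
move=> hn uS hj nj; have [h1 h2] := sort_gtn uS.
apply: (kann_kiso (perm_kiso M (perm_map (pw n) h2))).
have := @kann_exp _ _ _ (hP hn) _ j p k h1; rewrite /pwr nj expr1; apply.
by rewrite mem_sort.
Qed.

Lemma ann_nil_pw n S i j p : (forall i, (0 < n i)%N) -> uniq S -> (i < j)%N ->
  i \notin S -> j \notin S -> exists N, forall z, kZ M (map (pw n) S) p z ->
  kB M (map (pw n) S) p (pw n i *: z) -> kB M (map (pw n) S) p (pw n j ^+ N *: z).
Proof.
move=> hn uS hij hi hj; have [h1 h2] := sort_gtn uS.
have [||N hN] := kos_ann_nil (hP hn) p h1 hij; rewrite ?mem_sort //.
by exists N; apply: (kann_nil_kiso (perm_kiso M (perm_map (pw n) h2))).
Qed.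

Definition set1n (n : nat -> nat) j i := if i == j then 1%N else n i.

Lemma kann_const_step D l n S i j p : addf D l -> (forall i, (0 < n i)%N) ->
  uniq S -> {in S, forall s, (i < s)%N} -> j \in S ->
  Dl D (map x (i :: S)) (@sT R M) s0 ->
  l _ (kann M (map (pw n) S) p (pw n i)) (kB M (map (pw n) S) p) =
  l _ (kann M (map (pw (set1n n j)) S) p (pw (set1n n j) i)) (kB M (map (pw (set1n n j)) S) p).
Proof.
move=> hD hn uS hi hj hd.
have hn' : forall k, (0 < set1n n j k)%N by move=> k; rewrite /set1n; case: eqP.
have hij := hi j hj.
have hp : perm_eq S (j :: rem j S) by apply: perm_to_rem.
have uS' : uniq (rem j S) by apply: rem_uniq.
have hjS : j \notin rem j S by rewrite mem_rem_uniq // inE eqxx.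
have hiS : i \notin rem j S.
  by apply/negP => /mem_rem/hi; rewrite ltnn.
have dom k : Dl D (map (pw k) [:: i, j & rem j S]) (@sT R M) s0.
  apply: (Dl_pwr k hD); apply: Dl_perm hD _ hd => z.
  by apply/perm_mem/perm_map; rewrite perm_cons.
(* On the right the j-th element occurs only through its annihilators on complexes without it; by
   [kann_pw] these do not depend on its exponent. *)
have swap k : (forall i, (0 < k i)%N) ->
  l _ (kann M (map (pw k) S) p (pw k i)) (kB M (map (pw k) S) p) =
  l _ (kann M (map (pw k) (i :: rem j S)) p (pw k j)) (kB M (map (pw k) (i :: rem j S)) p)
  - lr l (pw k i) (kann M (map (pw k) (rem j S)) p (pw k j)) (kB M (map (pw k) (rem j S)) p).
  move=> hk; have [N hN] := ann_nil_pw p hk uS' hij hiS hjS.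
  rewrite -(kann_swap hD (dom k) hN).
  apply: (perm_kann hD (perm_map (pw k) hp)).
  apply: (Dr_ker hD); apply: (kos_dom p (Dr_addf hD _)).
  suff h : Dl D (map (pw k) (i :: S)) (@sT R M) s0 by exact: h.
  apply: (Dl_perm hD _ (dom k)) => z.
  by apply/perm_mem/perm_map; rewrite perm_cons perm_sym.
rewrite (swap n hn) (swap _ hn').
have eS k : k != j -> pw (set1n n j) k = pw n k by rewrite /pwr /set1n => /negPf ->.
have eM T : j \notin T -> map (pw (set1n n j)) T = map (pw n) T.
  by move=> hT; apply/eq_in_map => k hk; apply: eS; apply: contraNneq hT => <-.
have hjiS : j \notin i :: rem j S by rewrite inE negb_or hjS neq_ltn hij orbT.
have nj : set1n n j j = 1%N by rewrite /set1n eqxx.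
have ej : pw (set1n n j) j = x j by rewrite /pwr nj expr1.
have eK T : uniq T -> j \notin T ->
    kann M (map (pw n) T) p (pw n j) = kann M (map (pw n) T) p (x j).
  move=> uT hT; rewrite -(eM T hT).
  have -> : pw n j = x j ^+ (n j).-1.+1 by rewrite /pwr prednK.
  exact: kann_pw hn' uT hT nj.
rewrite (eM _ hjiS) (eM _ hjS) ej eS ?neq_ltn ?hij //.
by rewrite !eK //= hiS.
Qed.

Lemma kann_const D l n S i p : addf D l -> (forall i, (0 < n i)%N) ->
  uniq S -> {in S, forall s, (i < s)%N} -> Dl D (map x (i :: S)) (@sT R M) s0 ->
  l _ (kann M (map (pw n) S) p (pw n i)) (kB M (map (pw n) S) p) =
  l _ (kann M (map x S) p (x i)) (kB M (map x S) p).
Proof.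
move=> hD hn uS hi hd.
pose F (k : nat -> nat) := l _ (kann M (map (pw k) S) p (pw k i)) (kB M (map (pw k) S) p).
(* [k T] resets to 1 the exponents with index in T. The exponent of i itself is removed last, by
   [kann_pw]. *)
pose k T := foldr (fun j n => set1n n j) n T.
have hk T j : (0 < k T j)%N.
  by elim: T => //= t T IHT; rewrite /set1n; case: eqP.
have hF T : {subset T <= S} -> F n = F (k T).
  elim: T => //= t T IHT hT; rewrite IHT; last by move=> s hs; apply: hT; rewrite inE hs orbT.
  by apply: (@kann_const_step D) => //; apply: hT; rewrite mem_head.
rewrite -/(F n) (hF S) // /F.
have kS j : j \in S -> k S j = 1%N.
  rewrite /k; elim: (S) => //= t T IHT; rewrite inE /set1n.
  by case: eqP => //= _ /IHT.
have -> : map (pw (k S)) S = map x S.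
  by apply/eq_in_map => j hj; rewrite /pwr kS ?expr1.
have hiS : i \notin S by apply/negP => /hi; rewrite ltnn.
have ex : map x S = map (pw (fun=> 1%N)) S by apply: eq_map => j; rewrite /pwr expr1.
have -> : pw (k S) i = x i ^+ (k S i).-1.+1 by rewrite /pwr prednK ?hk.
by rewrite ex (@kann_pw (fun=> 1%N)).
Qed.

End Constancy.

(** * Comparison with the subset-indexed Koszul complex *)

Section Translation.
Variables (R : comNzRingType).
Implicit Types V W M : lmodType R.

Lemma has_length_slen V n : has_length V n <-> is_slen (@sT R V) s0 n.
Proof.
have h m : has_chain (fun S : {pred V} => submod_closed S) m <-> schain (@s0 R V) sT m.
  split=> -[C [h1 h2]].
    (* The given chain is controlled only up to m; beyond m the predicate becomes the whole module,
       hence closed for every i. *)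
    have cl i : smod_closed (fun v => (i <= m)%N -> v \in C i).
      split; first by move=> /h1 [].
      by move=> a u v hu hv hi; apply: (h1 i hi).2; [apply: hu | apply: hv].
    exists (fun i => Smod (cl i)); split=> i hi.
      by split; [apply: s0_le | apply: le_sT].
    have [h3 h4] := h2 i hi; split; first by move=> v /= hv _; apply/h3/hv/ltnW.
    by move=> h5; apply: h4 => v hv; apply: (h5 v _ (ltnW hi)).
  exists (fun i => smod_pred (C i)); split=> i hi; first exact: smod_pred_closed.
  have [h3 h4] := h2 i hi; split; first by move=> v /asboolP/h3 hv; apply/asboolP.
  by move=> h5; apply: h4 => v hv; apply/asboolP/h5/asboolP.
by split=> -[h1 h2]; split=> [|m /h]; by [apply/h | apply: h2].
Qed.

Lemma mod_length_slen V : mod_length V = slen (@sT R V) s0.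
Proof.
by rewrite /mod_length /slen; congr xget; apply/predeqP => n; apply: has_length_slen.
Qed.

Lemma finite_length_fl V : finite_length V <-> fl (@sT R V) s0.
Proof. by rewrite fl_slen; split=> -[n /has_length_slen h]; exists n. Qed.

Lemma idmul_sidl V ys : smod_of (idmul V ys) = sidl ys sT.
Proof.
apply: smod_eq => v; split=> [/asboolP|].
  elim: ys v => [|y s IHs] v /= [f ->]; first by rewrite big_ord0.
  rewrite big_ord_recl; exists (y *: f ord0), (\sum_(i < size s) s`_i *: f (lift ord0 i)).
  by split=> //; [exists (f ord0) | apply: IHs; exists (fun i => f (lift ord0 i))].
move=> h; apply/asboolP; elim: ys v h => [|y s IHs] v /=.
  by move=> ->; exists (fun=> 0); rewrite big_ord0.
move=> [_ [b [[a _ ->] /IHs [f ->] ->]]].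
exists (fun i => if unlift ord0 i is Some j then f j else a).
rewrite big_ord_recl unlift_none; congr (_ + _).
by apply: eq_bigr => i _; rewrite liftK.
Qed.

Lemma finite_length_idmul V ys :
  finite_length (quotmod (idmul V ys)) <-> fl (@sT R V) (sidl ys sT).
Proof.
rewrite finite_length_fl.
have := @siso_pi R V sT (idmul V ys); rewrite idmul_sidl.
rewrite scap_Tl simg_pi.
by move=> /(ad_iso (len_addf R) (@le_sT _ _ _) (@s0_le _ _ _)) [<-].
Qed.

Section KoszulIso.
Variable V : lmodType R.
Implicit Types (y : R) (s ys : seq R).

Definition lift0 n (J : {set 'I_n}) : {set 'I_n.+1} := [set lift ord0 j | j in J].
Definition unlift0 n (I : {set 'I_n.+1}) : {set 'I_n} := [set j | lift ord0 j \in I].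

Lemma mem_lift0 n (J : {set 'I_n}) j : (lift ord0 j \in lift0 J) = (j \in J).
Proof. by rewrite mem_imset //; apply: lift_inj. Qed.
Lemma ord0_lift0 n (J : {set 'I_n}) : (ord0 \in lift0 J) = false.
Proof. by apply/imsetP => -[j _ /eqP]; rewrite (negPf (neq_lift _ _)). Qed.
Lemma card_lift0 n (J : {set 'I_n}) : #|lift0 J| = #|J|.
Proof. by rewrite card_imset //; apply: lift_inj. Qed.
Lemma unlift0K n (J : {set 'I_n}) : unlift0 (lift0 J) = J.
Proof. by apply/setP => j; rewrite inE mem_lift0. Qed.
Lemma unlift0UK n (J : {set 'I_n}) : unlift0 (ord0 |: lift0 J) = J.
Proof. by apply/setP => j; rewrite !inE mem_lift0. Qed.
Lemma lift0_case n (I : {set 'I_n.+1}) :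
  I = if ord0 \in I then ord0 |: lift0 (unlift0 I) else lift0 (unlift0 I).
Proof.
case: ifP => h; apply/setP => i; have [j ->|->] := unliftP ord0 i;
by rewrite ?inE ?mem_lift0 ?inE ?ord0_lift0 ?h.
Qed.

Definition kfst y s (f : koszul (y :: s) V) : koszul s V := [ffun J => f (lift0 J)].
Definition ksnd y s (f : koszul (y :: s) V) : koszul s V :=
  [ffun J => f (ord0 |: lift0 J)].

Fixpoint kth ys : koszul ys V -> kos V ys :=
  match ys with
  | [::] => fun f => f finset.set0
  | y :: s => fun f => (kth (kfst f), kth (ksnd f))
  end.

Fixpoint kht ys : kos V ys -> koszul ys V :=
  match ys with
  | [::] => fun m => [ffun=> m]
  | y :: s => fun v => [ffun I : {set 'I_(size s).+1} =>
      if ord0 \in I then kht v.2 (unlift0 I) else kht v.1 (unlift0 I)]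
  end.

Lemma kth_lin ys : lin (@kth ys).
Proof.
elim: ys => [|y s IHs] a f g /=; first by rewrite !ffunE.
by congr (_, _); rewrite -IHs; congr kth; apply/ffunP => J; rewrite !ffunE.
Qed.

Lemma kthK ys : cancel (@kht ys) (@kth ys).
Proof.
elim: ys => [|y s IHs] v /=; first by rewrite ffunE.
case: v => v1 v2; congr (_, _); rewrite -[RHS]IHs; congr kth; apply/ffunP => J.
  by rewrite !ffunE ord0_lift0 unlift0K.
by rewrite !ffunE setU11 unlift0UK.
Qed.

Lemma khtK ys : cancel (@kth ys) (@kht ys).
Proof.
elim: ys => [|y s IHs] f /=; apply/ffunP => I; rewrite ffunE.
  by congr (f _); apply/setP; case.
rewrite !IHs !ffunE; case: ifP => h; congr (f _); by rewrite [RHS]lift0_case h.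
Qed.

(** A set containing 0 has one more element below every other index, whence the sign in the second
    coordinate of the cone; for a set without 0, adjoining 0 gives the extra summand. *)
Lemma kth_diff ys (f : koszul ys V) : kth (koszul_diff f) = kd (kth f).
Proof.
elim: ys f => [|y s IHs] f /=.
  by rewrite ffunE big1 // => -[].
rewrite -!IHs -(linZ (@kth_lin s)) -(linD (@kth_lin s)) -(linN (@kth_lin s)).
congr (_, _); congr kth; apply/ffunP => J; rewrite !ffunE.
  rewrite big_mkcond big_ord_recl /= ord0_lift0 /= addrC; congr (_ + _).
    rewrite [RHS]big_mkcond; apply: eq_bigr => j _; rewrite mem_lift0.
    case: ifP => // hj; rewrite ffunE; congr (_ ^+ _ *: (_ *: f _)).
      rewrite -(card_lift0 [set l in J | (l < j)%N]); apply: eq_card => i.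
      have [k ->|->] := unliftP ord0 i; rewrite !inE ?mem_lift0 ?ord0_lift0 ?inE //.
    apply/setP => i; have [k ->|->] := unliftP ord0 i;
    by rewrite !inE ?mem_lift0 ?inE ?ord0_lift0 ?(inj_eq (@lift_inj _ _)).
  rewrite (_ : #|_| = 0%N) ?expr0 ?scale1r //; apply/eqP; rewrite cards_eq0.
  by apply/eqP/setP => i; rewrite !inE andbF.
rewrite big_mkcond big_ord_recl /= setU11 /= add0r.
rewrite [in RHS]big_mkcond -sumrN; apply: eq_bigr => j _.
rewrite !inE mem_lift0 /=; case: ifP => hj; last by rewrite oppr0.
rewrite ffunE -scaleNr; congr (_ *: (_ *: f _)).
  rewrite -[RHS]mulN1r -[in RHS]exprS; congr (_ ^+ _).
  have := cardsU1 ord0 (lift0 [set l in J | (l < j)%N]).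
  rewrite ord0_lift0 card_lift0 add1n => <-.
  apply: eq_card => i; have [k ->|->] := unliftP ord0 i; by rewrite !inE ?mem_lift0 ?ord0_lift0 ?inE.
apply/setP => i; have [k ->|->] := unliftP ord0 i;
by rewrite !inE ?mem_lift0 ?inE ?ord0_lift0 ?(inj_eq (@lift_inj _ _)).
Qed.

Lemma kth_deg ys p (f : koszul ys V) : koszul_deg p f <-> kdeg p (kth f).
Proof.
elim: ys p f => [|y s IHs] p f /=.
  have h (I : {set 'I_0}) : I = finset.set0 by apply/setP; case.
  split=> [hf|[-> I|e I _]]; last by rewrite (h I).
    by case: p hf => [|p] hf; [left | right; apply: hf; rewrite cards0].
  by rewrite (h I) cards0.
rewrite -IHs.
have -> : (if p is q.+1 then kdeg q (kth (ksnd f)) else kth (ksnd f) = 0) <->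
    (if p is q.+1 then koszul_deg q (ksnd f) else ksnd f = 0).
  case: p => [|q]; last by rewrite -IHs.
  split=> [h|->]; last exact: lin0 (@kth_lin s).
  by rewrite -[ksnd f]khtK h -(lin0 (@kth_lin s)) khtK.
split=> [hf|[h1 h2] I hI].
  split; first by move=> J hJ; rewrite ffunE hf // card_lift0.
  case: p hf => [|p] hf.
    by apply/ffunP => J; rewrite !ffunE hf // cardsU1 ord0_lift0.
  by move=> J hJ; rewrite ffunE hf // cardsU1 ord0_lift0 card_lift0.
have := lift0_case I; case: ifP => hI0 eI; rewrite eI in hI *.
  rewrite cardsU1 ord0_lift0 card_lift0 add1n in hI.
  rewrite -[LHS](ffunE (fun J => f (ord0 |: lift0 J))) -/(ksnd f).
  case: p h2 hI {h1} => [|p] h2 hI; first by rewrite h2 ffunE.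
  exact: h2.
rewrite -[LHS](ffunE (fun J => f (lift0 J))) -/(kfst f).
by apply: h1; rewrite card_lift0 in hI.
Qed.

Section Homology.
Variables (ys : seq R) (p : nat).

Definition bdry : smod (submod (@cycles R ys V p)) := smod_of (@boundaries R ys V p).

Lemma bdryP z : bdry z <-> kB V ys p (kth (val z)).
Proof.
split=> [/asboolP [g hg ->]|[u hu e]].
  by exists (kth g); [apply/kth_deg | rewrite kth_diff].
apply/asboolP; exists (kht u); first by apply/kth_deg; rewrite kthK.
by apply: (can_inj (@khtK ys)); rewrite kth_diff kthK.
Qed.

Definition cth (z : submod (@cycles R ys V p)) : kos V ys := kth (val z).

Lemma cth_lin : lin cth.
Proof. by move=> a u v; rewrite /cth -(kth_lin (ys := ys)). Qed.

Lemma cthZ z : kZ V ys p (cth z).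
Proof.
have /asboolP [h1 h2] := valP z; split; first exact/kth_deg.
by rewrite -kth_diff h2 (lin0 (@kth_lin ys)).
Qed.

Lemma cth_surj w : kZ V ys p w -> exists z, cth z = w.
Proof.
move=> [h1 h2].
have hz : kht w \in @cycles R ys V p.
  apply/asboolP; split; first by apply/kth_deg; rewrite kthK.
  by apply: (can_inj (@khtK ys)); rewrite kth_diff kthK h2 (lin0 (@kth_lin ys)).
by exists (Sub (kht w) hz : submod (@cycles R ys V p)); rewrite /cth SubK kthK.
Qed.

Lemma siso_cth : siso cth sT bdry (kZ V ys p) (kB V ys p).
Proof.
split; [exact: cth_lin | by move=> z _; apply: cthZ | |].
  by move=> w /cth_surj [z <-]; exists z; rewrite // subrr; apply: sm0.
by move=> z _; rewrite bdryP.
Qed.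

Lemma siso_cth_ann r : siso cth (scol bdry r) bdry (kann V ys p r) (kB V ys p).
Proof.
have h z : scol bdry r z <-> scol (kB V ys p) r (cth z).
  by move: (bdryP (r *: z)); rewrite -/(cth (r *: z)) (linZ cth_lin).
split; [exact: cth_lin | by move=> z /h hz; split=> //; apply: cthZ | |].
  move=> w [/cth_surj [z <-] /h hz]; exists z => //.
  by rewrite subrr; apply: sm0.
by move=> z _; rewrite bdryP.
Qed.

Lemma mod_length_koszulH : mod_length (koszulH ys V p) = slen (kZ V ys p) (kB V ys p).
Proof.
rewrite mod_length_slen /slen; congr xget; apply/predeqP => n.
rewrite /= -(is_slen_iso n (@le_sT _ _ _) (@kB_le _ _ _ _) siso_cth).
have := @siso_pi R _ sT (@boundaries R ys V p).
rewrite scap_Tl simg_pi.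
by move=> /(is_slen_iso n (@le_sT _ _ _) (@s0_le _ _ _)) ->.
Qed.

Lemma koszulH_ann D l r : addf D l -> D _ (kann V ys p r) (kB V ys p) ->
  D (submod (ann_by (koszulH ys V p) r)) sT s0 /\
  l (submod (ann_by (koszulH ys V p) r)) sT s0 = l _ (kann V ys p r) (kB V ys p).
Proof.
move=> hD h.
have hbd : sle bdry (scol bdry r) by apply: le_scol.
have [i1 i2] := ad_iso hD hbd (@kB_le_kann _ _ _ _ _) (siso_cth_ann r).
have hpi := @siso_pi R _ (scol bdry r) (@boundaries R ys V p).
have e1 : scap (scol bdry r) (smod_of (@boundaries R ys V p)) = bdry.
  by apply: smod_eq => v; split=> [[]|hv] //; split=> //; apply: hbd.
have e2 : simg (@pi_lin R _ (@boundaries R ys V p)) (scol bdry r) =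
    smod_of (ann_by (koszulH ys V p) r).
  apply: smod_eq => v; split=> [[z hz ->]|/eqP hv].
    by apply/eqP; rewrite -(linZ (@pi_lin _ _ _)) -(lin0 (@pi_lin _ _ (@boundaries R ys V p)));
       apply/eqP; rewrite quot_eqE subr0.
  exists (repr v); rewrite ?reprK //=.
  have : \pi_(quotmod (@boundaries R ys V p))%qT (r *: repr v) = \pi_(quotmod (@boundaries R ys V p))%qT 0.
    by rewrite (lin0 (@pi_lin _ _ _)) (linZ (@pi_lin _ _ _)) reprK.
  by move/eqP; rewrite quot_eqE subr0.
rewrite e1 e2 in hpi.
have [i3 i4] := ad_iso hD hbd (@s0_le _ _ _) hpi.
have hv := @siso_val R _ (ann_by (koszulH ys V p) r) s0.
have e3 : spre (@val_lin R _ (ann_by (koszulH ys V p) r)) s0 = s0.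
  apply: smod_eq => v; split=> [h0|->] //.
  by apply: val_inj; rewrite [LHS]h0.
rewrite e3 in hv.
have [i5 i6] := ad_iso hD (@le_sT _ _ _) (@s0_le _ _ _) hv.
have h1 := i1.2 h; have h3 := i3.1 h1; have h5 := i5.2 h3.
by split=> //; rewrite i6 // -i4 // i2.
Qed.

End Homology.

Lemma chi_chik k ys : chi k ys V = chik V (@len R) k ys.
Proof. by apply: eq_bigr => i _; rewrite mod_length_koszulH. Qed.

End KoszulIso.
End Translation.

(** * Noetherian and local rings, dd-sequences *)

Section Noetherian.
Variable R : comNzRingType.
Implicit Types V W M : lmodType R.

(** Membership in the Jacobson radical, the form in which locality of R enters Nakayama's lemma. *)
Definition jac (x : R) := forall r, exists u, u * (1 - r * x) = 1.

Definition cyc V (v : V) : smod V.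
Proof.
exists (fun w => exists a : R, w = a *: v); split; first by exists 0; rewrite scale0r.
by move=> c _ _ [a ->] [b ->]; exists (c * a + b); rewrite scalerDl scalerA.
Defined.

Definition annm M : smod (R^o : lmodType R).
Proof.
exists (fun a : R => forall v : M, a *: v = 0); split; first by move=> v; rewrite scale0r.
by move=> c a b ha hb v; rewrite scalerDl -scalerA ha hb scaler0 addr0.
Defined.

Lemma noetherian_noeth : noetherian R -> noeth (@sT R R^o) s0.
Proof.
move=> hR; split; first exact: s0_le.
move=> P [C0 [pC0 _ _]]; apply: contrapT => hno.
have step (C : {C | P C}) : exists C' : {C | P C},
    sle (sval C) (sval C') /\ ~ sle (sval C') (sval C).
  case: C => C pC; apply: contrapT => h; apply: hno.
  exists C; split=> //; first exact: s0_le.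
  move=> C' pC' _ hCC'; apply: contrapT => hC'; apply: h.
  by exists (exist _ C' pC').
have [f hf] := choice step.
pose E n := sval (iter n f (exist _ C0 pC0)).
have mono i j : (i <= j)%N -> sle (E i) (E j).
  move/subnKC <-; elim: (j - i)%N => [|k IHk]; first by rewrite addn0.
  by rewrite addnS; apply: sle_trans IHk (hf _).1.
have cl : smod_closed (fun v => exists n, E n v).
  split; first by exists 0%N; apply: sm0.
  move=> a u v [i hi] [j hj]; exists (maxn i j); apply: smD.
    by apply/smZ/(mono i _ _ _ hi)/leq_maxl.
  by apply/(mono j _ _ _ hj)/leq_maxr.
have [s hs] := hR _ (smod_pred_closed (Smod cl)).
have [N hN] : exists N, forall i, (i < size s)%N -> E N s`_i.
  have hsi i : (i < size s)%N -> exists n, E n s`_i.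
    move=> hi; apply/asboolP/hs; exists (fun j => (j == Ordinal hi)%:R).
    rewrite (bigD1 (Ordinal hi)) //= eqxx scale1r big1 ?addr0 // => j /negPf ->.
    by rewrite scale0r.
  elim: (size s) hsi => [|k IHk] hk; first by exists 0%N.
  have [i hi|N hN] := IHk; first exact: hk (ltnW hi).
  have [n hn] := hk k (ltnSn k); exists (maxn N n) => i; rewrite ltnS leq_eqVlt.
  case/orP => [/eqP ->|/hN h]; first exact: mono (leq_maxr _ _) _ hn.
  exact: mono (leq_maxl _ _) _ h.
have [_ []] := hf (iter N f (exist _ C0 pC0)); move=> v hv.
have /hs [c ->] : v \in smod_pred (Smod cl) by apply/asboolP; exists N.+1.
by apply: sm_sum => i _; apply: smZ; apply: hN.
Qed.

(* A finitely generated module is an iterated extension of quotients of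
   R / Ann M. *)
Lemma addf_fin_gen D l M : addf D l -> fin_gen M -> D _ (@sT R R^o) (annm M) ->
  D _ (@sT R M) s0.
Proof.
move=> hD [s hs] h.
pose sp := fix sp (t : seq M) : smod M := if t is g :: t then sadd (sp t) (cyc g) else s0.
have -> : sT = sp s.
  apply: smod_eq => v; split=> // _; have [c ->] := hs v.
  apply: sm_sum => i _; apply: smZ.
  elim: (s) (nat_of_ord i) (ltn_ord i) => [|g t IHt] [|j] // hj.
    by apply: sle_addr; exists 1; rewrite scale1r.
  by apply: sle_addl; apply: IHt.
elim: (s) => [|g t IHt] /=; first exact: ad_refl hD _ _.
apply: (ad_ext hD _ IHt).
have hf : lin (fun a : R^o => (a : R) *: g).
  by move=> a u v; rewrite scalerDl -scalerA.
have hX : sle (annm M) (spre hf (sp t)).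
  by move=> a ha /=; rewrite ha; apply: sm0.
have hiso : siso (fun a : R^o => (a : R) *: g) sT (spre hf (sp t)) (sadd (sp t) (cyc g)) (sp t).
  split=> //; first by move=> a _; apply: sle_addr; exists a.
  by move=> _ [b [_ [hb [a ->] ->]]]; exists a; rewrite // addrK.
have [hi _] := ad_iso hD (@le_sT _ _ _) (@sle_addl _ _ _ _) hiso.
by apply/hi; apply: (ad_quot hD hX _ h).
Qed.

Lemma fin_gen_noeth M : noetherian R -> fin_gen M -> noeth (@sT R M) s0.
Proof.
move=> /noetherian_noeth h hM; apply: (addf_fin_gen (noeth_addf R) hM).
exact: (ad_quot (noeth_addf R) (@s0_le _ _ _) (@le_sT _ _ _) h).
Qed.

(** If 1 - rx were not a unit, an ideal maximal among those containing it but not 1 would be m, and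
    would contain both x and 1 - rx. *)
Lemma local_jac (m : {pred R}) x : noetherian R -> local_ring m -> x \in m -> jac x.
Proof.
move=> /noetherian_noeth [_ hR] [_ hm] hx r.
pose I0 := cyc (1 - r * x : R^o); apply: contrapT => hu.
have h1 : ~ I0 1 by move=> [u e]; apply: hu; exists u.
have [|J [[h0J hJ1] _ _ hJ]] := hR (fun J => sle I0 J /\ ~ J (1 : R)).
  by exists I0; split; [split | apply: s0_le | apply: le_sT].
have cl : idealr_closed (smod_pred J).
  split; first by apply/asboolP/sm0.
    by apply/negP => /asboolP.
  by move=> a u v /asboolP hu' /asboolP hv; apply/asboolP/(scarP J).2.
have /hm e : maximal_ideal (smod_pred J).
  split=> // I [I0' I1 Icl] hJI v hv.
  have cl' : smod_closed (fun w : R^o => (w : R) \in I) by split.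
  apply/asboolP; apply: (hJ (Smod cl')) => //.
  - split; last by move=> h; rewrite h in I1.
    by move=> w /h0J hw; apply/hJI/asboolP.
  - by move=> w hw; apply/hJI/asboolP.
have : x \in smod_pred J by rewrite e.
move=> /asboolP /(smZ r) hrx; apply: hJ1.
rewrite -[1](subrK (r * x)); apply: smD => //.
by apply: h0J; exists 1; rewrite scale1r.
Qed.

Lemma jac0 : jac 0.
Proof. by move=> r; exists 1; rewrite mulr0 subr0 mulr1. Qed.

(** Let X be maximal among the submodules between B and A that do not contain A. For a in A, either
    X + (xa) does not contain A, so xa is in X, or (1 - rx) a is in X for some r, so a is. Thus xA,
    and with it A, lies in X. *)
Lemma nakayama x V (A B : smod V) : jac x -> noeth A B ->
  sle A (sadd B (smul x A)) -> sle A B.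
Proof.
move=> hx [hBA hn] h; apply: contrapT => hAB.
have [|X [hAX hBX hXA hX]] := hn (fun X => ~ sle A X).
  by exists B; split.
apply: hAX; apply: sle_trans h _; apply: sadd_le => // _ [a ha ->].
apply: contrapT => hxa.
have hX' : sle (sadd X (cyc (x *: a))) A.
  by apply: sadd_le => // _ [r ->]; do 2 apply: smZ.
have [hA|hA] := pselect (sle A (sadd X (cyc (x *: a)))); last first.
  apply: hxa; apply: (hX _ hA hX'); first exact: sle_addl.
  by apply: sle_addr; exists 1; rewrite scale1r.
have [t [_ [ht [r ->] ea]]] := hA _ ha.
have [u hu] := hx r; apply: hxa; apply: smZ.
have e : (1 - r * x) *: a = t by rewrite scalerBl scale1r -scalerA {1}ea addrK.
by rewrite -[a]scale1r -hu -scalerA e; apply: smZ.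
Qed.

(** U is the intersection of all W + x^N V; stability of the colons U : x^n gives U <= W + xU, and
    Nakayama's lemma concludes. *)
Lemma krull x V (W : smod V) : jac x -> noeth sT W ->
  forall v, (forall N, sadd W (smul (x ^+ N) sT) v) -> W v.
Proof.
move=> hx hn.
have cl : smod_closed (fun v => forall N, sadd W (smul (x ^+ N) sT) v).
  split=> [N|a u v hu hv N]; first exact: sm0.
  exact: (scarP (sadd W (smul (x ^+ N) sT))).2.
pose U := Smod cl.
have hWU : sle W U by move=> v hv N; apply: sle_addl.
have [i|i|i|n hn'] := @noeth_acc _ _ _ _ (fun i => scap sT (scol U (x ^+ i))) hn.
- by apply: le_scap => //; apply: sle_trans hWU _; apply: le_scol.
- exact: scap_l.
- by move=> v [? h1]; split=> //; rewrite /scol /= exprS -scalerA; apply: (@smZ _ _ U).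
suff: sle U W by [].
apply: (nakayama hx).
  exact: (ad_sub (noeth_addf R) hWU (@le_sT _ _ _) hn).
move=> u hu; have [w [_ [hw [a _ ->] eu]]] := hu n.+1.
have hxa : U (x ^+ n.+1 *: a).
  by rewrite -[_ *: a](addKr w) -eu addrC; apply: smB => //; apply: hWU.
have [|_ ha] := hn' n.+1 a; first by split.
exists w, (x ^+ n.+1 *: a); split=> //.
by rewrite exprS -scalerA; apply: smul_sub.
Qed.

End Noetherian.

Section DDSequence.
Variables (R : comNzRingType) (M : lmodType R).

Lemma sidl_simg (V W : lmodType R) (f : V -> W) (hf : lin f) ys (A : smod V) :
  sidl ys (simg hf A) = simg hf (sidl ys A).
Proof.
elim: ys => [|y s IHs] /=.
  apply: smod_eq => v; split=> [->|[a -> ->]]; last exact: lin0.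
  by exists 0; rewrite ?lin0.
rewrite IHs; apply: smod_eq => v; split.
  move=> [_ [_ [[_ [a ha ->] ->] [b hb ->] ->]]]; exists (y *: a + b).
    by exists (y *: a), b; split=> //; exists a.
  by rewrite (linD hf) (linZ hf).
move=> [_ [_ [b [[a ha ->] hb ->]]] ->]; exists (y *: f a), (f b).
split; [by exists (f a); [exists a|] | by exists b | by rewrite (linD hf) (linZ hf)].
Qed.

Lemma idmul_quot (S : submodClosed M) ys v :
  (\pi_(quotmod S)%qT v \in idmul (quotmod S) ys) <->
  sadd (smod_of S) (sidl ys sT) v.
Proof.
have -> : (\pi_(quotmod S)%qT v \in idmul (quotmod S) ys) <->
    smod_of (idmul (quotmod S) ys) (\pi_(quotmod S)%qT v) by [].
rewrite idmul_sidl -(@simg_pi _ _ S) sidl_simg; split.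
  move=> [a ha /eqP]; rewrite quot_eqE => h; exists (v - a), a.
  by rewrite subrK.
move=> [b [a [hb ha ->]]]; exists a => //; apply/eqP.
by rewrite quot_eqE addrK.
Qed.

Variables (m : {pred R}) (d : nat) (x : d.-tuple R).
Let xx i := x`_i.
Hypothesis hnoeth : noeth (@sT R M) s0.
Hypothesis hjac : forall i, jac (xx i).
Hypothesis hdd : dd_sequence m x M.

Lemma pows_map n : tval (pows x (fun i : 'I_d => n (val i))) = map (pwr xx n) (iota 0 d).
Proof.
apply: (@eq_from_nth _ 0); first by rewrite size_tuple size_map size_iota.
move=> i; rewrite size_tuple => hi.
rewrite (nth_map 0%N) ?size_iota // nth_iota //.
by rewrite -[i]/(val (Ordinal hi)) -tnth_nth tnth_mktuple (tnth_nth 0).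
Qed.

Local Notation I n S := (@sidl R M (map (pwr xx n) S) sT).

Lemma dd_base n : (forall i, (0 < n i)%N) -> forall a b, (a <= b < d)%N -> forall v : M,
  I n (iota 0 a ++ iota b.+1 (d - b.+1)) (pwr xx n a *: (pwr xx n b *: v)) ->
  I n (iota 0 a ++ iota b.+1 (d - b.+1)) (pwr xx n b *: v).
Proof.
move=> hn a b /andP[hab hbd] v.
have [_ h] := hdd.
have hb : (0 < b.+1 <= d)%N by [].
have hpos : positive (fun i : 'I_d => n (val i)) by move=> i.
have := h b.+1 hb _ hpos; rewrite pows_map.
set S := idmul M _.
have hab' : (a <= b < size (take b.+1 (map (pwr xx n) (iota 0 d))))%N.
  by rewrite size_takel ?size_map ?size_iota ?hab //=.
move=> /(_ a b hab' (\pi_(quotmod S)%qT v)).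
have e i : (i <= b)%N -> (take b.+1 (map (pwr xx n) (iota 0 d)))`_i = pwr xx n i.
  move=> hi; rewrite nth_take // (nth_map 0%N) ?size_iota ?nth_iota ?(leq_ltn_trans hi) //.
rewrite !e // take_takel ?leqW //.
have eq w : (idmul (quotmod S) (take a (map (pwr xx n) (iota 0 d)))) (\pi_(quotmod S)%qT w) <->
    I n (iota 0 a ++ iota b.+1 (d - b.+1)) w.
  rewrite -[X in X <-> _]/(is_true (\pi_(quotmod S)%qT w \in idmul (quotmod S) (take a (map (pwr xx n) (iota 0 d))))).
  rewrite idmul_quot idmul_sidl -map_take -map_drop take_iota drop_iota add0n.
  rewrite (minn_idPl _); last by rewrite (leq_trans hab) // ltnW.
  rewrite map_cat; split.
    move=> [u [z [hu hz ->]]]; apply: smD.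
      by apply: sidl_sub hu => t ht; rewrite mem_cat ht orbT.
    by apply: sidl_sub hz => t ht; rewrite mem_cat ht.
  elim: (map _ (iota 0 a)) w => [|t s IHs] w; first by move=> hw; exists w, 0; rewrite addr0.
  move=> [_ [w' [[u _ ->] /IHs [p [q [hp hq ->]]] ->]]].
  exists p, (t *: u + q); split=> //; last by rewrite addrCA.
  by exists (t *: u), q; split=> //; exists u.
rewrite -!(linZ (@pi_lin R _ S)) => -[_ h'].
rewrite scalerA => /eq hv; apply/eq; exact: h'.
Qed.

Lemma dd_colon n : (forall i, (0 < n i)%N) ->
  forall S a b, (a <= b)%N -> {in S, forall s, (s < a)%N || (b < s)%N} ->
  forall v : M, I n S (pwr xx n a *: (pwr xx n b *: v)) -> I n S (pwr xx n b *: v).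
Proof.
move=> hn S a b hab hS.
(* From index d on the entries of x default to 0. *)
have [hdb|hbd] := leqP d b.
  move=> v _; rewrite /pwr /xx nth_default ?size_tuple // expr0n.
  by rewrite eqn0Ngt hn scale0r; apply: sm0.
(* L lists the indices outside [a, b] that may be missing from S; when it is empty, I S is the ideal
   of [dd_base]. *)
suff aux (L : seq nat) : forall (S : seq nat) n, (forall i, (0 < n i)%N) ->
    {in S, forall s, (s < a)%N || (b < s)%N} ->
    (forall i, (i < d)%N -> (i < a)%N || (b < i)%N -> (i \in S) || (i \in L)) ->
    forall v, I n S (pwr xx n a *: (pwr xx n b *: v)) -> I n S (pwr xx n b *: v).
  by apply: (aux (iota 0 d) S n hn hS) => i hi _; rewrite mem_iota hi orbT.
elim: L => [|r L IHL] {hS hn}S {}n hn hS hL v.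
  have -> : I n S = I n (iota 0 a ++ iota b.+1 (d - b.+1)).
    apply: sle_anti.
      apply: sidl_min => _ u /mapP [s hs ->] _.
      have [hds|hsd] := leqP d s.
        rewrite /pwr /xx nth_default ?size_tuple // expr0n eqn0Ngt hn scale0r.
        exact: sm0.
      apply: sidl_mem => //; apply: map_f; rewrite mem_cat !mem_iota add0n /=.
      by rewrite subnKC // hsd andbT; apply: hS.
    apply: sidl_sub => _ /mapP [s hs ->]; apply: map_f.
    move: hs; rewrite mem_cat !mem_iota add0n /= subnKC // => hs.
    have hsd : (s < d)%N.
      by case/orP: hs => [h|/andP[]//]; apply: ltn_trans hbd; apply: leq_trans h hab.
    have := hL s hsd; rewrite orbF; apply.
    by case/orP: hs => [->|/andP[->]]; rewrite ?orbT.
  by apply: dd_base; rewrite ?hab.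
have [hr|hr] := boolP ((r \in S) || ~~ ((r < a) || (b < r))%N).
  apply: IHL => // i hi hi'; have := hL i hi hi'; rewrite inE.
  by case: eqP hr => [<-|] //=; rewrite hi' orbF => ->.
move: hr; rewrite negb_or negbK => /andP[hrS hr] hv.
(* The missing r is adjoined with exponent N + 1, where induction applies; N is arbitrary, so
   Krull's theorem removes it again. *)
apply: (@krull _ (xx r)) => // [|N].
  exact: (ad_quot (noeth_addf R) (@s0_le _ _ _) (@le_sT _ _ _) hnoeth).
pose n' i := if i == r then N.+1 else n i.
have hn' i : (0 < n' i)%N by rewrite /n'; case: eqP.
have en i : i != r -> pwr xx n' i = pwr xx n i by rewrite /pwr /n' => /negPf ->.
have ne i : (a <= i <= b)%N -> i != r.
  by move=> hi; apply/eqP => e; move: hr; rewrite -e; lia.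
have eS : map (pwr xx n') S = map (pwr xx n) S.
  by apply/eq_in_map => i hi; apply: en; apply: contraNneq hrS => <-.
have := IHL (r :: S) n' hn' _ _ v.
rewrite map_cons eS (en a) ?ne ?leqnn ?hab // (en b) ?ne ?leqnn ?hab // => h.
have [|||_ [w [[u _ ->] hw e]]] := h _ _ _.
- by move=> s; rewrite inE => /orP[/eqP ->|/hS].
- by move=> i hi hi'; have := hL i hi hi'; rewrite !inE; case: eqP; rewrite ?orbT.
- exact: (@sle_addr _ _ _ _ _ hv).
rewrite e addrC; exists w, (pwr xx n' r *: u); split=> //.
rewrite /pwr /n' eqxx exprSr -scalerA; exact: smul_sub.
Qed.

End DDSequence.

(** * Prime avoidance *)

Section Avoidance.
Variable R : comNzRingType.
Implicit Types V : lmodType R.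
Local Notation idl := (smod (R^o : lmodType R)).

Lemma idlM (J : idl) (a b : R) : J b -> J (a * b).
Proof. exact: (@smZ R R^o J a b). Qed.

Lemma len0_le V (A B : smod V) : fl A B -> len A B = 0 -> sle A B.
Proof.
move=> h; have [hBA _] := h; have [_ h2] := fl_slenP h; rewrite /len => -[h0].
apply: contrapT => hAB; suff /h2 : schain B A 1 by rewrite h0.
exact: schain_ext (schain0 (@sle_refl _ _ B)) hBA hAB.
Qed.

(* Modulo the x-power torsion x is injective, hence surjective by a length
   count, so Nakayama applies. *)
Lemma jac_nilpotent V x (A B : smod V) : jac x -> Dr (@fl R) x A B ->
  lr (@len R) x A B = 0 -> exists n, sle (smul (x ^+ n) A) B.
Proof.
move=> hx h e; have hBA := Dr_le h; have [nAB _] := h.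
have hD := Dr_addf (len_addf R) x.
have [i|i|i|n hn] := @noeth_acc _ _ A B (fun i => scap A (scol B (x ^+ i))) nAB.
- by apply: le_scap => //; apply: le_scol.
- exact: scap_l.
- by move=> v [? h1]; split=> //; rewrite /scol /= exprS -scalerA; apply: smZ.
set T := scap A (scol B (x ^+ n)) in hn.
have hBT : sle B T by apply: le_scap => //; apply: le_scol.
have hTA : sle T A by apply: scap_l.
have [dT dB] := (ad_split hD hBT hTA).1 h.
have eT : lr (@len R) x A T = 0.
  have := ad_add hD hBT hTA h; rewrite e (@lr_nil _ _ _ (len_addf R) x n _ T B) //.
    by rewrite addr0.
  by move=> _ [a [_ ha] ->].
have eTT : scap A (scol T x) = T.
  apply: smod_eq => v; split=> [[ha [_ hv]]|hv]; last first.
    by split; [apply: hTA | apply: smZ].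
  by apply: (hn n.+1); split=> //; rewrite /scol /= exprSr -scalerA.
move: eT; rewrite /lr eTT (ad_id (len_addf R)) subr0 => /(len0_le dT.2) hA.
exists n => _ [a /(nakayama hx dT.1 hA) [_ ha] ->].
exact: ha.
Qed.

Definition prime_idl (p : idl) := ~ p 1 /\ forall a b : R, p (a * b) -> p a \/ p b.

Fixpoint for_all (T : Type) (P : T -> Prop) (s : seq T) : Prop :=
  if s is a :: t then P a /\ for_all P t else True.

Lemma for_all_cat T (P : T -> Prop) s t : for_all P (s ++ t) <-> for_all P s /\ for_all P t.
Proof. by elim: s => [|a s IHs] /=; [split=> [|[]] | rewrite IHs; split=> [[? []]|[[]]]]. Qed.

Lemma for_all_imp T (P Q : T -> Prop) s : (forall a, P a -> Q a) -> for_all P s -> for_all Q s.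
Proof. by move=> h; elim: s => //= a s IHs [/h ? /IHs]. Qed.

Lemma for_all_and T (P Q : T -> Prop) s : for_all P s -> for_all Q s ->
  for_all (fun a => P a /\ Q a) s.
Proof. by elim: s => //= a s IHs [? /IHs h] [? /h]. Qed.

(** A prime filtration of R/I, in the form of a test for membership in any D. In a maximal
    counterexample J take ab in J with a and b outside: R/J is an extension of R/(J + aR) by R/(J :
    a). *)
Lemma devissage (I : idl) : noeth (@sT R R^o) s0 -> exists ps : seq idl,
  for_all (fun p => prime_idl p /\ sle I p) ps /\
  forall D l, addf D l -> for_all (fun p => D _ sT p) ps -> D _ sT I.
Proof.
move=> [_ hR]; apply: contrapT => hI.
have [|J [hJ _ _ maxJ]] := hR (fun I => ~ exists ps : seq idl,
  for_all (fun p => prime_idl p /\ sle I p) ps /\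
  forall D l, addf D l -> for_all (fun p => D _ sT p) ps -> D _ sT I).
  by exists I; split=> //; apply: s0_le.
have good J' : sle J J' -> ~ sle J' J -> exists ps : seq idl,
  for_all (fun p => prime_idl p /\ sle J' p) ps /\
  forall D l, addf D l -> for_all (fun p => D _ sT p) ps -> D _ sT J'.
  by move=> h1 h2; apply: contrapT => h3; apply: h2; apply: maxJ.
apply: hJ.
have [h1|h1] := pselect (J 1).
  exists [::]; split=> // D l hD _; rewrite (_ : J = sT); first exact: (ad_refl hD).
  by apply: smod_eq => a; split=> // _; rewrite -[a]mulr1; exact: idlM.
have [[a [b [hab ha hb]]]|hp] := pselect (exists a b : R, [/\ J (a * b), ~ J a & ~ J b]); last first.
  exists [:: J]; split; last by move=> D l hD [].
  split=> //; split=> //; split=> // a b hab.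
  have [ha|ha] := pselect (J a); first by left.
  by right; apply: contrapT => hb; apply: hp; exists a, b.
have hJa : sle J (sadd J (smul a sT)) by apply: sle_addl.
have [|ps1 [p1 d1]] := good _ hJa.
  by move=> h; apply: ha; apply: h; apply: sle_addr; exists 1; rewrite // /GRing.scale /= mulr1.
have [|ps2 [p2 d2]] := good _ (@le_scol _ _ J a).
  by move=> h; apply: hb; apply: h.
exists (ps1 ++ ps2); split.
  apply/for_all_cat; split.
    by apply: for_all_imp p1 => p [? h]; split=> //; apply: sle_trans h.
  by apply: for_all_imp p2 => p [? h]; split=> //; apply: sle_trans h; apply: le_scol.
move=> D l hD /for_all_cat [/(d1 _ _ hD) h2 /(d2 _ _ hD) h3].
apply: (ad_ext hD h2); apply/(ad_mulD hD).
by rewrite (_ : scap _ _ = scol J a) //; apply: smod_eq => v; split=> [[]|].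
Qed.

(* Krull's principal ideal theorem in dimension one: z and x are both regular
   on R/p, so lr len x vanishes on R/(p + z). *)
Lemma prime_fl (p : idl) (x z : R) : prime_idl p -> jac x -> Dr (@fl R) x sT p -> ~ p z ->
  fl sT (sadd p (smul z sT)).
Proof.
move=> [p1 pp] hx h hz; have hD := Dr_addf (len_addf R) x.
set J := sadd p _; have hpJ : sle p J by apply: sle_addl.
have [dJ dp] := (ad_split hD hpJ (@le_sT _ _ J)).1 h.
have hiso : siso (fun a : R^o => z *: a) sT p J p.
  split; first exact: lin_scale.
  - by move=> a _; apply: sle_addr; exists a.
  - by move=> _ [b [_ [hb [a _ ->] ->]]]; exists a; rewrite // addrK.
  - by move=> a _; split=> [/pp [/hz|]|/smZ].
have [_ /(_ h) e] := ad_iso hD (@le_sT _ _ p) hpJ hiso.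
have e0 : lr (@len R) x sT J = 0.
  by apply: (addIr (lr (@len R) x J p)); rewrite -(ad_add hD hpJ (@le_sT _ _ J) h) add0r.
have [n hn] := jac_nilpotent hx dJ e0.
exact: (Dr_nil (len_addf R) hn dJ).
Qed.

Lemma prime_separate (m p : idl) ps : prime_idl p -> ~ sle m p ->
  exists w, [/\ m w, ~ p w & for_all (fun q => sle q p \/ q w) ps].
Proof.
move=> [p1 pp] hm; elim: ps => [|q ps [w [h1 h2 h3]]] /=.
  apply: contrapT => h; apply: hm => a ha; apply: contrapT => hpa.
  by apply: h; exists a; split.
have [hq|hq] := pselect (sle q p); first by exists w; split=> //; split=> //; left.
have [v [hv hpv]] : exists v, q v /\ ~ p v.
  by apply: contrapT => h; apply: hq => a ha; apply: contrapT => hpa; apply: h; exists a.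
exists (v * w); split; first exact: idlM.
  by move/pp => [].
split; first by right; rewrite mulrC; apply: idlM.
by apply: for_all_imp h3 => q' [h|h]; [left | right; apply: idlM].
Qed.

(** Primes above m cannot be avoided and stay as an exception. The correction w lies outside p but
    in every listed prime not contained in p, so z + w stays outside the primes that z avoids. *)
Lemma prime_avoidance (m : idl) ps : for_all prime_idl ps ->
  exists z : R, m z /\ for_all (fun p => sle m p \/ ~ p z) ps.
Proof.
elim: ps => [|p ps IHps] /=; first by exists 0; split=> //; apply: sm0.
move=> [hp /IHps [z [hz hps]]].
have [hmp|hmp] := pselect (sle m p); first by exists z; split=> //; split=> //; left.
have [hpz|hpz] := pselect (p z); last by exists z; split=> //; split=> //; right.
have [w [h1 h2 h3]] := prime_separate ps hp hmp.
exists (z + w); split; first exact: smD.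
split; first by right => /(smDr _ hpz).
apply: for_all_imp (for_all_and hps h3) => q [[hmq|hqz] [hqp|hqw]];
  try by [left].
  by right => /hqp /(smDr _ hpz).
by right; rewrite addrC => /(smDr _ hqw).
Qed.

(** Tested on prime filtrations: if p contains m, it contains the given parameter and R/p has finite
    length; otherwise z is outside p and [prime_fl] applies. *)
Lemma fl_common (m I1 I2 : idl) (x y : R) : noeth (@sT R R^o) s0 ->
  (forall a, m a -> jac a) -> m x -> m y ->
  fl sT (sadd I1 (smul x sT)) -> fl sT (sadd I2 (smul y sT)) ->
  exists z : R, [/\ m z, fl sT (sadd I1 (smul z sT)) & fl sT (sadd I2 (smul z sT))].
Proof.
move=> hR hm hx hy f1 f2.
have [ps1 [p1 d1]] := devissage I1 hR; have [ps2 [p2 d2]] := devissage I2 hR.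
have [|z [hz hps]] := @prime_avoidance m (ps1 ++ ps2).
  by apply/for_all_cat; split; [apply: for_all_imp p1 | apply: for_all_imp p2] => p [].
have nR (I : idl) : noeth sT I.
  exact: (ad_quot (noeth_addf R) (@s0_le _ _ _) (@le_sT _ _ _) hR).
have aux (I p : idl) (t : R) : m t -> fl sT (sadd I (smul t sT)) ->
    prime_idl p -> sle I p -> sle m p \/ ~ p z -> Dr (@fl R) z sT p.
  move=> ht ft pp hIp; case=> [hmp|hpz]; split=> //; last first.
    apply: (prime_fl pp (hm _ ht)) => //; split=> //.
    by apply: (ad_quot (len_addf R) _ (@le_sT _ _ _) ft); apply: sadd_mono.
  apply: (ad_quot (len_addf R) _ (@le_sT _ _ _) ft).
  apply: (sle_trans _ (@sle_addl _ _ p _)); apply: sadd_le => // _ [a _ ->].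
  by rewrite /GRing.scale /= mulrC; apply: idlM; apply: hmp.
move/for_all_cat: hps => [q1 q2].
have hDz := Dr_addf (len_addf R) z.
exists z; split=> //.
  have [] // := d1 _ _ hDz _.
  by apply: for_all_imp (for_all_and p1 q1) => p [[pp hIp] hpz]; apply: aux f1 pp hIp hpz.
have [] // := d2 _ _ hDz _.
by apply: for_all_imp (for_all_and p2 q2) => p [[pp hIp] hpz]; apply: aux f2 pp hIp hpz.
Qed.

Lemma fl_nilpotent (J : idl) (v : R) : jac v -> fl sT J -> exists n, J (v ^+ n).
Proof.
move=> hv hJ.
have h : Dr (@fl R) v sT J.
  split; first exact: fl_noeth.
  by apply: (ad_quot (len_addf R) _ (@le_sT _ _ _) hJ); apply: sle_addl.
have [n hn] := jac_nilpotent hv h (lr_fin (len_addf R) v hJ).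
by exists n; apply: hn; exists 1; rewrite // /GRing.scale /= mulr1.
Qed.

Lemma idl_pow (J : idl) (gs : seq R) (t : R) N : (0 < N)%N ->
  sadd J (sidl gs sT) t ->
  sadd J (sidl (map (fun g => g ^+ N) gs) sT) (t ^+ ((size gs).+1 * N)).
Proof.
move=> hN; elim: gs t => [|g gs IHgs] t.
  rewrite [size _]/= mul1n => -[a [_ [ha -> ->]]]; rewrite addr0; apply: sle_addl.
  by rewrite -(prednK hN) exprSr; exact: idlM.
move=> [b [_ [hb [_ [c [[a _ ->] hc ->]] ->]]]].
set t' := b + c.
have {}IHgs : sadd J (sidl (map (fun g => g ^+ N) gs) sT) (t' ^+ ((size gs).+1 * N)).
  by apply: IHgs; exists b, c.
rewrite addrCA -/t' exprDn.
pose K := sadd J (sadd (smul (g ^+ N) sT) (sidl (map (fun g => g ^+ N) gs) sT)).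
rewrite -[sadd J _]/K [size _]/=.
have hK : sle (sadd J (sidl (map (fun g => g ^+ N) gs) sT)) K.
  by apply: sadd_mono => //; apply: sle_addr.
have hgK b' : K (g ^+ N * b').
  by apply: sle_addr; apply: sle_addl; exists b'.
move: K hK hgK => K hK hgK.
apply: sm_sum => -[i hi] _ /=; rewrite -mulr_natl; apply: idlM.
(* Pigeonhole in the binomial expansion: either the power of t' is covered by induction, or g occurs
   at least N times. *)
have [h|h] := leqP ((size gs).+1 * N) i.
  by apply: idlM; rewrite -(subnK h) exprD; apply: idlM; apply: hK.
rewrite mulrC; apply: idlM.
have hNi : (N <= (size gs).+2 * N - i)%N by rewrite mulSn; lia.
rewrite -(subnK hNi) exprD; apply: idlM.
by rewrite [_ *: _]/(g * a) exprMn.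
Qed.

End Avoidance.

(** * Changing the system of parameters *)

Section Comparison.
Variables (R : comNzRingType) (M : lmodType R).
Implicit Types (ys zs : seq R).
Local Notation kZ := (@kZ R M).
Local Notation kB := (@kB R M).
Local Notation kann := (@kann R M).

(** The difference is chi of l^s on ys plus the value of (0 : rs)/(0 : r) in H_q(ys), both
    nonnegative. *)
Lemma chik_mul_le D l r s ys q : addf D l -> Dl D (r * s :: ys) (@sT R M) s0 ->
  chik M l q.+1 (r :: ys) <= chik M l q.+1 (r * s :: ys).
Proof.
move=> hD h.
have hr : Dl D (r :: ys) (@sT R M) s0.
  by apply: (@Dl_mono _ (Dr D (r * s)) (Dr D r)) h => V A B; apply: (Dr_dvd hD).
have hs : Dl D (s :: ys) (@sT R M) s0.
  apply: (@Dl_mono _ (Dr D (r * s)) (Dr D s)) h => V A B.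
  by rewrite mulrC; apply: (Dr_dvd hD).
rewrite (chik_cons _ hD hr) (chik_cons _ hD h).
have hrs p := kos_dom p (Dr_addf hD (r * s)) h.
have -> : chik M (lr l (r * s)) q.+1 ys = chik M (lr l r) q.+1 ys + chik M (lr l s) q.+1 ys.
  rewrite /chik /alt -big_split; apply: eq_bigr => i _ /=.
  by rewrite (lr_mul hD (hrs i)) mulrDr.
have := chik_ge0 q.+1 (Dr_addf hD s) hs.
have hle : sle (kann ys q r) (kann ys q (r * s)).
  move=> z [hz hb]; split=> //; rewrite /scol /= mulrC -scalerA.
  exact: (@smZ _ _ (kB ys q) s _ hb).
have hk := Dr_ker hD (hrs q).
rewrite (ad_add hD (@kB_le_kann _ _ _ _ _) hle hk).
have := ad_ge0 hD (ad_quot hD (@kB_le_kann _ _ _ _ _) hle hk).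
lia.
Qed.

Lemma chik_congr D l r t ys q : addf D l ->
  Dl D (r :: ys) (@sT R M) s0 -> Dl D (t :: ys) (@sT R M) s0 ->
  (forall p z, kZ ys p z -> kB ys p ((r - t) *: z)) ->
  chik M l q.+1 (r :: ys) = chik M l q.+1 (t :: ys).
Proof.
move=> hD hr ht h; rewrite (chik_cons _ hD hr) (chik_cons _ hD ht).
have e p z : kZ ys p z -> kB ys p (r *: z) <-> kB ys p (t *: z).
  move=> hz; rewrite -[r](subrK t) scalerDl smDr //; exact: h.
have eK p : kann ys p r = kann ys p t.
  by apply: smod_eq => z; split=> -[hz hb]; split=> //; apply/e.
rewrite eK; congr (_ + _); apply: eq_bigr => i _; congr (_ * _).
rewrite /lr -/(kann ys i r) eK -/(kann ys i t); congr (l _ _ _ - _).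
apply: sle_anti; apply: sadd_le; try exact: sle_addl; move=> _ [z hz ->].
  rewrite -[r](subrK t) scalerDl; exists ((r - t) *: z), (t *: z).
  by split=> //; [apply: h | apply: smul_sub].
rewrite -[t](subrK r) scalerDl; exists ((t - r) *: z), (r *: z); split=> //.
  by rewrite -opprB scaleNr; apply/smN/h.
exact: smul_sub.
Qed.

Lemma kos_annm ys (a : R) (z : kos M ys) : annm M a -> a *: z = 0.
Proof.
move=> ha; elim: ys z => [|y s IHs] z /=; first exact: ha.
by rewrite [LHS]surjective_pairing /= !IHs.
Qed.

Lemma kos_ideal ys p z (a : R) : sadd (annm M) (sidl ys (@sT R R^o)) a ->
  kZ ys p z -> kB ys p (a *: z).
Proof.
move=> [b [c [hb hc ->]]] hz.
rewrite scalerDl (kos_annm _ hb) add0r.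
have cl : smod_closed (fun c : R^o => kB ys p ((c : R) *: z)).
  split; first by rewrite scale0r; apply: sm0.
  move=> r u v hu hv; rewrite scalerDl; apply: smD => //.
  by rewrite -scalerA; apply: smZ.
apply: (@sidl_min R R^o ys sT (Smod cl)) hc => y u hy _.
rewrite -[scar _ _]/(kB ys p ((y *: u : R) *: z)).
have -> : (y *: u : R^o) = u * y :> R by rewrite mulrC.
by rewrite -scalerA; apply: smZ; apply: kos_homotopy.
Qed.

Lemma sidl_annm_le ys (a : R) : sadd (annm M) (sidl ys (@sT R R^o)) a ->
  forall v : M, sidl ys sT (a *: v).
Proof.
move=> [b [c [hb hc ->]]] v; rewrite scalerDl hb add0r.
have cl : smod_closed (fun c : R^o => sidl ys (@sT R M) ((c : R) *: v)).
  split; first by rewrite scale0r; apply: sm0.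
  move=> r u w hu hw; rewrite scalerDl; apply: smD => //.
  by rewrite -scalerA; apply: smZ.
apply: (@sidl_min R R^o ys sT (Smod cl)) hc => y u hy _.
rewrite -[scar _ _]/(sidl ys sT ((y *: u : R) *: v)).
have -> : (y *: u : R^o) = y * u :> R by [].
by rewrite -scalerA; apply: sidl_mem.
Qed.

(* t acts on H(ys; M) as a multiple of u. *)
Lemma chik_ideal_le (D : dom R) l (u t : R) ys q : addf D l ->
  sadd (annm M) (sidl (u :: ys) (@sT R R^o)) t ->
  Dl D (t :: ys) (@sT R M) s0 ->
  chik M l q.+1 (u :: ys) <= chik M l q.+1 (t :: ys).
Proof.
move=> hD [b [w [hb [v [c [[a _ ev] hc ew]]] et]]] ht.
have {w ew v ev} et : t = u * a + (b + c).
  by rewrite et ew ev addrCA.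
have e : sadd (annm M) (sidl ys (@sT R R^o)) (u * a - t).
  rewrite et opprD addrA subrr add0r opprD; exists (- b), (- c).
  by split=> //; apply: smN.
have hua : Dl D (u * a :: ys) (@sT R M) s0.
  move: ht; rewrite !(DlE _ _ _ hD) => -[n h]; split=> //.
  apply: (ad_quot hD _ (@le_sT _ _ _) h); apply: sadd_mono => //.
  apply: sadd_le; last exact: sle_addr.
  move=> _ [v _ ->]; rewrite -[t](subKr (u * a)) scalerBl; apply: smB.
    by apply: sle_addl; apply: smul_sub.
  by apply: sle_addr; apply: sidl_annm_le.
rewrite -(chik_congr (r := u * a) _ hD hua ht); first exact: chik_mul_le hD hua.
by move=> p z hz; apply: kos_ideal.
Qed.

Lemma chik_exp_le D l y e e' ys q : addf D l -> (e <= e')%N ->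
  Dl D (y ^+ e' :: ys) (@sT R M) s0 ->
  chik M l q.+1 (y ^+ e :: ys) <= chik M l q.+1 (y ^+ e' :: ys).
Proof.
move=> hD he; rewrite -(subnKC he) exprD; exact: chik_mul_le.
Qed.

Lemma chik_pow_mono (T : eqType) (x : T -> R) D l (n n' : T -> nat) S q :
  addf D l -> (forall i, (n i <= n' i)%N) -> Dl D (map x S) (@sT R M) s0 ->
  chik M l q.+1 (map (pwr x n) S) <= chik M l q.+1 (map (pwr x n') S).
Proof.
move=> hD hn hd.
suff aux S1 S2 : S1 ++ S2 = S -> chik M l q.+1 (map (pwr x n) S) <=
    chik M l q.+1 (map (pwr x n) S1 ++ map (pwr x n') S2).
  exact: (aux [::] S).
elim: S2 S1 => [|s S2 IHS2] S1 hS; first by rewrite /= cats0 -hS cats0.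
have /IHS2 h : rcons S1 s ++ S2 = S by rewrite cat_rcons.
apply: le_trans h _; rewrite map_rcons cat_rcons.
have dom e : Dl D (map (pwr x n) S1 ++ x s ^+ e :: map (pwr x n') S2) (@sT R M) s0.
  (* Each entry carries its own exponent, since an index repeated in S may have different exponents
     in the two halves. *)
  pose T2 := [seq (i, n i) | i <- S1] ++ (s, e) :: [seq (i, n' i) | i <- S2].
  have := @Dl_pwr R _ (fun ie : T * nat => x ie.1) D l (fun ie => ie.2) T2 M sT s0 hD.
  rewrite !map_cat !map_cons -!map_comp.
  apply; suff -> : [seq (fun ie : T * nat => x ie.1) ((fun i => (i, n i)) i) | i <- S1] ++
      x s :: [seq (fun ie : T * nat => x ie.1) ((fun i => (i, n' i)) i) | i <- S2] = map x S by [].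
  by rewrite -hS map_cat.
have p1 r : perm_eq (map (pwr x n) S1 ++ r :: map (pwr x n') S2)
    (r :: map (pwr x n) S1 ++ map (pwr x n') S2).
  by rewrite (perm_catCA _ [:: r]).
rewrite (perm_chik q.+1 hD (p1 _) (dom _)) [leRHS](perm_chik q.+1 hD (p1 _) (dom _)).
apply: (chik_exp_le _ hD (hn s)).
by apply: (Dl_perm hD _ (dom (n' s))); apply: perm_mem.
Qed.

Section Exchange.
Hypothesis hR : noeth (@sT R R^o) s0.
Hypothesis hM : fin_gen M.
Variable k : nat.
Local Notation good ys := (Dl (@fl R) ys (@sT R M) s0).
Local Notation chl ys := (chik M (@len R) k.+1 ys).
Local Notation pows e ys := (map (fun y : R => y ^+ e) ys).

Lemma good_pow e ys : good ys -> good (pows e ys).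
Proof.
move=> h; have := @Dl_pwr R _ (fun y : R => y) _ _ (fun=> e) ys M sT s0 (len_addf R).
by rewrite map_id; apply.
Qed.

(** From M to R/Ann M: Ann M is the intersection of the annihilators of the generators g, and each
    R/Ann g embeds in M. The converse is [addf_fin_gen]. *)
Lemma good_annm ys : good ys <-> fl (@sT R R^o) (sadd (annm M) (sidl ys sT)).
Proof.
have hD := Dl_addf ys (len_addf R).
have nR : noeth (@sT R R^o) (annm M).
  exact: (ad_quot (noeth_addf R) (@s0_le _ _ _) (@le_sT _ _ _) hR).
have -> : fl (@sT R R^o) (sadd (annm M) (sidl ys sT)) <-> Dl (@fl R) ys (@sT R R^o) (annm M).
  by rewrite (DlE _ _ _ (len_addf R)); split=> [|[]].
split; last exact: addf_fin_gen hD hM.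
move=> hd; have [s hs] := hM.
have clA (t : seq M) : smod_closed (fun a : R^o => forall g, g \in t -> (a : R) *: g = 0).
  split=> [g _|a u v hu hv g hg]; first by rewrite scale0r.
  by rewrite scalerDl -scalerA hu // hv // scaler0 addr0.
have -> : annm M = Smod (clA s).
  apply: smod_eq => a; split=> [h g _|h v] //.
  have [c ->] := hs v; rewrite scaler_sumr big1 // => i _.
  by rewrite scalerA mulrC -scalerA h ?scaler0 //; apply: mem_nth.
elim: s {hs} => [|g s IHs].
  rewrite (_ : Smod (clA [::]) = sT); first exact: (ad_refl hD).
  by apply: smod_eq.
apply: (ad_ext hD IHs).
have -> : Smod (clA (g :: s)) = scap (Smod (clA s)) (Smod (clA [:: g])).
  apply: smod_eq => a; split=> [h|[h1 h2] g'].
    by split=> g' hg'; apply: h; move: hg'; rewrite !inE => ->; rewrite ?orbT.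
  by rewrite inE => /orP[/eqP ->|/h1 //]; apply: h2; rewrite mem_head.
apply/(ad_iso2D hD).
have hf : lin (fun a : R^o => (a : R) *: g).
  by move=> a u v; rewrite scalerDl -scalerA.
have hiso : siso (fun a : R^o => (a : R) *: g) sT (Smod (clA [:: g])) (simg hf sT) s0.
  split=> // [a _|_ [a _ ->]|a _].
  - by exists a.
  - by exists a; rewrite // subrr.
  - by split=> [h g'|h]; [rewrite inE => /eqP -> | apply: h; rewrite mem_head].
have [hi _] := ad_iso hD (@le_sT _ _ _) (@s0_le _ _ _) hiso.
have : Dl (@fl R) ys (@sT R R^o) (Smod (clA [:: g])).
  by apply/hi; apply: (ad_sub hD (@s0_le _ _ _) (@le_sT _ _ _) hd).
by apply: (ad_sub hD); [apply: sle_addr | apply: le_sT].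
Qed.

(** Rescaling all exponents by a constant does not change the degree of growth. *)
Definition cle ys zs := exists2 c, (0 < c)%N &
  forall N, (0 < N)%N -> chl (pows N ys) <= chl (pows (c * N) zs).

Lemma cle_trans ys zs ts : cle ys zs -> cle zs ts -> cle ys ts.
Proof.
move=> [c hc h1] [c' hc' h2]; exists (c' * c)%N; first by rewrite muln_gt0 hc hc'.
move=> N hN; apply: le_trans (h1 N hN) _; rewrite -mulnA; apply: h2.
by rewrite muln_gt0 hc hN.
Qed.

Lemma cle_perm ys zs : good ys -> perm_eq ys zs -> cle ys zs.
Proof.
move=> h hp; exists 1%N => // N _; rewrite mul1n.
by rewrite (perm_chik k.+1 (len_addf R) (perm_map _ hp)) //; apply: good_pow.
Qed.

Lemma good_perm ys zs : perm_eq ys zs -> good ys -> good zs.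
Proof. by move=> hp; apply: (Dl_perm (len_addf R)); apply: perm_mem. Qed.

(** Some v^e is in Ann M + (u, ws), so by [idl_pow] v^(erN) is in Ann M + (u^N, ws^N). Hence u^N can
    be exchanged for a power of v, after which monotonicity raises the exponents of ws. *)
Lemma cle_exchange u v ws : jac v -> good (u :: ws) -> good (v :: ws) ->
  cle (u :: ws) (v :: ws).
Proof.
move=> hv hu hvw.
have [e he] := fl_nilpotent hv ((good_annm (u :: ws)).1 hu).
(* r comes from [idl_pow]; e + 1 in place of e makes the constant positive even when e = 0. *)
pose r := (size (u :: ws)).+1; exists (e.+1 * r)%N => // N hN.
have := idl_pow hN he; rewrite -exprM -/r => ht.
have {ht}ht : sadd (annm M) (sidl (pows N (u :: ws)) (@sT R R^o)) (v ^+ (e.+1 * r * N)).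
  have -> : (e.+1 * r * N = r * N + e * (r * N))%N by rewrite -mulnA mulSn.
  by rewrite exprD; apply: idlM.
have hle : (N <= e.+1 * r * N)%N by rewrite leq_pmull // muln_gt0.
have hg : good (v ^+ (e.+1 * r * N) :: pows N ws).
  (* The tag separates v from entries of ws that may equal v but carry another exponent. *)
  pose n (i : bool * R) := if i.1 then (e.+1 * r * N)%N else N.
  have := @Dl_pwr R _ (fun i : bool * R => i.2) _ _ n ((true, v) :: map (pair false) ws) M sT s0 (len_addf R).
  by rewrite !map_cons -!map_comp map_id /=; apply.
apply: le_trans (chik_ideal_le k (len_addf R) ht hg) _.
pose n (i : bool * R) := if i.1 then (e.+1 * r * N)%N else N.
have := @chik_pow_mono _ (fun i : bool * R => i.2) _ _ n (fun=> (e.+1 * r * N)%N) ((true, v) :: map (pair false) ws) k (len_addf R).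
rewrite !map_cons -!map_comp map_id; apply=> //.
by move=> [[] y].
Qed.

Variable m : smod (R^o : lmodType R).
Hypothesis hm : forall a : R, m a -> jac a.

(** One z completes the rest of both sequences. After x and y are exchanged for z, it joins the
    common tail ws, and the lists get shorter. *)
Lemma cle_sop xs ys ws : size xs = size ys -> {in xs ++ ys, forall a : R, m a} ->
  good (xs ++ ws) -> good (ys ++ ws) -> cle (xs ++ ws) (ys ++ ws).
Proof.
elim: xs ys ws => [|x xs IHxs] [|y ys] // ws; first by move=> _ _ h _; apply: cle_perm.
move=> /eqP; rewrite eqSS => /eqP hs hmxy hx hy.
have hxm : m x by apply: hmxy; rewrite mem_head.
have hym : m y by apply: hmxy; rewrite mem_cat mem_head orbT.
have comm t ts : sidl (t :: ts) (@sT R R^o) = sadd (sidl ts sT) (smul t sT).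
  by rewrite /= saddC.
have [z [hz hzx hzy]] : exists z : R, [/\ m z, good (z :: xs ++ ws) & good (z :: ys ++ ws)].
  have := (good_annm _).1 hx; have := (good_annm _).1 hy.
  rewrite !cat_cons !comm !saddA => f2 f1.
  have [z [hz f1' f2']] := fl_common hR hm hxm hym f1 f2.
  by exists z; split=> //; apply/good_annm; rewrite comm saddA.
rewrite !cat_cons in hx hy *.
apply: (cle_trans (zs := z :: xs ++ ws)); first exact: cle_exchange (hm hz) hx hzx.
apply: (cle_trans (zs := z :: ys ++ ws)); last exact: cle_exchange (hm hym) hzy hy.
have px : perm_eq (z :: xs ++ ws) (xs ++ z :: ws).
  exact: (permEl (perm_catCA [:: z] xs ws)).
have py : perm_eq (z :: ys ++ ws) (ys ++ z :: ws).
  exact: (permEl (perm_catCA [:: z] ys ws)).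
apply: (cle_trans (cle_perm hzx px)).
apply: (cle_trans (zs := ys ++ z :: ws)).
  apply: IHxs => //; [|exact: good_perm px hzx|exact: good_perm py hzy].
  by move=> a; rewrite mem_cat => /orP[h|h]; apply: hmxy; rewrite !(inE, mem_cat) h ?orbT.
by apply: cle_perm; [apply: good_perm py hzy | rewrite perm_sym].
Qed.

End Exchange.
End Comparison.

(** * Exponents in iterated additive functions *)

Section Final.
Variable R : comNzRingType.

Lemma ll_scale (D : dom R) l1 l2 c ys : addf D l1 ->
  (forall V (A B : smod V), D V A B -> l1 V A B = c * l2 V A B) ->
  forall V (A B : smod V), Dl D ys A B -> ll l1 ys A B = c * ll l2 ys A B.
Proof.
elim: ys D l1 l2 => [|y ys IHys] D l1 l2 hD h V A B hAB; first exact: h.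
apply: (IHys _ _ (lr l2 y) (Dr_addf hD y) _ _ _ _ hAB) => W A' B' h'.
by rewrite /lr !h ?mulrBr //; [apply: (Dr_ker hD) | case: h'].
Qed.

Lemma ll_pw (x : nat -> R) n (D : dom R) l S : addf D l ->
  forall V (A B : smod V), Dl D (map x S) A B ->
  ll l (map (pwr x n) S) A B = (\prod_(s <- S) n s)%N%:Z * ll l (map x S) A B.
Proof.
elim: S D l => [|s S IHS] D l hD V A B hAB; first by rewrite big_nil mul1r.
rewrite big_cons PoszM -mulrA -[RHS]mulrCA /=.
have e : forall V (A B : smod V), Dr D (x s) A B ->
    lr l (x s ^+ n s) A B = (n s)%:Z * lr l (x s) A B.
  by move=> W A' B'; apply: (lr_exp hD).
have hd : forall V (A B : smod V), Dr D (x s) A B -> Dr D (x s ^+ n s) A B.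
  by move=> W A' B'; apply: (Dr_exp hD).
(* The induction hypothesis is applied to l^(x^n) on the domain of l^x, where it equals n l^x. *)
have hadd : addf (Dr D (x s)) (lr l (x s ^+ n s)).
  have h1 := Dr_addf hD (x s); have h2 := Dr_addf hD (x s ^+ n s).
  split.
  - exact: ad_noeth h1.
  - exact: ad_refl h1.
  - exact: ad_split h1.
  - by move=> W A' B' C' hCB hBA /hd; apply: (ad_add h2).
  - move=> W W' f A' B' A'' B'' h3 h4 h5; split; first by have [] := ad_iso h1 h3 h4 h5.
    by move=> /hd; have [_] := ad_iso h2 h3 h4 h5.
  - by move=> W A' B' /hd; apply: (ad_ge0 h2).
rewrite (IHS _ _ hadd _ _ _ hAB); congr (_ * _).
exact: (ll_scale hadd e hAB).
Qed.

Lemma sop_fl (m : {pred R}) d (y : d.-tuple R) (M : lmodType R) :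
  noetherian R -> fin_gen M -> sop m y M -> Dl (@fl R) y (@sT R M) s0.
Proof.
move=> hR hM [_ _ /finite_length_idmul h]; rewrite (DlE _ _ _ (len_addf R)).
split; first exact: fin_gen_noeth.
by rewrite sadd_idl //; apply: s0_le.
Qed.

End Final.

(** * Growth of polynomials along the diagonal *)

Section PolynomialBounds.

Lemma meval_bound d (P : {mpoly rat[d]}) (c : nat) : exists2 C : rat, 0 <= C &
  forall N, (0 < N)%N -> P.@[fun=> (c * N)%:R] <= C * N%:R ^+ (msize P).-1.
Proof.
exists (\sum_(mm <- msupp P) `|P@_mm| * c%:R ^+ mdeg mm).
  by apply: sumr_ge0 => mm _; rewrite mulr_ge0 // exprn_ge0 // ler0n.
move=> N hN; rewrite mevalE mulr_suml big_seq [leRHS]big_seq; apply: ler_sum => mm hmm.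
have -> : \prod_(i < d) (c * N)%:R ^+ mm i = (c * N)%:R ^+ mdeg mm :> rat.
  by rewrite mdegE (big_morph _ (exprD _) (expr0 _)).
rewrite natrM exprMn mulrA.
have c0 e : 0 <= c%:R ^+ e :> rat by rewrite exprn_ge0 // ler0n.
apply: (@le_trans _ _ (`|P@_mm| * c%:R ^+ mdeg mm * N%:R ^+ mdeg mm)).
  apply: ler_wpM2r; first by rewrite exprn_ge0 // ler0n.
  by apply: ler_wpM2r => //; apply: ler_norm.
apply: ler_wpM2l; first by rewrite mulr_ge0.
rewrite -!natrX ler_nat leq_pexp2l //.
by have := msize_mdeg_lt hmm; case: (msize P).
Qed.

Lemma msize_sumX_exp d i : (msize ((\sum_(j < d) 'X_j) ^+ i : {mpoly rat[d]}) <= i.+1)%N.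
Proof.
elim: i => [|i IHi]; first by rewrite expr0 msize1.
rewrite exprS; set s := \sum_(j < d) _ in IHi *.
have hs : (msize s <= 2)%N.
  apply: leq_trans (msize_sum _ _ _) _; apply/bigmax_leqP => j _.
  by rewrite msizeX mdeg1.
have [->|s0'] := eqVneq s 0; first by rewrite mul0r msize0.
have [->|si0] := eqVneq (s ^+ i) 0; first by rewrite mulr0 msize0.
by rewrite msizeM // -subn1 leq_subLR; apply: leq_trans (leq_add hs IHi) _.
Qed.

(** The bounded sum is at least N^(q-1), because that coefficient is a positive integer, while P on
    the diagonal is at most a constant times N to its degree. *)
Lemma msize_ge d d' (P : {mpoly rat[d]}) (a : nat -> int) q c : (q <= d')%N -> (0 < c)%N ->
  (forall i, (i < d')%N -> 0 <= a i) -> (if q is r.+1 then 0 < a r else true) ->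
  (forall N, (0 < N)%N -> (\sum_(i < d') (N ^ i)%N%:Z * a i)%:~R <= P.@[fun=> (c * N)%:R]) ->
  (q <= msize P)%N.
Proof.
case: q => // r hrd hc ha har hb.
have low N : (0 < N)%N -> (N ^ r)%N%:R <= P.@[fun=> (c * N)%:R] :> rat.
  move=> hN; apply: le_trans (hb N hN).
  rewrite (bigD1 (Ordinal hrd)) //= -[(N ^ r)%N%:R]/((N ^ r)%N%:Z%:~R) ler_int.
  rewrite -[leLHS]addr0 lerD //; first by rewrite ler_peMr // -gtz0_ge1.
  by apply: sumr_ge0 => i _; rewrite mulr_ge0 // ha.
have [C hC0 hC] := meval_bound P c.
rewrite leqNgt; apply/negP => hlt.
have [P0|Pn0] := eqVneq P 0.
  by have := low 1%N isT; rewrite P0 meval0 exp1n ler10.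
have hP : (0 < msize P)%N by rewrite lt0n mmeasure_poly_eq0.
(* N exceeds C, against N^r <= C N^(deg P) with deg P < r. *)
pose N := (Num.bound C).+1.
have hN : (0 < N)%N by [].
have := le_trans (low N hN) (hC N hN).
have e : (r = (msize P).-1 + (r - (msize P).-1).-1.+1)%N.
  by rewrite prednK ?subnKC //; move: hP hlt; lia.
rewrite {1}e natrX exprD mulrC ler_pM2r; last by rewrite exprn_gt0 // ltr0n.
move=> h; have : N%:R <= C.
  apply: le_trans h; rewrite exprS ler_peMr ?ler0n // -natrX.
  by rewrite ler1n expn_gt0.
apply/negP; rewrite -ltNge; apply: lt_trans (archi_boundP hC0) _.
by rewrite ltr_nat.
Qed.
End PolynomialBounds.

(** * The formula and the degree p_k(M) *)

Section MainFormula.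
Variables (R : comNzRingType) (m : {pred R}) (M : lmodType R) (d : nat) (x : d.-tuple R).
Variable k : nat.
Hypotheses (hnoeth : noetherian R) (hloc : local_ring m) (hfg : fin_gen M).

(** Here [k] is the index of chi minus 1: these coefficients, formed from H_k, belong to
    chi_(k+1). *)
Definition dd_coef i : int := serre_mult (take i x)
  (submod (ann_by (koszulH (drop i.+1 x) M k) x`_i)).

Definition maximal_idl : smod (R^o : lmodType R).
Proof.
exists (fun a : R^o => (a : R) \in m); case: hloc => -[[h0 h1 h2] _] _.
by split.
Defined.

Lemma maximal_idl_jac (a : R) : maximal_idl a -> jac a.
Proof. exact: local_jac. Qed.

Lemma pows_enum (y : d.-tuple R) n :
  tval (pows y n) = map (pwr (tnth y) n) (enum 'I_d).
Proof. by rewrite -val_ord_tuple. Qed.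

Section OneSop.
Variable y : d.-tuple R.
Hypothesis hy : sop m y M.

Lemma chi_chl n : chi k.+1 (pows y n) M =
  chik M (@len R) k.+1 (map (pwr (tnth y) n) (enum 'I_d)).
Proof. by rewrite chi_chik pows_enum. Qed.

Lemma chi_const N : chi k.+1 (pows y (fun=> N)) M =
  chik M (@len R) k.+1 (map (fun a : R => a ^+ N) y).
Proof.
rewrite chi_chl -[in RHS](map_tnth_enum y) -map_comp; congr chik.
Qed.

Lemma chi_le_const n N : (forall i, (n i <= N)%N) ->
  chi k.+1 (pows y n) M <= chi k.+1 (pows y (fun=> N)) M.
Proof.
move=> hn; rewrite !chi_chl; apply: (chik_pow_mono _ (len_addf R) hn).
by rewrite map_tnth_enum; apply: sop_fl hy.
Qed.

End OneSop.

Lemma chi_sop_le (y z : d.-tuple R) : sop m y M -> sop m z M ->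
  exists2 c, (0 < c)%N & forall N, (0 < N)%N ->
  chi k.+1 (pows y (fun=> N)) M <= chi k.+1 (pows z (fun=> (c * N)%N)) M.
Proof.
move=> hy hz.
have gy := sop_fl hnoeth hfg hy; have gz := sop_fl hnoeth hfg hz.
have := @cle_sop R M (noetherian_noeth hnoeth) hfg k maximal_idl maximal_idl_jac y z [::].
rewrite !cats0 !size_tuple => /(_ erefl) [] //.
  move=> a; rewrite mem_cat; case: hy hz => _ hy _ [_ hz _].
  by case/orP=> [/hy|/hz].
move=> c hc h; exists c => // N hN; rewrite !chi_const; exact: h.
Qed.

Hypothesis hsop : sop m x M.
Hypothesis hdd : dd_sequence m x M.
Let xx i := x`_i.

Lemma x_iota : tval x = map xx (iota 0 d).
Proof. by rewrite -[RHS]/(mkseq _ _) -{2}(size_tuple x) mkseq_nth. Qed.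

Lemma xx_jac i : jac (xx i).
Proof.
have [hi|hi] := ltnP i d; last by rewrite /xx nth_default ?size_tuple //; apply: jac0.
apply: (local_jac hnoeth hloc); case: hdd => h _; apply: h.
by apply: mem_nth; rewrite size_tuple.
Qed.

(** The first i exponents come out as a factor by [ll_pw]; the others disappear by [kann_const],
    applied to e(x_1, .., x_i; -) as the additive function. *)
Lemma dd_term n i : (forall j, (0 < n j)%N) -> (i < d)%N ->
  Dl (@fl R) (map xx (iota 0 i)) (kann M (map xx (iota i.+1 (d - i.+1))) k (xx i))
     (kB M (map xx (iota i.+1 (d - i.+1))) k) /\
  ll (@len R) (map (pwr xx n) (iota 0 i))
    (kann M (map (pwr xx n) (iota i.+1 (d - i.+1))) k (pwr xx n i))
    (kB M (map (pwr xx n) (iota i.+1 (d - i.+1))) k) =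
  (\prod_(j <- iota 0 i) n j)%N%:Z * ll (@len R) (map xx (iota 0 i))
    (kann M (map xx (iota i.+1 (d - i.+1))) k (xx i))
    (kB M (map xx (iota i.+1 (d - i.+1))) k).
Proof.
move=> hn hi; set S := iota i.+1 _; set D := Dl (@fl R) (map xx (iota 0 i)).
have hD : addf D (ll (@len R) (map xx (iota 0 i))) by apply/Dl_addf/len_addf.
have hd : Dl D (map xx (i :: S)) (@sT R M) s0.
  have := sop_fl hnoeth hfg hsop.
  suff e : tval x = map xx (iota 0 i) ++ map xx (i :: S).
    by rewrite e /Dl foldl_cat.
  rewrite -map_cat -[i :: S]/(iota i (d - i.+1).+1) -iotaD.
  by rewrite subnSK // subnKC ?(ltnW hi) // x_iota.
have hdn t : (forall j, (0 < t j)%N) -> D _ (kann M (map (pwr xx t) S) k (pwr xx t i)) (kB M (map (pwr xx t) S) k).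
  move=> ht; apply: (Dr_ker hD); apply: (kos_dom k (Dr_addf hD _)).
  exact: (Dl_pwr t hD hd).
split.
  apply: (Dr_ker hD); apply: (kos_dom k (Dr_addf hD _)); exact: hd.
rewrite (ll_pw _ (len_addf R)); last exact: hdn.
congr (_ * _).
have hP := dd_colon (fin_gen_noeth hnoeth hfg) xx_jac hdd.
apply: (kann_const hP k hD hn (iota_uniq _ _) _ hd).
by move=> s; rewrite mem_iota => /andP[].
Qed.

Lemma dd_coefE i : (i < d)%N -> dd_coef i = ll (@len R) (map xx (iota 0 i))
    (kann M (map xx (iota i.+1 (d - i.+1))) k (xx i))
    (kB M (map xx (iota i.+1 (d - i.+1))) k) /\ 0 <= dd_coef i.
Proof.
move=> hi; have [h _] := dd_term (n := fun=> 1%N) (fun=> isT) hi.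
have et : take i x = map xx (iota 0 i) :> seq R.
  by rewrite x_iota -map_take take_iota (minn_idPl (ltnW hi)).
have ed : drop i.+1 x = map xx (iota i.+1 (d - i.+1)) :> seq R.
  by rewrite x_iota -map_drop drop_iota add0n.
have hD := Dl_addf (map xx (iota 0 i)) (len_addf R).
have [h1 h2] := koszulH_ann hD h.
rewrite /dd_coef /serre_mult chi_chik ed et (chik_serre (len_addf R) h1) h2.
by split=> //; apply: (ad_ge0 hD).
Qed.

Lemma dd_formula (n : 'I_d -> nat) : positive n ->
  chi k.+1 (pows x n) M = \sum_(i < d) (\prod_(j < d | (j < i)%N) n j)%N%:Z * dd_coef i.
Proof.
(* Exponents are needed for all natural indices; the default 1 keeps them positive. *)
move=> hn; pose n' (i : nat) := if insub i is Some j then n j else 1%N.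
have en i : n' (val i) = n i by rewrite /n' valK.
have hn' j : (0 < n' j)%N by rewrite /n'; case: insub.
have -> : pows x n = pows x (fun i => n' (val i)).
  by congr pows; apply: funext => i; rewrite en.
rewrite chi_chik pows_map.
have hg : Dl (@fl R) (map (pwr xx n') (iota 0 d)) (@sT R M) s0.
  apply: (Dl_pwr n' (len_addf R)); have := sop_fl hnoeth hfg hsop.
  by rewrite x_iota.
rewrite (chik_formula _ (len_addf R) hg) size_map size_iota.
apply: eq_bigr => i _; have hi := ltn_ord i.
have [_ e] := dd_term hn' hi.
rewrite -map_take take_iota (minn_idPl (ltnW hi)) -map_drop drop_iota add0n.
rewrite (nth_map 0%N) ?size_iota // nth_iota // add0n e (dd_coefE hi).1.
congr (Posz _ * _).
have -> : iota 0 i = index_iota 0 i by rewrite /index_iota subn0.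
rewrite big_mkord (big_ord_widen_cond d (fun _ => true)) ?(ltnW hi) //=.
by apply: eq_bigr => j _; rewrite -en.
Qed.

(* The degree of the polynomial of dd_formula is p_k(M): chi_k of the powers of
   any other system of parameters is comparable with that of x. *)
Lemma pk_size_dd : (k < d)%N -> exists q, [/\ (q <= d)%N, pk_size m k.+1 M = q
  & forall i, (q <= i < d)%N -> dd_coef i = 0].
Proof.
move=> hkd; have d0 : (0 < d)%N by apply: leq_ltn_trans hkd.
have a0 i : (i < d)%N -> 0 <= dd_coef i by move=> hi; have [] := dd_coefE hi.
(* The least such q is one more than the degree, and 0 for the zero polynomial, as in [msize]. *)
have ex : exists q, `[< forall i, (q <= i < d)%N -> dd_coef i = 0 >].
  by exists d; apply/asboolP => i /andP[h1 /(leq_ltn_trans h1)]; rewrite ltnn.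
case: (ex_minnP ex) => q /asboolP hq qmin.
have hqd : (q <= d)%N.
  by apply: qmin; apply/asboolP => i /andP[h1 /(leq_ltn_trans h1)]; rewrite ltnn.
have apos : (if q is r.+1 then 0 < dd_coef r else true) : bool.
  case: (q) hqd hq qmin => // r hrd hq qmin; rewrite lt_def a0 // andbT.
  apply/eqP => e; have : (r.+1 <= r)%N; last by rewrite ltnn.
  apply: qmin; apply/asboolP => i /andP[]; rewrite leq_eqVlt => /orP[/eqP <- //|h1 h2].
  by apply: hq; rewrite h1.
have constf N : (0 < N)%N ->
    chi k.+1 (pows x (fun=> N)) M = \sum_(i < d) (N ^ i)%N%:Z * dd_coef i.
  move=> hN; rewrite dd_formula; last by move=> i.
  apply: eq_bigr => i _; congr (Posz _ * _).
  by rewrite -(big_ord_widen d (fun=> N) (ltnW (ltn_ord i))) prod_nat_const card_ord.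
have lower d' (y : d'.-tuple R) P : sop m y M -> chi_bound k.+1 y M P -> (q <= msize P)%N.
  move=> hy hP.
  have ed : d' = d by case: hy hsop => [[h1 h2] _ _] [[h3 h4] _ _]; apply/eqP; rewrite eqn_leq h4 // h2.
  subst d'; have [c hc hle] := chi_sop_le hsop hy.
  apply: (msize_ge (a := dd_coef) hqd hc a0 apos) => N hN.
  rewrite -constf //; apply: le_trans (hP (fun=> (c * N)%N) _); last by move=> i; rewrite muln_gt0 hc.
  by rewrite ler_int; apply: hle.
have upper d' (y : d'.-tuple R) : sop m y M -> exists2 P, chi_bound k.+1 y M P & (msize P <= q)%N.
  move=> hy.
  have ed : d' = d by case: hy hsop => [[h1 h2] _ _] [[h3 h4] _ _]; apply/eqP; rewrite eqn_leq h4 // h2.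
  subst d'; have [c hc hle] := chi_sop_le hy hsop.
  (* With N the sum of the n_j, chi of y^n is at most chi of y^(N, .., N), hence at most chi of
     x^(cN, .., cN), which is the value of this polynomial. *)
  exists (\sum_(i < q) ((dd_coef i)%:~R * c%:R ^+ i) *: (\sum_(j < d) 'X_j) ^+ i).
    move=> n hn; pose N := (\sum_(j < d) n j)%N.
    have hnN j : (n j <= N)%N by rewrite /N (bigD1 j) //= leq_addr.
    have hN : (0 < N)%N by apply: leq_trans (hn (Ordinal d0)) (hnN _).
    apply: (@le_trans _ _ (chi k.+1 (pows x (fun=> (c * N)%N)) M)%:~R).
      by rewrite ler_int; apply: le_trans (chi_le_const hy hnN) (hle N hN).
    rewrite constf ?muln_gt0 ?hc //.
    rewrite (bigID (fun i : 'I_d => (i < q)%N)) /= [X in _ + X]big1 ?addr0; last first.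
      by move=> i; rewrite -leqNgt => hi; rewrite hq ?mulr0 // hi /=.
    rewrite -(big_ord_widen d (fun i => ((c * N) ^ i)%N%:Z * dd_coef i) hqd).
    rewrite /peval raddf_sum rmorph_sum /=; apply: ler_sum => i _.
    have hs : (\sum_(j < d) 'X_j).@[fun j => (n j)%:R] = N%:R :> rat.
      by rewrite raddf_sum /N natr_sum; apply: eq_bigr => j _; rewrite /= mevalXU.
    have {}hs : ((\sum_(j < d) 'X_j) ^+ i).@[fun j => (n j)%:R] = N%:R ^+ i :> rat.
      by rewrite rmorphXn /= hs.
    by rewrite mevalZ hs rmorphM /= -mulrA -exprMn mulrC -natrM -natrX.
  apply: leq_trans (msize_sum _ _ _) _; apply/bigmax_leqP => i _.
  apply: leq_trans (msizeZ_le _ _) _; apply: leq_trans (msize_sumX_exp _ _) _.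
  exact: ltn_ord.
(* [pk_size] ranges over all systems of parameters, so the defining set must be shown to have only
   one element. *)
exists q; split=> //; apply: xget_subset1; last first.
  move=> p p' [d1 [y1 [h1 [P1 hP1 <-] m1]]] [d2 [y2 [h2 [P2 hP2 <-] m2]]].
  have [Q1 hQ1 hq1] := upper _ _ h1; have [Q2 hQ2 hq2] := upper _ _ h2.
  apply/eqP; rewrite eqn_leq (leq_trans (m1 _ hQ1)) ?(leq_trans hq1) ?(lower _ _ _ h2 hP2) //.
  by rewrite (leq_trans (m2 _ hQ2)) // (leq_trans hq2) // (lower _ _ _ h1 hP1).
have [P hP hPq] := upper _ _ hsop.
exists d, x; split=> //; last by move=> P' hP'; apply: lower hsop hP'.
by exists P => //; apply/eqP; rewrite eqn_leq hPq (lower _ _ _ hsop hP).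
Qed.

End MainFormula.

Theorem theorem1p3 (R : comNzRingType) (m : {pred R}) (M : lmodType R)
  (d : nat) (x : d.-tuple R) (k : nat)
  (hnoeth : noetherian R) (hloc : local_ring m) (hfg : fin_gen M)
  (hdim : has_dim M d) (hsop : sop m x M) (hdd : dd_sequence m x M)
  (hk : (0 < k <= d)%N) :
  (exists P : {mpoly rat[d]}, forall n : 'I_d -> nat, positive n ->
     (chi k (pows x n) M)%:~R = peval P n) /\
  (forall n : 'I_d -> nat, positive n ->
     chi k (pows x n) M =
       \sum_(i < pk_size m k M) (\prod_(j < d | (j < i)%N) n j)%:Z *
         serre_mult (take i x)
           (submod (ann_by (koszulH (drop i.+1 x) M k.-1) x`_i))).
Proof.
case: k hk => // k /= hkd.
have hf := dd_formula k hnoeth hloc hfg hsop hdd; split.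
  exists (\sum_(i < d) (dd_coef M x k i)%:~R *: \prod_(j < d | (j < i)%N) 'X_j).
  move=> n hn; rewrite hf // /peval raddf_sum rmorph_sum /=.
  apply: eq_bigr => i _; rewrite mevalZ rmorphM /= mulrC; congr (_ * _).
  rewrite -pmulrn natr_prod rmorph_prod /=.
  by apply: eq_bigr => j _; rewrite mevalXU.
move=> n hn; rewrite hf //.
have [q [hqd -> hq]] := pk_size_dd hnoeth hloc hfg hsop hdd hkd.
rewrite (bigID (fun i : 'I_d => (i < q)%N)) /= [X in _ + X]big1 ?addr0; last first.
  by move=> i; rewrite -leqNgt => hi; rewrite hq ?mulr0 // hi /=.
by rewrite -(big_ord_widen d (fun i => (\prod_(j < d | (j < i)%N) n j)%N%:Z * dd_coef M x k i) hqd).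
Qed.
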